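(* Let $V$ be a potential as in the context (twice continuously differentiable on an open interval containing $1$, $V''>0$, $V'(1)=0$). There exist $\alpha_0=\alpha_0(V)>0$ and a constant $m_0=m_0(V)\in\mathbb R$ such that for every $\alpha\in(0,\alpha_0)$ and every $l\in(1-\alpha/2,1+\alpha/2)$, $$\lim_{\beta\to\infty}\ \sup_{N\ge 5}\ \sup_{m\ge m_0}\ \sup_{x\in A_2}\ \sup_{z\in\mathcal N}\ E_{P_{\beta,m,N}}\big[\,|\omega(x+z)-\omega(x)-lz|^2\,1_{\{\omega(x+z)\neq\diamond,\ \omega(x)\ne\diamond\}}\,\big]=0 .$$ Here $N$ ranges over integers, $m$ over reals, $\diamond$ is the symbol for a hole, and $P_{\beta,m,N}$ (which also depends on $\alpha,l,V$) is the Gibbs measure defined in the context.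
   Context: Potential. $V$ is a real-valued, twice continuously differentiable function on an open interval containing $1$, with $V''>0$ and $V'(1)=0$. The parameter $\alpha>0$ is always so small that $V$ is defined on $[1-\alpha,1+\alpha]$ (and $\alpha<1$), and $l\in(1-\alpha/2,1+\alpha/2)$. Lattice. Identify $\mathbb C$ with $\mathbb R^2$. Let $\tau=e^{\pi i/3}$, $A_2=\mathbb Z+\tau\mathbb Z$ (triangular lattice), $x\sim y$ iff $|x-y|=1$, and $\mathcal N=\{\tau^j:j\in\mathbb Z\}$ (the six neighbors of $0$). For $N\in\mathbb N$ let $I_N=\{x+\tau^2y:x,y\in\{0,\dots,N-1\}\}$ (representatives of $A_2/NA_2$) and $\Lambda_{lN}=[0,lN)+\tau^2[0,lN)$ (representatives of $\mathbb C/lNA_2$). For $x\in A_2$, $z\in\{1,\tau\}$ let $\Delta_{x,z}=\{x+sz+t\tau z:s,t>0,\ s+t<1\}$ (open triangle with corners $x,x+z,x+\tau z$), and $\mathcal T=\{\Delta_{x,z}:x\in A_2,z\in\{1,\tau\}\}$. Configurations. Let $\diamond$ be an extra symbol denoting a hole (defect). $\Omega^*_{l,N}$ is the set of $\omega\in(\mathbb C\cup\{\diamond\})^{A_2}$ such that for all $x,z\in A_2$: $\omega(x+Nz)=\omega(x)+lNz$ if $\omega(x)\ne\diamond$, and $\omega(x+Nz)=\diamond$ if $\omega(x)=\diamond$. Such $\omega$ is determined by its restriction to $I_N$, so $\Omega^*_{l,N}$ is identified with $(\mathbb C\cup\{\diamond\})^{I_N}$. Two configurations $\omega,\omega'$ are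 identified if there is $z\in A_2$ with $\omega(x)=\omega'(x+Nz)$ for all $x\in A_2$; $\underline\Omega_{l,N}$ is the quotient, identified with a measurable set of representatives in $\Omega^*_{l,N}$, e.g. those $\omega$ with $\omega(x)\in\Lambda_{lN}$ for the lexicographically smallest $x\in I_N$ with $\omega(x)\ne\diamond$ (together with the constant configuration $\diamond$); the choice is irrelevant. For $x\in A_2$ put $\hat\omega(x)=\omega(x)$ if $\omega(x)\neq\diamond$ and $\hat\omega(x)=\frac16\sum_{z\in\mathcal N}\omega(x+z)$ if $\omega(x)=\diamond$ (used for configurations satisfying (Ω2) below, so that the sum makes sense), and extend $\hat\omega$ to a map $\mathbb C\to\mathbb C$ that is affine linear on the closure of every triangle in $\mathcal T$. The set $\Omega_{l,N}$ of allowed configurations consists of all $\omega\in\underline\Omega_{l,N}$ with: (Ω1) $|\omega(x)-\omega(y)|\in(1-\alpha,1+\alpha)$ for all $x\sim y$ in $A_2$ with $\omega(x)\ne\diamond\ne\omega(y)$; (Ω2) for all $x,y\in A_2$, $\omega(x)=\omega(y)=\diamond$ only if $x=y$ or $|x-y|>2$; (Ω3) $\hat\omega:\mathbb C\to\mathbb C$ is bijective; (Ω4) $\operatorname{Im}\big(\frac{\hat\omega(x+\tau z)-\hat\omega(x)}{\hat\omega(x+z)-\hat\omega(x)}\big)>0$ for all $x\in A_2$, $z\in\mathcal N$. Gibbs measure. For $m\in\mathbb R$ and $\omega\in\Omega_{l,N}$, $$H_{m,N}(\omega)=\tfrac12\sum_{x\in I_N}\sum_{y\in A_2:\,y\sim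 x}1_{\{\omega(x)\ne\diamond,\ \omega(y)\neq\diamond\}}V(|\omega(x)-\omega(y)|)+m\sum_{x\in I_N}1_{\{\omega(x)=\diamond\}}.$$ Let $\lambda$ be Lebesgue measure on $\mathbb C$; $\mu_N$ is the restriction to $\underline\Omega_{l,N}$ of the product measure $(\lambda+\delta_\diamond)^{I_N}$ on $(\mathbb C\cup\{\diamond\})^{I_N}\cong\Omega^*_{l,N}$. For $\beta>0$, $Z_{\beta,m,N}=\int_{\Omega_{l,N}}e^{-\beta H_{m,N}}\,d\mu_N$ and $P_{\beta,m,N}(d\omega)=Z_{\beta,m,N}^{-1}e^{-\beta H_{m,N}(\omega)}\mu_N(d\omega)$, a probability measure on $\Omega_{l,N}$; $E_{P_{\beta,m,N}}$ is its expectation. The random variable in the claim is understood to be $0$ when the indicator vanishes. *)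

(* Defs.v *)
From HB Require Import structures.
From mathcomp Require Import all_boot all_order all_algebra.
From mathcomp Require Import ring lra zify.
From mathcomp Require Import complex.
From mathcomp Require Import all_classical all_reals all_analysis.

Set Implicit Arguments.
Unset Strict Implicit.
Unset Printing Implicit Defensive.

Import Order.TTheory GRing.Theory Num.Theory.
Import numFieldNormedType.Exports.
Import ComplexField.Normc.

Local Open Scope classical_set_scope.
Local Open Scope ring_scope.

(* [None] is the hole; a set of cells is measurable iff its trace on [T] is. *)
Definition option_display : measure_display -> measure_display.
Proof. exact. Qed.

Section option_measurable.
Context {d : measure_display} {T : measurableType d}.

Definition option_measurable : set (set (option T)) :=
  [set A | measurable (Some @^-1` A)].

Let option_measurable0 : option_measurable set0.
Proof. by rewrite /option_measurable /= preimage_set0. Qed.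

Let option_measurableC A : option_measurable A -> option_measurable (~` A).
Proof. by rewrite /option_measurable /= preimage_setC; exact: measurableC. Qed.

Let option_measurable_bigcup (F : (set (option T))^nat) :
  (forall i, option_measurable (F i)) -> option_measurable (\bigcup_i F i).
Proof.
by move=> mF; rewrite /option_measurable /= preimage_bigcup; exact: bigcupT_measurable.
Qed.

HB.instance Definition _ := @isMeasurable.Build (option_display d) (option T)
  option_measurable option_measurable0 option_measurableC
  option_measurable_bigcup.

Lemma measurable_Some : measurable_fun [set: T] (@Some T).
Proof. by move=> _ A mA; rewrite setTI. Qed.

End option_measurable.

Section hole_measure.
Local Open Scope ereal_scope.
Context {d : measure_display} {T : measurableType d} {R : realType}.
Variable mu : {sigma_finite_measure set T -> \bar R}.

Let mSome := @measurable_Some d T.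

Definition cell_measure : set (option T) -> \bar R := pushforward mu (@Some T).

Let cell_measure0 : cell_measure set0 = 0. Proof. exact: measure0. Qed.

Let cell_measure_ge0 A : 0 <= cell_measure A. Proof. exact: measure_ge0. Qed.

Let cell_measure_sigma_additive : semi_sigma_additive cell_measure.
Proof. exact: measure_semi_sigma_additive. Qed.

HB.instance Definition _ := isMeasure.Build _ _ _ cell_measure
  cell_measure0 cell_measure_ge0 cell_measure_sigma_additive.

Definition hole_measure : set (option T) -> \bar R :=
  measure_add cell_measure (\d_(@None T)).

Lemma hole_measureE A : hole_measure A = mu (Some @^-1` A) + \d_(@None T) A.
Proof. by rewrite /hole_measure measure_addE. Qed.

HB.instance Definition _ := Measure.on hole_measure.

Let hole_measure_sigma_finite : sigma_finite setT hole_measure.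
Proof.
have /sigma_finiteP[F [TF ndF Foo]] := sigma_finiteT mu.
exists (fun n => [set None] `|` Some @` F n).
  rewrite predeqE => -[t|]; split=> //.
  - have : setT t by []. rewrite TF => -[n _ Fnt] _.
    by exists n => //; right; exists t.
  - by move=> _; exists 0%N => //; left.
move=> n; have [mFn Fnoo] := Foo n.
have E : Some @^-1` ([set None] `|` Some @` F n) = F n.
  rewrite predeqE => t; split => [[//|[s Fs [<-//]]]|Ft].
  by right; exists t.
split; first by rewrite /measurable /= /option_measurable /= E.
rewrite [ltLHS]hole_measureE E lte_add_pinfty//.
by rewrite diracE ltry.
Qed.

HB.instance Definition _ :=
  Measure_isSigmaFinite.Build _ _ _ hole_measure hole_measure_sigma_finite.

End hole_measure.

(* The library's sigma-finite instance on [\x] cannot be inferred: it is shadowed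
   by the later subprobability one. *)
Lemma product_sigma_finite (d1 d2 : measure_display) (T1 : measurableType d1)
    (T2 : measurableType d2) (R : realType)
    (m1 : {sigma_finite_measure set T1 -> \bar R})
    (m2 : {sigma_finite_measure set T2 -> \bar R}) :
  sigma_finite [set: T1 * T2] (m1 \x m2)%E.
Proof.
have /sigma_finiteP[F [TF ndF Foo]] := sigma_finiteT m1.
have /sigma_finiteP[G [TG ndG Goo]] := sigma_finiteT m2.
exists (fun n => F n `*` G n).
  rewrite -setXTT TF TG predeqE => -[x y]; split.
    move=> [/= [n _ Fnx] [k _ Gky]]; exists (maxn n k) => //; split.
    - by move: x Fnx; exact/subsetPset/ndF/leq_maxl.
    - by move: y Gky; exact/subsetPset/ndG/leq_maxr.
  by move=> [n _ []/= ? ?]; split; exists n.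
move=> k; have [? ?] := Foo k; have [? ?] := Goo k.
split; first exact: measurableX.
by rewrite product_measure1E// lte_mul_pinfty// ge0_fin_numE.
Qed.

Section power_measure.
Local Open Scope ereal_scope.
Context {d : measure_display} {T : measurableType d} {R : realType}.
Variable mu : {sigma_finite_measure set T -> \bar R}.

Definition cons_pair n (p : T * n.-tuple T) : n.+1.-tuple T :=
  [tuple of p.1 :: p.2].

Lemma measurable_cons_pair n : measurable_fun setT (@cons_pair n).
Proof. by apply: measurable_cons. Qed.

Section step.
Variables (n : nat) (nu : {sigma_finite_measure set (n.-tuple T) -> \bar R}).

Definition power_step : set (n.+1.-tuple T) -> \bar R :=
  pushforward (mu \x nu) (@cons_pair n).

Let mcons := @measurable_cons_pair n.

Let power_step0 : power_step set0 = 0. Proof. exact: measure0. Qed.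

Let power_step_ge0 A : 0 <= power_step A. Proof. exact: measure_ge0. Qed.

Let power_step_sigma_additive : semi_sigma_additive power_step.
Proof. exact: measure_semi_sigma_additive. Qed.

HB.instance Definition _ := isMeasure.Build _ _ _ power_step
  power_step0 power_step_ge0 power_step_sigma_additive.

Let power_step_sigma_finite : sigma_finite setT power_step.
Proof.
have /sigma_finiteP[F [TF ndF Foo]] := product_sigma_finite mu nu.
pose g (t : n.+1.-tuple T) := (thead t, [tuple of behead t]).
have gK : cancel (@cons_pair n) g.
  by case=> x t; rewrite /g /cons_pair theadE; congr pair; apply: val_inj.
have mg : measurable_fun setT g.
  by apply/measurable_fun_pairP; split; [exact: measurable_tnth|exact: measurable_behead].
exists (fun k => g @^-1` F k).
  by rewrite -preimage_bigcup -TF preimage_setT.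
move=> k; have [mFk Fkoo] := Foo k; split.
  by rewrite -[X in measurable X]setTI; exact: mg.
rewrite /power_step /pushforward -comp_preimage (_ : _ \o _ = id) //.
by apply/funext => p /=; rewrite gK.
Qed.

HB.instance Definition _ :=
  Measure_isSigmaFinite.Build _ _ _ power_step power_step_sigma_finite.

End step.

Fixpoint power_measure n : {sigma_finite_measure set (n.-tuple T) -> \bar R} :=
  match n with
  | 0 => \d_([tuple] : 0.-tuple T)
  | n'.+1 => power_step (power_measure n')
  end.

End power_measure.

Lemma power_measure_box (d : measure_display) (T : measurableType d)
    (R : realType) (mu : {sigma_finite_measure set T -> \bar R}) (n : nat)
    (A : 'I_n -> set T) : (forall i, measurable (A i)) ->
  power_measure mu n [set t | forall i, A i (tnth t i)] =
  (\prod_(i < n) mu (A i))%E.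
Proof.
elim: n A => [|n IHn] A mA /=.
  rewrite big_ord0 diracE mem_set//; by case.
rewrite /power_step /pushforward big_ord_recl -(IHn (fun i => A (lift ord0 i)))//.
rewrite -product_measure1E//; last first.
  rewrite [X in measurable X](_ : _ =
      \bigcap_(i in [set: 'I_n]) ((@tnth n T)^~ i @^-1` A (lift ord0 i))).
    apply: fin_bigcap_measurable => // i _.
    by rewrite -[X in measurable X]setTI; exact: (@measurable_tnth _ T n i).
  by rewrite predeqE => t; split=> [h i _|h i]; [exact: h|exact: (h i I)].
congr (_ _); rewrite predeqE => -[x t]; split => /= [h|[h0 h] i].
  split; first by have := h ord0; rewrite tnth0.
  by move=> i; have := h (lift ord0 i); rewrite tnthS.
by case: (unliftP ord0 i) => [j|] ->; rewrite ?tnthS ?tnth0.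
Qed.

Notation plane R := (measurableTypeR R * measurableTypeR R)%type.

Section plane_measure.
Variable R : realType.

Definition plane_measure : set (plane R) -> \bar R :=
  (@lebesgue_measure R \x @lebesgue_measure R)%E.

HB.instance Definition _ := Measure.on plane_measure.

HB.instance Definition _ := Measure_isSigmaFinite.Build _ _ _ plane_measure
  (product_sigma_finite (@lebesgue_measure R) (@lebesgue_measure R)).

End plane_measure.

(* A point [(a, b)] of the triangular lattice stands for [a + tau^2 b]. *)
Notation A2 := (int * int)%type.

Section triangular_lattice.
Variable R : realType.

Definition tau : R[i] := (cos (pi / 3) +i* sin (pi / 3))%C.

Definition emb (x : A2) : R[i] := x.1%:~R + tau ^+ 2 * x.2%:~R.

(* Multiplication by [tau]; see [emb_rot]. *)
Definition rot (z : A2) : A2 := (z.1 - z.2, z.1).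

Definition unit1 : A2 := (1, 0).

(* [tau^0, ..., tau^5]; see [nbrsP]. *)
Definition nbrs : seq A2 := traject rot unit1 6.

Definition adj (x y : A2) : bool := normc (emb x - emb y) == 1.

Lemma cos_pi3 : cos (pi / 3) = 1 / 2 :> R.
Proof.
have pi0 := @pi_gt0 R.
have c0 : 0 < cos (pi / 3) :> R by apply: cos_gt0_pihalf; lra.
have s2 : sin (pi / 3) * sin (pi / 3) = 1 - cos (pi / 3) * cos (pi / 3) :> R.
  by have := cos2Dsin2 (pi / 3 : R); rewrite !expr2; lra.
have : cos (pi / 3 + pi / 3 + pi / 3) = -1 :> R.
  by rewrite -cospi; congr cos; field.
rewrite !(cosD, sinD); move: c0 s2; set c := cos _; set s := sin _ => c0 s2 h.
have /eqP : (c + 1) * (2 * c - 1) ^+ 2 = 0.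
  transitivity (4 * c * c * c - 3 * c + 1); first by ring.
  have : (c * c - s * s) * c - (s * c + c * s) * s = 4 * c * c * c - 3 * c.
    transitivity (c * c * c - 3 * c * (s * s)); first by ring.
    by rewrite s2; ring.
  by move=> <-; rewrite h; ring.
by rewrite mulf_eq0 expf_eq0 /= => /orP[]/eqP; lra.
Qed.

Lemma sin_pi3_sqr : sin (pi / 3) ^+ 2 = 3 / 4 :> R.
Proof. by have := cos2Dsin2 (pi / 3 : R); rewrite cos_pi3; lra. Qed.

Lemma tau2 : tau ^+ 2 = tau - 1.
Proof.
apply/eqP; rewrite /tau expr2 eq_complex /=.
by rewrite -[X in _ - X]expr2 sin_pi3_sqr cos_pi3; apply/andP; split; apply/eqP; field.
Qed.

Lemma emb_rot z : emb (rot z) = tau * emb z.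
Proof.
rewrite /emb /rot /= rmorphB /=; set a := z.1%:~R; set b := z.2%:~R.
have -> : tau * (a + tau ^+ 2 * b) = tau * a + tau * tau ^+ 2 * b by ring.
have -> : tau * tau ^+ 2 = -1 by rewrite tau2 mulrBr -expr2 tau2; ring.
by rewrite tau2; ring.
Qed.

Lemma embE (z : A2) :
  emb z = ((z.1%:~R - z.2%:~R / 2) +i* (sin (pi / 3) * z.2%:~R))%C.
Proof.
rewrite /emb tau2 /tau.
have H (k : int) : k%:~R = (k%:~R : R)%:C%C by rewrite rmorph_int.
by apply/eqP; rewrite eq_complex !H /= cos_pi3; apply/andP; split; apply/eqP; field.
Qed.

Lemma normc_embB (x y : A2) : normc (emb x - emb y) =
  Num.sqrt ((y.1 - x.1) ^+ 2 - (y.1 - x.1) * (y.2 - x.2) + (y.2 - x.2) ^+ 2)%:~R.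
Proof.
rewrite !embE /= /normc; congr Num.sqrt.
rewrite -mulrBr exprMn sin_pi3_sqr.
rewrite rmorphD rmorphB rmorphM /= !rmorphXn /= !rmorphB /=.
by field.
Qed.

Lemma adjP (x y : A2) : adj x y = (y - x \in nbrs).
Proof.
rewrite /adj normc_embB.
have -> : y - x = (y.1 - x.1, y.2 - x.2) by [].
move: (y.1 - x.1) (y.2 - x.2) => a b.
have -> : (Num.sqrt ((a ^+ 2 - a * b + b ^+ 2)%:~R : R) == 1) =
    (a ^+ 2 - a * b + b ^+ 2 == 1).
  apply/eqP/eqP => [|->]; last by rewrite sqrtr1.
  move=> /(congr1 (fun u => u ^+ 2)); rewrite sqr_sqrtr ?expr1n.
    by move=> h; apply: (@intr_inj R); rewrite h.
  by rewrite ler0z; nia.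
rewrite !inE /rot /=.
apply/eqP/idP => [h|]; last first.
  by do ?[move=> /orP[/eqP[-> ->]//|]]; move=> /eqP[-> ->].
have hb : -1 <= b <= 1 by nia.
have ha : -1 <= a <= 1 by nia.
have : b = -1 \/ b = 0 \/ b = 1 by lia.
have : a = -1 \/ a = 0 \/ a = 1 by lia.
by case=> [|[|]] Ea [|[|]] Eb; move: h; rewrite Ea Eb.
Qed.

Lemma emb_iter_rot n : emb (iter n rot unit1) = tau ^+ n.
Proof.
elim: n => [|n IHn] /=; first by rewrite /emb /= mulr0 addr0.
by rewrite emb_rot IHn exprS.
Qed.

Lemma nbrsP (z : A2) : z \in nbrs <-> exists j : int, emb z = tau ^ j.
Proof.
split=> [/trajectP[n _ ->]|[j Ej]]; first by exists n%:Z; rewrite emb_iter_rot.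
have : adj 0 z.
  rewrite /adj [emb 0](_ : _ = 0) ?sub0r ?normcN; last by rewrite /emb mulr0 addr0.
  have n1 : normc tau = 1 by rewrite /normc /tau cos2Dsin2 sqrtr1.
  have nX n : normc (tau ^+ n) = 1.
    by elim: n => [|n IHn]; rewrite ?normc1// exprS normcM n1 IHn mulr1.
  by rewrite Ej; case: j {Ej} => n /=; rewrite ?normcV nX ?invr1.
by rewrite adjP subr0.
Qed.

End triangular_lattice.

Definition in_box (N : nat) (x : A2) : bool :=
  (0 <= x.1 < N%:Z) && (0 <= x.2 < N%:Z).

Definition lex_lt (x y : A2) : bool := (x.1 < y.1) || (x.1 == y.1) && (x.2 < y.2).

Section configurations.
Variable R : realType.

Definition config := A2 -> option R[i].

Implicit Types (om : config) (x y z : A2) (l alpha : R) (N : nat).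

Definition hole om x : bool := om x == None.

(* Junk value [0] at a hole. *)
Definition pos om x : R[i] := odflt 0 (om x).

Definition periodic l N om : Prop := forall x z,
  om (x + z *+ N) = omap (fun p => p + (l * N%:R)%:C%C * emb R z) (om x).

(* The periodic configuration whose value at [(i, j)] in the box is the entry
   [i * N + j] of [w]. *)
Definition extend l N (w : (N * N).-tuple (option (plane R))) : config := fun x =>
  let i := `|(x.1 %% N)%Z|%N in
  let j := `|(x.2 %% N)%Z|%N in
  let q : A2 := ((x.1 %/ N)%Z, (x.2 %/ N)%Z) in
  omap (fun p => (p.1 +i* p.2)%C + (l * N%:R)%:C%C * emb R q)
       (nth None w (i * N + j)).

Lemma pair_mulrn z N : z *+ N = (z.1 * N%:Z, z.2 * N%:Z).
Proof.
elim: N => [|N IHN]; first by rewrite !mulr0.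
by rewrite mulrSr IHN; case: z {IHN} => a b; congr pair => /=; rewrite intS; ring.
Qed.

Lemma embD x z : emb R (x + z) = emb R x + emb R z.
Proof. by rewrite /emb /= !rmorphD /=; ring. Qed.

Lemma extend_periodic l N (w : (N * N).-tuple (option (plane R))) :
  (0 < N)%N -> periodic l N (extend l w).
Proof.
move=> N0 x z; rewrite /extend pair_mulrn /=.
have N1 : N%:Z != 0 by rewrite eqz_nat -lt0n.
rewrite ![_ + _ * N%:Z]addrC !modzMDl !divzMDl//.
case: (nth _ _ _) => //= p; congr Some.
rewrite [emb R (_, _)](_ : _ = emb R z +
  emb R ((x.1 %/ N)%Z, (x.2 %/ N)%Z)); last by rewrite -embD.
by ring.
Qed.

Lemma extend_box l N (w : (N * N).-tuple (option (plane R))) (i j : nat) :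
  (i < N)%N -> (j < N)%N ->
  extend l w (i%:Z, j%:Z) =
  omap (fun p : plane R => (p.1 +i* p.2)%C) (nth None w (i * N + j)).
Proof.
move=> iN jN; rewrite /extend /= !modz_nat !divz_nat !modn_small// !divn_small//.
by case: (nth _ _ _) => //= p; rewrite /emb /= !mulr0 addr0 mulr0 addr0.
Qed.

(* The configurations with the stated periodicity are exactly the extensions of
   families indexed by the box. *)
Lemma extend_bij l N om : (0 < N)%N -> periodic l N om ->
  exists! w : (N * N).-tuple (option (plane R)), extend l w = om.
Proof.
move=> N0 pom; have N1 : N%:Z != 0 by rewrite eqz_nat -lt0n.
pose c (p : R[i]) : plane R := (complex.Re p, complex.Im p).
pose f (k : nat) : option (plane R) := omap c (om ((k %/ N)%N%:Z, (k %% N)%N%:Z)).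
pose w : (N * N).-tuple (option (plane R)) := [tuple f k | k < N * N].
have wE i j : (i < N)%N -> (j < N)%N ->
    nth None w (i * N + j) = omap c (om (i%:Z, j%:Z)).
  move=> iN jN; have kN : (i * N + j < N * N)%N by nia.
  rewrite -[(i * N + j)%N]/(val (Ordinal kN)) -tnth_nth tnth_mktuple /f /=.
  by rewrite divnMDl// divn_small// addn0 modnMDl modn_small.
have absK (a : int) : (`|(a %% N)%Z|%N < N)%N /\ `|(a %% N)%Z|%N%:Z = (a %% N)%Z.
  have h0 := modz_ge0 a N1; have h1 : (a %% N)%Z < N%:Z by rewrite ltz_pmod// ltz_nat.
  by split; lia.
exists w; split.
  apply/funext => x; rewrite /extend /= wE; [|exact: (absK _).1|exact: (absK _).1].
  rewrite !(absK _).2.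
  have xE : x = ((x.1 %% N)%Z, (x.2 %% N)%Z) +
      ((x.1 %/ N)%Z, (x.2 %/ N)%Z) *+ N.
    by rewrite pair_mulrn /=; case: x => a b; congr pair; rewrite /= addrC -divz_eq.
  by rewrite [in RHS]xE pom; case: (om _) => //= -[a b].
move=> w' Ew'; apply: eq_from_tnth => k.
have iN : (k %/ N < N)%N by rewrite ltn_divLR.
have jN : (k %% N < N)%N by rewrite ltn_mod.
rewrite !(tnth_nth None) (divn_eq k N) wE// -Ew' extend_box//.
by case: (nth _ _ _) => //= -[a b].
Qed.

(* The value at a hole whose six neighbours are occupied is their mean. *)
Definition hat om x : R[i] :=
  if om x is Some p then p else 6^-1 * \sum_(z <- nbrs) pos om (x + z).

(* [F] is affine on the closed triangle with corners [x], [x + z], [x + tau z]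
   for every [x] and every [z] in [{1, tau}], with the values [f] at corners;
   these triangles tile the plane, so [F] is determined by [f]. *)
Definition affine_extension (f : A2 -> R[i]) (F : R[i] -> R[i]) : Prop :=
  forall x z, z \in [:: unit1; rot unit1] ->
  forall s t : R, 0 <= s -> 0 <= t -> s + t <= 1 ->
    F (emb R x + s%:C%C * emb R z + t%:C%C * emb R (rot z)) =
    f x + s%:C%C * (f (x + z) - f x) + t%:C%C * (f (x + rot z) - f x).

Definition fundamental_domain (L : R) : set R[i] :=
  [set p | exists s t : R,
    [/\ 0 <= s < L, 0 <= t < L & p = s%:C%C + tau R ^+ 2 * t%:C%C]].

(* The representative of the class of [om] under relabelling by [N z]. *)
Definition normalized l N om : Prop := forall x p,
  in_box N x -> om x = Some p ->
  (forall y, in_box N y -> lex_lt y x -> om y = None) ->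
  fundamental_domain (l * N%:R) p.

Definition Omega1 alpha om : Prop := forall x y,
  adj R x y -> ~~ hole om x -> ~~ hole om y ->
  1 - alpha < normc (pos om x - pos om y) < 1 + alpha.

Definition Omega2 om : Prop := forall x y,
  hole om x -> hole om y -> x = y \/ 2 < normc (emb R x - emb R y).

Definition Omega3 om : Prop :=
  exists2 F : R[i] -> R[i], affine_extension (hat om) F & bijective F.

Definition Omega4 om : Prop := forall x z, z \in nbrs ->
  0 < complex.Im ((hat om (x + rot z) - hat om x) / (hat om (x + z) - hat om x)).

Definition allowed alpha l N om : Prop :=
  [/\ normalized l N om, Omega1 alpha om, Omega2 om, Omega3 om & Omega4 om].

Definition Omega alpha l N : set ((N * N).-tuple (option (plane R))) :=
  [set w | allowed alpha l N (extend l w)].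

End configurations.

Section gibbs_measure.
Variables (R : realType) (V : R -> R) (alpha l beta m : R) (N : nat).

Local Notation space := ((N * N).-tuple (option (plane R))).

Definition box_point (k : 'I_N * 'I_N) : A2 := (k.1%:Z, k.2%:Z).

Definition pair_energy (om : config R) (x y : A2) : R :=
  if hole om x || hole om y then 0 else V (normc (pos om x - pos om y)).

Definition hamiltonian (om : config R) : R :=
  2^-1 * (\sum_(k : 'I_N * 'I_N) \sum_(z <- nbrs)
            pair_energy om (box_point k) (box_point k + z)) +
  m * \sum_(k : 'I_N * 'I_N) (hole om (box_point k))%:R.

(* Not restricted to normalized configurations: it is only ever integrated over
   subsets of [Omega], whose elements are normalized. *)
Definition mu : set space -> \bar R :=
  power_measure (hole_measure (@plane_measure R)) (N * N).

Definition gibbs_weight (w : space) : \bar R :=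
  (expR (- (beta * hamiltonian (extend l w))))%:E.

Definition partition_function : \bar R :=
  (\int[mu]_(w in @Omega R alpha l N) gibbs_weight w)%E.

Definition gibbs (A : set space) : \bar R :=
  (partition_function^-1 *
   \int[mu]_(w in A `&` @Omega R alpha l N) gibbs_weight w)%E.

Definition sq_deviation (om : config R) (x z : A2) : R :=
  if hole om (x + z) || hole om x then 0
  else normc (pos om (x + z) - pos om x - l%:C%C * emb R z) ^+ 2.

End gibbs_measure.

Section potential.
Variables (R : realType) (D : set R) (V : R -> R).

(* [V] is total; only its values on the open interval [D] matter. *)
Definition potential : Prop :=
  [/\ open D, is_interval D, D 1,
      forall r, D r ->
        [/\ derivable V r 1, derivable (derive1 V) r 1,
            {for r, continuous (derive1 (derive1 V))}
          & 0 < derive1 (derive1 V) r]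
    & derive1 V 1 = 0].

Definition admissible (alpha : R) : Prop :=
  [/\ 0 < alpha, alpha < 1 & `[1 - alpha, 1 + alpha] `<=` D].

End potential.

(* Main.v *)
(* By convexity of V the energy exceeds its value at the perfect lattice by a
   constant times the sum of |r - l|^2 over the bonds, r being the bond length, up
   to V'(l) times the sum of r - l, whose first-order part sums to zero over the
   torus and whose remainder is quadratic; V'(l) is small since V'(1) = 0.  By Heron's
   formula the squared bond elongations of a positively oriented triangle control
   its distance from the equilateral ones, and since the oriented area is a null
   Lagrangian, summing over all triangles bounds the whole Dirichlet energy of the
   displacement x |-> omega(x) - l x (discrete rigidity).  Each hole spoils a
   bounded number of bonds, which a large m pays for.

   So a total square deviation of at least eps N^2 costs an energy of order
   eps N^2.  Placing the particles one after the other, each within bounded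
   distance of an earlier one, shows that Omega has measure at most C^(N^2); on the
   other side, small independent perturbations of the perfect lattice bound the
   partition function from below.  For large beta the energy cost beats both, hence
   the mean total deviation is at most 2 eps N^2, and by translation invariance
   every bond has the same share of it. *)
From HB Require Import structures.
From mathcomp Require Import all_boot all_order all_algebra.
From mathcomp Require Import ring lra zify.
From mathcomp Require Import complex.
From mathcomp Require Import all_classical all_reals all_analysis.
From mathcomp Require Import measurable_realfun.
(* After the other imports, lest [seq.rot] shadow [rot]. *)
Require Import Defs.

Set Implicit Arguments.
Unset Strict Implicit.
Unset Printing Implicit Defensive.

Import Order.TTheory GRing.Theory Num.Theory.
Import numFieldNormedType.Exports.
Import ComplexField.Normc.

Local Open Scope classical_set_scope.
Local Open Scope ring_scope.

(** Two obstacles shape the proof. [Omega] is not shown to be measurable, so integrals over it are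
    suprema over simple functions and [gibbs] need not be additive. The remedy is a measurable
    subset of [Omega] that carries its whole weight. This subset need not be invariant under
    relabelling, and relabelling also destroys the normalization; translation invariance is
    therefore proved piecewise, with one piece for each period that restores the normalization.

    The estimates must be uniform in [N], [m] and the bond. Energy cost, entropy and the lower bound
    for the partition function are all extensive, so the ratio of weights is the N^2-th power of a
    number that tends to 0 as beta grows. The lower bound uses configurations without holes and is
    thus free of [m]. That these are allowed requires a global bijection of the plane; it comes from
    a contraction argument for the piecewise affine interpolation of the perturbation. *)

(** * Periodic functions on the lattice and their sums over a box *)

Section box_sums.
Variable n : nat.
Local Notation N := n.+1.

Definition wrap (x : A2) : 'I_N * 'I_N :=
  (inord `|(x.1 %% N)%Z|%N, inord `|(x.2 %% N)%Z|%N).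

Definition quo (x : A2) : A2 := ((x.1 %/ N)%Z, (x.2 %/ N)%Z).

Lemma modz_ord (a : int) : (`|(a %% N)%Z| < N)%N /\ `|(a %% N)%Z|%N%:Z = (a %% N)%Z.
Proof.
have N0 : N%:Z != 0 by [].
have h0 := modz_ge0 a N0; have h1 : (a %% N)%Z < N%:Z by rewrite ltz_pmod.
by split; lia.
Qed.

Lemma box_wrap x : box_point (wrap x) = ((x.1 %% N)%Z, (x.2 %% N)%Z).
Proof.
have [h1 e1] := modz_ord x.1; have [h2 e2] := modz_ord x.2.
by rewrite /box_point /wrap /= !inordK// e1 e2.
Qed.

Lemma wrap_quo x : x = box_point (wrap x) + quo x *+ N.
Proof.
rewrite box_wrap pair_mulrn; case: x => a b; congr pair => /=;
by rewrite addrC -divz_eq.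
Qed.

Lemma wrap_box k : wrap (box_point k) = k.
Proof.
case: k => i j; rewrite /wrap /=; congr pair; apply: val_inj => /=;
by rewrite !modz_nat /= modn_small// inordK.
Qed.

Lemma wrap_period x z : wrap (x + z *+ N) = wrap x.
Proof. by rewrite /wrap pair_mulrn /= ![_ + _ * _]addrC !modzMDl. Qed.

Definition per {T : Type} (g : A2 -> T) := forall x z, g (x + z *+ N) = g x.

Lemma per_wrap T (g : A2 -> T) x : per g -> g (box_point (wrap x)) = g x.
Proof. by move=> pg; rewrite [in RHS](wrap_quo x) pg. Qed.

(** Translation by [y] modulo periods permutes the box, which makes box sums of periodic functions
    translation invariant. *)
Lemma wrap_addK y : cancel (fun k => wrap (box_point k + y)) (fun k => wrap (box_point k - y)).
Proof.
move=> k /=; set a := wrap (box_point k + y).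
have [q E] : exists q, box_point k + y = box_point a + q *+ N.
  by exists (quo (box_point k + y)); exact: wrap_quo.
have -> : box_point a - y = box_point k + (- q) *+ N.
  by rewrite -[box_point k](addrK y) E mulNrn addrAC addrK.
by rewrite wrap_period wrap_box.
Qed.

Lemma sum_shift (W : nmodType) (g : A2 -> W) y : per g ->
  \sum_(k : 'I_N * 'I_N) g (box_point k + y) = \sum_(k : 'I_N * 'I_N) g (box_point k).
Proof.
move=> pg; rewrite [RHS](reindex_inj (can_inj (wrap_addK y))) /=.
by apply: eq_bigr => k _; rewrite per_wrap.
Qed.

End box_sums.

Lemma rot_rot z : rot (rot z) = rot z - z.
Proof. by rewrite /rot; case: z => a b; congr pair => /=; ring. Qed.

Lemma rot_nbrs z : z \in nbrs -> rot z \in nbrs.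
Proof. by rewrite !inE => /or4P[|||/or3P[||]] /eqP ->. Qed.

Lemma opp_nbrs z : z \in nbrs -> - z \in nbrs.
Proof. by rewrite !inE => /or4P[|||/or3P[||]] /eqP ->. Qed.

Lemma sum_rot (W : nmodType) (F : A2 -> W) :
  \sum_(z <- nbrs) F (rot z) = \sum_(z <- nbrs) F z.
Proof.
rewrite -(big_map rot predT F) (_ : map rot nbrs = seq.rot 1 nbrs)//.
by apply: perm_big; rewrite perm_rot.
Qed.

Lemma sum_opp (W : nmodType) (F : A2 -> W) :
  \sum_(z <- nbrs) F (- z) = \sum_(z <- nbrs) F z.
Proof.
rewrite -(big_map -%R predT F) (_ : map _ nbrs = seq.rot 3 nbrs)//.
by apply: perm_big; rewrite perm_rot.
Qed.

(** * Triangles: distance from the equilateral shape in terms of the sides *)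

Section plane_geometry.
Variable R : realType.
Implicit Types d e : R[i].

Definition sqn d : R := complex.Re d ^+ 2 + complex.Im d ^+ 2.

Lemma sqn_ge0 d : 0 <= sqn d.
Proof. by rewrite addr_ge0// sqr_ge0. Qed.

Lemma normc_sqr d : normc d ^+ 2 = sqn d.
Proof. by case: d => a b; rewrite /normc sqr_sqrtr// addr_ge0// sqr_ge0. Qed.

Lemma normc_ge0 d : 0 <= normc d.
Proof. by case: d => a b; exact: sqrtr_ge0. Qed.

Lemma sin_pi3_gt0 : 0 < sin (pi / 3) :> R.
Proof. by apply: sin_gt0_pi; have := @pi_gt0 R; lra. Qed.

(** Twice the signed area of the triangle [0, d, e]. *)
Definition area2 d e : R :=
  complex.Re d * complex.Im e - complex.Im d * complex.Re e.

(** Expanding the square leaves the inner product of d and e, which polarization expresses by the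
    three sides, and their determinant; 2 sin(pi/3) is the square root of 3. The signed area is thus
    the only part that is not a sum of squared sides. *)
Lemma sqn_conformal d e : sqn (e - tau R * d) =
  2^-1 * (sqn d + sqn e + sqn (e - d)) - 2 * sin (pi / 3) * area2 d e.
Proof.
case: d e => a b [c f]; rewrite /sqn /area2 /tau /=.
have := sin_pi3_sqr R; rewrite cos_pi3; set s := sin _ => hs.
apply/eqP; rewrite -subr_eq0; apply/eqP.
transitivity ((s ^+ 2 - 3 / 4) * (a ^+ 2 + b ^+ 2)); first by field.
by rewrite hs subrr mul0r.
Qed.

Lemma heron_area d e :
  4 * area2 d e ^+ 2 = 4 * sqn d * sqn e - (sqn d + sqn e - sqn (e - d)) ^+ 2.
Proof. by case: d e => a b [c f]; rewrite /sqn /area2 /=; ring. Qed.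

Lemma area2_gt0 d e : 0 < complex.Im (e / d) -> 0 < area2 d e.
Proof.
case: d e => a b [c f]; rewrite /area2 /=; set n2 := _ + b ^+ 2.
have [->|n0] := eqVneq n2 0; first by rewrite invr0 !mulr0 oppr0 mulr0 addr0 ltxx.
have n2_gt0 : 0 < n2 by rewrite lt_neqAle eq_sym n0 addr_ge0 ?sqr_ge0.
have -> : c * - (b / n2) + f * (a / n2) = (a * f - b * c) / n2.
  by move: (n2^-1) => v; ring.
by rewrite pmulr_lgt0// invr_gt0.
Qed.

(* [e - tau d] vanishes exactly when [0, d, e] is equilateral and positively
   oriented; by Heron's formula it is controlled by the side lengths alone. *)
Lemma conformal_le_sides d e l : 0 < area2 d e ->
  2^-1 < normc d < 3 / 2 -> 2^-1 < normc e < 3 / 2 ->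
  2^-1 < normc (e - d) < 3 / 2 ->
  sqn (e - tau R * d) <=
    36 * ((normc d - l) ^+ 2 + (normc e - l) ^+ 2 + (normc (e - d) - l) ^+ 2).
Proof.
move=> a0; have := heron_area d e; rewrite sqn_conformal -!normc_sqr.
have s0 := sin_pi3_gt0; have s2 := sin_pi3_sqr R.
set s := sin _ in s0 s2 *; set A := area2 d e in a0 *.
move: (normc d : R) (normc e : R) (normc (e - d) : R) => a b c hA ha hb hc.
set p := 2^-1 * _; set q := 2 * s * A.
have q0 : 0 < q by rewrite !mulr_gt0.
have p0 : 3 / 8 <= p by rewrite /p; nra.
(* The quantity to bound is p - q, where q > 0 by orientation. Since x + y <= 3 for any two sides,
   p^2 - q^2 is at most 9/2 times 3 S; dividing by p >= 3/8 gives the constant 36. *)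
have pq : p ^+ 2 - q ^+ 2 =
    2^-1 * ((a ^+ 2 - b ^+ 2) ^+ 2 + (b ^+ 2 - c ^+ 2) ^+ 2 + (c ^+ 2 - a ^+ 2) ^+ 2).
  rewrite (_ : q ^+ 2 = s ^+ 2 * (4 * A ^+ 2)); last by rewrite /q; ring.
  by rewrite s2 hA /p; field.
have sq (x y : R) : 2^-1 < x < 3 / 2 -> 2^-1 < y < 3 / 2 ->
    (x ^+ 2 - y ^+ 2) ^+ 2 <= 9 * (x - y) ^+ 2.
  move=> hx hy; rewrite subr_sqr exprMn mulrC ler_wpM2r ?sqr_ge0//.
  have -> : 9 = 3 ^+ 2 :> R by ring.
  by rewrite ler_pXn2r// ?nnegrE; lra.
have /= h1 := sq _ _ ha hb; have /= h2 := sq _ _ hb hc; have /= h3 := sq _ _ hc ha.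
have h4 : (a - b) ^+ 2 + (b - c) ^+ 2 + (c - a) ^+ 2 <=
    3 * ((a - l) ^+ 2 + (b - l) ^+ 2 + (c - l) ^+ 2).
  rewrite -subr_ge0 (_ : _ - _ = (a + b + c - 3 * l) ^+ 2) ?sqr_ge0//; ring.
have h5 : (p - q) * p <= p ^+ 2 - q ^+ 2 \/ p <= q.
  have [pq'|qp] := leP p q; [by right|left]; nra.
set S := _ + (c - l) ^+ 2 in h4 *.
have S0 : 0 <= S by rewrite !addr_ge0 ?sqr_ge0.
case: h5 => [h5|]; last by nra.
have h6 : (p - q) * p <= 27 / 2 * S by nra.
have [|pq'] := leP (p - q) 0; first by nra.
nra.
Qed.

End plane_geometry.

(** * Edge sums on the torus and the null Lagrangian *)

Section periodic_maps.
Variables (R : realType) (n : nat).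
Local Notation N := n.+1.
Local Notation bp := (@box_point N).

Definition grad (v : A2 -> R[i]) x z := v (x + z) - v x.

(** Edges are directed, so every bond is counted twice; in return the sum is invariant under
    rotation and reversal of the directions. *)
Definition sum_edges (f : A2 -> A2 -> R) :=
  \sum_(z <- nbrs) \sum_(k : 'I_N * 'I_N) f (bp k) z.

Definition per2 (f : A2 -> A2 -> R) := forall z, per n (f^~ z).

Lemma sum_edges_shift f (s : A2 -> A2) : per2 f ->
  sum_edges (fun x z => f (x + s z) z) = sum_edges f.
Proof. by move=> pf; apply: eq_bigr => z _; exact: (sum_shift (s z) (pf z)). Qed.

Lemma sum_edges_rot f : sum_edges (fun x z => f x (rot z)) = sum_edges f.
Proof. exact: (sum_rot (fun z => \sum_k f (bp k) z)). Qed.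

Lemma sum_edges_opp f : sum_edges (fun x z => f x (- z)) = sum_edges f.
Proof. exact: (sum_opp (fun z => \sum_k f (bp k) z)). Qed.

Lemma sum_edgesD f g :
  sum_edges (fun x z => f x z + g x z) = sum_edges f + sum_edges g.
Proof. by rewrite -big_split; apply: eq_bigr => z _; rewrite big_split. Qed.

Lemma sum_edgesZ c f : sum_edges (fun x z => c * f x z) = c * sum_edges f.
Proof.
by rewrite /sum_edges mulr_sumr; apply: eq_bigr => z _; rewrite mulr_sumr.
Qed.

Lemma eq_sum_edges f g : (forall x z, f x z = g x z) ->
  sum_edges f = sum_edges g.
Proof. by move=> fg; apply: eq_bigr => z _; apply: eq_bigr. Qed.

Lemma le_sum_edges f g : (forall x z, z \in nbrs -> f x z <= g x z) ->
  sum_edges f <= sum_edges g.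
Proof.
move=> fg; rewrite /sum_edges !big_seq; apply: ler_sum => z hz.
by apply: ler_sum => k _; exact: fg.
Qed.

Lemma sum_edges_cst c : sum_edges (fun _ _ => c) = 6 * (N * N)%:R * c.
Proof.
rewrite /sum_edges sumr_const card_prod !card_ord big_const_seq count_predT.
have -> : size nbrs = 6%N by [].
by rewrite iter_addr addr0 -[RHS]mulrA !mulr_natl.
Qed.

(** The third side of the triangle [x, x + z, x + rot z] starts at x + z in the direction rot (rot
    z); it too runs through all directed edges. *)
Lemma sum_edges_rot2 f : per2 f ->
  sum_edges (fun x z => f (x + z) (rot (rot z))) = sum_edges f.
Proof.
move=> pf; rewrite (sum_edges_shift (f := fun x z => f x (rot (rot z))) id).
  by rewrite (sum_edges_rot (fun x z => f x (rot z))) sum_edges_rot.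
by move=> z; exact: pf.
Qed.

(** Each directed edge plays each of the three roles in exactly one triangle: the side weights add
    up to 3/2, the signs 1, -1, 1 to 1. *)
Lemma sum_edges_triangles S B c : per2 S -> per2 B ->
  sum_edges (fun x z =>
    (2^-1 * S x z + (2^-1 * S x (rot z) + 2^-1 * S (x + z) (rot (rot z)))) +
    c * (B x z + ((-1) * B x (rot z) + B (x + z) (rot (rot z))))) =
  3 / 2 * sum_edges S + c * sum_edges B.
Proof.
move=> pS pB; rewrite sum_edgesD [X in _ + X]sum_edgesZ !sum_edgesD !sum_edgesZ.
by rewrite !sum_edges_rot !sum_edges_rot2//; lra.
Qed.

(* Up to periodic shifts, the oriented areas of the six triangles around a
   point cancel: the determinant is a null Lagrangian. *)
Lemma sum_conformal v : per n v ->
  sum_edges (fun x z => sqn (grad v x (rot z) - tau R * grad v x z)) =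
  3 / 2 * sum_edges (fun x z => sqn (grad v x z)).
Proof.
move=> pv.
pose S (x z : A2) := sqn (grad v x z); pose B (x z : A2) := area2 (v x) (v (x + z)).
have pS : per2 S by move=> z x y; rewrite /S /grad addrAC !pv.
have pB : per2 B by move=> z x y; rewrite /B addrAC !pv.
have rr z x : x + rot z = x + z + rot (rot z) by rewrite rot_rot -addrA [z + _]addrC subrK.
(* The shoelace formula splits the signed area of the image triangle into determinants [B] of its
   three sides. *)
rewrite (eq_sum_edges (g := fun x z =>
    (2^-1 * S x z + (2^-1 * S x (rot z) + 2^-1 * S (x + z) (rot (rot z)))) +
    - (2 * sin (pi / 3)) * (B x z + ((-1) * B x (rot z) + B (x + z) (rot (rot z))))));
  last first.
  move=> x z; rewrite sqn_conformal /S /B /grad -!rr.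
  move: (v x) (v (x + z)) (v (x + rot z)) => [a b] [c d] [e f].
  by rewrite /sqn /area2 /=; ring.
rewrite sum_edges_triangles//.
(* Reversing an edge changes the sign of its determinant. *)
have B0 : sum_edges B = - sum_edges B.
  rewrite -[LHS]sum_edges_opp -(sum_edges_shift id); last by move=> z; exact: pB.
  rewrite -mulN1r -sum_edgesZ; apply: eq_sum_edges => x z; rewrite /B addrK.
  by rewrite /area2; ring.
by rewrite (_ : sum_edges B = 0) ?mulr0 ?addr0//; lra.
Qed.

Lemma sum_grad_linear v (a b : A2 -> R) : per n v ->
  sum_edges (fun x z => a z * complex.Re (grad v x z) + b z * complex.Im (grad v x z)) = 0.
Proof.
move=> pv; rewrite /sum_edges big1// => z _.
have H (f : R[i] -> R) : (forall p q, f (p - q) = f p - f q) ->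
    \sum_(k : 'I_N * 'I_N) f (grad v (bp k) z) = 0.
  move=> fB; under eq_bigr do rewrite /grad fB.
  rewrite sumrB; apply/eqP; rewrite subr_eq0; apply/eqP.
  by apply: (sum_shift z (g := f \o v)) => x y /=; rewrite pv.
rewrite big_split /= -!mulr_sumr !H ?mulr0 ?addr0//; by case=> ? ? [].
Qed.

End periodic_maps.

(** * Filling the holes with bounded increments *)

Section filled_configuration.
Variables (R : realType) (om : config R) (alpha : R).
Hypothesis alpha1 : alpha <= 1.
Hypothesis om1 : Omega1 alpha om.
Hypothesis om2 : Omega2 om.

Lemma hole_nbr x z : hole om x -> z \in nbrs -> hole om (x + z) = false.
Proof.
move=> hx hz; apply/negP => hxz.
have az : adj R x (x + z) by rewrite adjP addrC addKr.
have [/eqP|] := om2 hx hxz; last by rewrite (eqP az); lra.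
by rewrite eq_sym addrC -subr_eq0 addrK => /eqP z0; move: hz; rewrite z0.
Qed.

(* The value chosen at a hole is irrelevant up to a bounded error. *)
Definition fill x : R[i] := if hole om x then pos om (x + unit1) else pos om x.

Lemma fill_pos x : ~~ hole om x -> fill x = pos om x.
Proof. by rewrite /fill => /negbTE ->. Qed.

Lemma grad_fill_occupied x z : z \in nbrs -> ~~ hole om x -> ~~ hole om (x + z) ->
  1 - alpha < normc (grad fill x z) < 1 + alpha.
Proof.
move=> hz hx hxz; rewrite /grad !fill_pos// om1//.
by rewrite adjP opprD addNKr opp_nbrs.
Qed.

Lemma ring_step h z : hole om h -> z \in nbrs ->
  normc (fill (h + rot z) - fill (h + z)) <= 2.
Proof.
move=> hh hz.
have E : h + rot z = (h + z) + rot (rot z) by rewrite rot_rot -addrA [z + _]addrC subrK.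
have := @grad_fill_occupied (h + z) (rot (rot z)) (rot_nbrs (rot_nbrs hz)).
rewrite -E !hole_nbr//; last exact: rot_nbrs.
by rewrite /grad -E => /(_ isT isT) /andP[_ h2]; apply: (le_trans (ltW h2)); rewrite -lerBrDl (le_trans alpha1)//; lra.
Qed.

(** The neighbours of a hole are all occupied, and the walk around the hexagon from one to another
    takes at most five steps of length at most 2. *)
Lemma ring_dist h z w : hole om h -> z \in nbrs -> w \in nbrs ->
  normc (fill (h + z) - fill (h + w)) <= 10.
Proof.
move=> hh /trajectP[i i6 ->] /trajectP[j j6 ->].
have uN k : iter k rot unit1 \in nbrs by elim: k => //= k; exact: rot_nbrs.
have step k p : normc (fill (h + iter (k + p) rot unit1) - fill (h + iter p rot unit1))
    <= (2 * k)%:R.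
  elim: k => [|k IHk]; first by rewrite subrr normc0.
  rewrite -(subrK (fill (h + iter (k + p) rot unit1)) (fill _)) -addrA.
  apply: (le_trans (le_normcD _ _)); rewrite mulnS natrD lerD//.
  exact: (ring_step hh (uN (k + p)%N)).
wlog ij : i j i6 j6 / (j <= i)%N => [H|].
  have [ij|/ltnW ij] := leqP j i; first exact: H.
  by rewrite -normcN opprB; exact: H.
have := step (i - j)%N j; rewrite subnK// => /le_trans; apply.
by rewrite ler_nat; lia.
Qed.

(** At a hole [fill] takes the value of a neighbour, so an increment into or out of a hole is a
    distance between two neighbours of that hole. *)
Lemma grad_fill_le x z : z \in nbrs -> normc (grad fill x z) <= 10.
Proof.
move=> hz; rewrite /grad.
have [hx|hx] := boolP (hole om x).
  rewrite [in X in _ - X]/fill hx -fill_pos ?hole_nbr//.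
  exact: ring_dist.
have [hxz|hxz] := boolP (hole om (x + z)); last first.
  by have /andP[_ h2] := grad_fill_occupied hz hx hxz; apply: (le_trans (ltW h2)); rewrite -lerBrDl (le_trans alpha1)//; lra.
have := ring_dist hxz (isT : unit1 \in nbrs) (opp_nbrs hz); rewrite addrK.
suff -> : fill (x + z) = fill (x + z + unit1) by [].
by rewrite [LHS]/fill hxz fill_pos// (hole_nbr hxz (isT : unit1 \in nbrs)).
Qed.

End filled_configuration.

Lemma periodic_hole (R : realType) (l : R) N (om : config R) x z :
  periodic l N om -> hole om (x + z *+ N) = hole om x.
Proof. by move=> pom; rewrite /hole pom; case: (om x). Qed.

Lemma periodic_pos (R : realType) (l : R) N (om : config R) x z :
  periodic l N om -> ~~ hole om x ->
  pos om (x + z *+ N) = pos om x + (l * N%:R)%:C%C * emb R z.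
Proof. by rewrite /hole /pos => pom; rewrite pom; case: (om x). Qed.

Lemma emb_mulrn (R : realType) (z : A2) N : emb R (z *+ N) = N%:R * emb R z.
Proof.
rewrite pair_mulrn /emb /= !intrM -!pmulrn; ring.
Qed.

Lemma sum_nbrs_cst (W : nmodType) (c : W) : \sum_(z <- nbrs) c = c *+ 6.
Proof. by rewrite big_const_seq count_predT iter_addr addr0. Qed.

Lemma sqn_emb (R : realType) z : z \in nbrs -> sqn (emb R z) = 1.
Proof.
move=> hz; have : adj R 0 z by rewrite adjP subr0.
rewrite /adj [emb R 0](_ : _ = 0) ?sub0r ?normcN; last by rewrite /emb mulr0 addr0.
by move=> /eqP h; rewrite -normc_sqr h expr1n.
Qed.

(** * Discrete rigidity and the lower bound for the energy *)

Section lower_bound.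
Variables (R : realType) (n : nat) (l alpha : R) (om : config R).
Local Notation N := n.+1.
Hypothesis alpha2 : alpha < 2^-1.
Hypothesis l2 : 2^-1 < l < 3 / 2.
Hypothesis omN : periodic l N om.
Hypothesis om1 : Omega1 alpha om.
Hypothesis om2 : Omega2 om.
Hypothesis om4 : Omega4 om.

Definition displacement x := fill om x - l%:C%C * emb R x.
Local Notation v := displacement.

Let alpha1 : alpha <= 1. Proof. by move: alpha2; lra. Qed.

Lemma per_hole : per n (hole om).
Proof. by move=> x z; exact: periodic_hole omN. Qed.

Lemma per_displacement : per n v.
Proof.
move=> x z; rewrite /v /fill per_hole embD emb_mulrn.
have lN : (l * N%:R)%:C%C = l%:C%C * N%:R :> R[i] by rewrite rmorphM /= rmorph_nat.
case: ifPn => hx.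
  have h1 : hole om (x + unit1) = false := hole_nbr om2 hx (isT : unit1 \in nbrs).
  by rewrite addrAC (periodic_pos _ omN) ?h1// lN; ring.
by rewrite (periodic_pos _ omN)// lN; ring.
Qed.

Lemma grad_displacement x z : grad v x z = grad (fill om) x z - l%:C%C * emb R z.
Proof. by rewrite /grad /v embD; ring. Qed.

Lemma grad_fillE x z : grad (fill om) x z = l%:C%C * emb R z + grad v x z.
Proof. by rewrite grad_displacement addrC subrK. Qed.

Let b x : R := (hole om x)%:R.

Let b0 x : 0 <= b x. Proof. exact: ler0n. Qed.

Let g x z : R := if hole om x || hole om (x + z) then 0
  else (normc (grad (fill om) x z) - l) ^+ 2.

Let g0 x z : 0 <= g x z. Proof. by rewrite /g; case: ifP => // _; exact: sqr_ge0. Qed.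

(** The linear part l x is conformal and cancels on the left, so [fill] may replace the
    displacement. Triangles without holes fall under [conformal_le_sides], with the orientation from
    [Omega4]; a triangle with a hole at a corner is charged (10 + 10)^2 = 400. *)
Lemma triangle_bound x z : z \in nbrs ->
  sqn (grad v x (rot z) - tau R * grad v x z) <=
  36 * (g x z + (g x (rot z) + g (x + z) (rot (rot z)))) +
  400 * (b x + (b (x + z) + b (x + rot z))).
Proof.
move=> hz; have hrz := rot_nbrs hz; have hrrz := rot_nbrs hrz.
have -> : grad v x (rot z) - tau R * grad v x z =
    grad (fill om) x (rot z) - tau R * grad (fill om) x z.
  by rewrite !grad_displacement emb_rot; ring.
have E : x + z + rot (rot z) = x + rot z by rewrite rot_rot -addrA [z + _]addrC subrK.
have [|/norP[hx /norP[hxz hxr]]] :=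
  boolP (hole om x || (hole om (x + z) || hole om (x + rot z))).
  move=> H; apply: (@le_trans _ _ (400 * 1)); last first.
    have : 1 <= b x + (b (x + z) + b (x + rot z)).
      by move: H; rewrite /b; do 3 case: hole => //=; lra.
    by have := g0 x z; have := g0 x (rot z); have := g0 (x + z) (rot (rot z)); lra.
  rewrite -normc_sqr (_ : 400 * 1 = 20 ^+ 2); last by ring.
  rewrite ler_pXn2r// ?nnegrE ?normc_ge0//.
  apply: (le_trans (le_normcD _ _)); rewrite normcN normcM.
  have -> : normc (tau R) = 1 by rewrite /normc /tau cos2Dsin2 sqrtr1.
  rewrite mul1r (_ : 20 = 10 + 10); last by ring.
  by apply: lerD; exact: (grad_fill_le alpha1 om1 om2).
have Ed : grad (fill om) (x + z) (rot (rot z)) =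
    grad (fill om) x (rot z) - grad (fill om) x z by rewrite /grad E; ring.
have B y w : w \in nbrs -> ~~ hole om y -> ~~ hole om (y + w) ->
    2^-1 < normc (grad (fill om) y w) < 3 / 2.
  by move=> hw hy hyw; have /andP[h1 h2] := grad_fill_occupied om1 hw hy hyw; move: alpha2; lra.
have hatE y : ~~ hole om y -> hat om y = pos om y.
  by rewrite /hole /hat /pos; case: (om y).
apply: (@le_trans _ _ (36 * (g x z + (g x (rot z) + g (x + z) (rot (rot z)))))); last first.
  by have := b0 x; have := b0 (x + z); have := b0 (x + rot z); lra.
rewrite /g E (negbTE hx) (negbTE hxz) (negbTE hxr) /= Ed addrA.
apply: conformal_le_sides; [|exact: B|exact: B|].
  apply: area2_gt0; have := om4 x hz; rewrite !hatE// /grad !fill_pos//.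
by rewrite -Ed; apply: B; rewrite ?E.
Qed.

Let B := \sum_(k : 'I_N * 'I_N) b (box_point k).
Let D := sum_edges n (fun x z => sqn (grad v x z)).

Let per_b : per n b. Proof. by move=> x z; rewrite /b per_hole. Qed.

Let per_grad z : per n (fun x => grad v x z).
Proof. by move=> x w; rewrite /grad [x + _ + z]addrAC !per_displacement. Qed.

Let sum_b (s : A2 -> A2) : sum_edges n (fun x z => b (x + s z)) = 6 * B.
Proof.
rewrite /sum_edges; under eq_bigr do rewrite (sum_shift _ per_b).
by rewrite sum_nbrs_cst mulr_natl.
Qed.

(** This is [triangle_bound] summed, with [sum_conformal] on the left. Every edge has three roles,
    whence 108 = 3 * 36; every hole is a corner 3 * 6 times, whence 7200 = 18 * 400. *)
Lemma rigidity : 3 / 2 * D <= 108 * sum_edges n g + 7200 * B.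
Proof.
rewrite /D -sum_conformal; last exact: per_displacement.
apply: (le_trans (le_sum_edges _ triangle_bound)).
have pg : per2 n g.
  move=> z x w; rewrite /g addrAC !per_hole !grad_fillE.
  by rewrite [grad v (x + w *+ N) z](per_grad z).
rewrite sum_edgesD !sum_edgesZ !sum_edgesD sum_edges_rot sum_edges_rot2//.
have b1 : sum_edges n (fun x _ => b x) = 6 * B.
  by rewrite -(sum_b (fun=> 0)); apply: eq_sum_edges => x z; rewrite addr0.
by rewrite b1 (sum_b id) (sum_b rot); lra.
Qed.

(* The first-order term is [Re (conj (emb z) * grad v x z)], which sums to 0. *)
Lemma length_expansion x z : z \in nbrs ->
  let r := complex.Re (emb R z) * complex.Re (grad v x z) +
           complex.Im (emb R z) * complex.Im (grad v x z) in
  r <= normc (grad (fill om) x z) - l <= r + sqn (grad v x z).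
Proof.
move=> hz; rewrite grad_fillE; have := sqn_emb R hz.
have := normc_sqr (l%:C%C * emb R z + grad v x z).
have := normc_ge0 (l%:C%C * emb R z + grad v x z).
move: (normc (l%:C%C * emb R z + grad v x z) : R) => d.
move: (emb R z) (grad v x z) => [p q] [c e]; rewrite /sqn /= => d0 d2 pq.
rewrite !mul0r subr0 addr0 in d2.
set r := p * c + q * e.
have E : d ^+ 2 = l ^+ 2 + 2 * l * r + (c ^+ 2 + e ^+ 2).
  transitivity (l ^+ 2 * (p ^+ 2 + q ^+ 2) + 2 * l * r + (c ^+ 2 + e ^+ 2)).
    by rewrite d2 /r; ring.
  by rewrite pq mulr1.
(* Cauchy-Schwarz by Lagrange's identity, [emb z] being a unit vector. *)
have r2 : r ^+ 2 <= c ^+ 2 + e ^+ 2.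
  rewrite -subr_ge0 -[c ^+ 2 + e ^+ 2]mul1r -pq.
  rewrite (_ : _ - _ = (p * e - q * c) ^+ 2) ?sqr_ge0//.
  by rewrite /r; ring.
have /andP[l1 _] := l2.
apply/andP; split.
  have [|h] := leP (l + r) 0; first by lra.
  rewrite -subr_ge0 -(@pmulr_rge0 _ (d + (l + r))); last by lra.
  rewrite (_ : _ * _ = d ^+ 2 - (l + r) ^+ 2); last by ring.
  by rewrite E; lra.
have : 2 * l * (d - l) <= d ^+ 2 - l ^+ 2 by have := sqr_ge0 (d - l); lra.
rewrite E => h; have s0 : 0 <= c ^+ 2 + e ^+ 2 by rewrite addr_ge0// sqr_ge0.
(* The error is really the square divided by 2 l, and 2 l > 1. *)
have : 2 * l * (d - l - r) <= 2 * l * (c ^+ 2 + e ^+ 2) by nra.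
by rewrite ler_pM2l; lra.
Qed.

(** The elongation exceeds its linear part by an amount between 0 and |grad v|^2. Whatever the sign
    of [V1], replacing one by the other therefore costs at most e |grad v|^2. *)
Lemma linear_part (V1 e : R) : `|V1| <= e -> exists2 lin : A2 -> A2 -> R,
  sum_edges n lin = 0 & forall x z, z \in nbrs ->
    lin x z - e * sqn (grad v x z) <= V1 * (normc (grad (fill om) x z) - l).
Proof.
move=> hV1.
exists (fun x z => V1 * complex.Re (emb R z) * complex.Re (grad v x z) +
                   V1 * complex.Im (emb R z) * complex.Im (grad v x z)).
  exact: (sum_grad_linear (fun z => V1 * complex.Re (emb R z))
    (fun z => V1 * complex.Im (emb R z)) per_displacement).
move=> x z hz; have := length_expansion x hz.
move: (normc _ - l : R) (sqn _) => d Q /=.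
rewrite -!mulrA -mulrDr; set r := _ + _ => /andP[e1 e2].
have t0 : 0 <= d - r by rewrite subr_ge0.
have t1 : d - r <= Q by rewrite lerBlDl.
rewrite -subr_ge0 (_ : _ - _ = e * Q + V1 * (d - r)); last by ring.
rewrite addrC -lerBlDr sub0r lerNl -mulNr.
apply: (le_trans (ler_norm _)); rewrite normrM normrN (ger0_norm t0).
exact: ler_pM.
Qed.

Lemma hamiltonianE V m : hamiltonian V m N om =
  2^-1 * sum_edges n (fun x z => pair_energy V om x (x + z)) + m * B.
Proof. by rewrite /hamiltonian exchange_big. Qed.

(** Halving the edge sum, [rigidity] turns the convexity term into c0/144 times [D], of which the
    linear replacement consumes c0/288. Per hole the losses are 6 (C0 + c0) from its missing bonds
    and 100/3 c0 from [rigidity], together less than [m]. *)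
Lemma energy_lower_bound (V : R -> R) (Vl V1 c0 C0 m : R) :
  (forall r, 1 - alpha < r < 1 + alpha ->
    Vl + V1 * (r - l) + c0 * (r - l) ^+ 2 <= V r) ->
  0 < c0 -> `|V1| <= c0 / 144 -> `|Vl| <= C0 -> 6 * C0 + 100 * c0 <= m ->
  3 * (N * N)%:R * Vl + c0 / 288 * D <= hamiltonian V m N om.
Proof.
move=> hV c00 hV1 hVl hm; rewrite hamiltonianE.
have B0 : 0 <= B by apply: sumr_ge0.
have D0 : 0 <= D by apply: sumr_ge0 => z _; apply: sumr_ge0 => k _; exact: sqn_ge0.
have hrig := rigidity.
pose G := sum_edges n g.
have [lin lin0 hlin] := linear_part hV1.
have key : sum_edges n (fun x z => (Vl + lin x z) +
    (c0 * g x z + (- (c0 / 144) * sqn (grad v x z) +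
      - (C0 + c0) * (b x + b (x + z))))) <=
    sum_edges n (fun x z => pair_energy V om x (x + z)).
  apply: le_sum_edges => x z hz.
  have d10 := grad_fill_le alpha1 om1 om2 x hz.
  have d0 := normc_ge0 (grad (fill om) x z).
  have := hlin x z hz.
  move: (lin x z) (sqn (grad v x z)) => L Q hl.
  have [/andP[hx hxz]|bad] := boolP (~~ hole om x && ~~ hole om (x + z)).
    rewrite /pair_energy /g /b (negbTE hx) (negbTE hxz) /=.
    have -> : normc (pos om x - pos om (x + z)) = normc (grad (fill om) x z).
      by rewrite -normcN opprB /grad !fill_pos.
    by have := hV _ (grad_fill_occupied om1 hz hx hxz); lra.
  have -> : pair_energy V om x (x + z) = 0.
    by rewrite /pair_energy; move: bad; do 2 case: hole.
  have -> : g x z = 0 by rewrite /g; move: bad; do 2 case: hole.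
  have bb : 1 <= b x + b (x + z) by rewrite /b; move: bad; do 2 case: hole => //=; lra.
  (* At a bond with a hole only the crude bound 10 for the length of the filled bond is
     available. *)
  have hd : V1 * (normc (grad (fill om) x z) - l) <= c0 / 144 * 10.
    apply: (le_trans (ler_norm _)); rewrite normrM ler_pM// ler_norml.
    by move: l2; lra.
  have := le_trans (ler_norm Vl) hVl; have C00 : 0 <= C0 := le_trans (normr_ge0 _) hVl.
  have : (C0 + c0) * 1 <= (C0 + c0) * (b x + b (x + z)) by rewrite ler_wpM2l//; lra.
  by lra.
move: key; rewrite !sum_edgesD !sum_edgesZ sum_edges_cst sum_edgesD.
have b1 : sum_edges n (fun x _ => b x) = 6 * B.
  by rewrite -(sum_b (fun=> 0)); apply: eq_sum_edges => x z; rewrite addr0.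
rewrite lin0 b1 (sum_b id) -/G -/D => key.
have h1 : c0 * (3 / 2 * D) <= c0 * (108 * G + 7200 * B) by rewrite ler_pM2l.
have h2 : (6 * C0 + 100 * c0) * B <= m * B by rewrite ler_wpM2r.
have h3 : 0 <= c0 * B by rewrite mulr_ge0// ltW.
by lra.
Qed.

End lower_bound.

(** * Integration over sets that need not be measurable *)

Section inner_integral.
Local Open Scope ereal_scope.
Context d (T : measurableType d) (R : realType).
Variable mu : {measure set T -> \bar R}.
Import HBNNSimple.

(* The integral of a nonnegative function is a supremum over simple functions,
   so it is monotone without any measurability assumption. *)
Lemma ge0_le_integral_nonmeasurable (f g : T -> \bar R) :
  (forall x, 0 <= f x) -> (forall x, f x <= g x) ->
  \int[mu]_x f x <= \int[mu]_x g x.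
Proof.
move=> f0 fg; rewrite !ge0_integralTE//; last by move=> x; exact: le_trans (fg x).
apply: ereal_sup_le => _ [h /= hf <-]; exists h => //= x.
exact: le_trans (hf x) (fg x).
Qed.

Lemma ge0_subset_integral_nonmeasurable (A B : set T) (g : T -> \bar R) :
  (forall x, 0 <= g x) -> A `<=` B ->
  \int[mu]_(x in A) g x <= \int[mu]_(x in B) g x.
Proof.
move=> g0 AB; rewrite (integral_mkcond A) (integral_mkcond B).
apply: ge0_le_integral_nonmeasurable => x; first exact: erestrict_ge0.
rewrite /patch; case: ifPn => [|_]; last by case: ifP.
by rewrite inE => /AB Bx; rewrite mem_set.
Qed.

Variables (g : T -> \bar R) (g0 : forall x, 0 <= g x).
Hypothesis mg : measurable_fun [set: T] g.

(** The witness is the support of [h]: it is measurable even if [E] is not, and it lies in [E]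
    because [h] is below a function that vanishes off [E]. *)
Lemma nnsfun_le_restrict (E : set T) (h : {nnsfun T >-> R}) :
  (forall x, (h x)%:E <= (g \_ E) x) ->
  exists S, [/\ measurable S, S `<=` E & sintegral mu h <= \int[mu]_(x in S) g x].
Proof.
move=> hg; exists (h @^-1` [set x | x != 0]%R).
have mS : measurable (h @^-1` [set x | x != 0]%R).
  rewrite (_ : [set x | x != 0]%R = ~` [set 0%R]); last first.
    by apply/seteqP; split=> x /= /eqP.
  by rewrite -preimage_setC; apply: measurableC.
split => //.
  move=> x /= hx0; apply: contrapT => Ex; have := hg x.
  rewrite /patch memNset// lee_fin => h0.
  by move/negP: hx0; apply; rewrite eq_le h0 /=.
rewrite -integralT_nnsfun [leRHS]integral_mkcond.
apply: ge0_le_integral_nonmeasurable => x; first by rewrite lee_fin.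
rewrite [leRHS]/patch; case: ifPn => [|]; last first.
  by rewrite notin_setE /= => /negP; rewrite negbK => /eqP ->.
move=> _; apply: (le_trans (hg x)); rewrite /patch; case: ifP => // _; exact: g0.
Qed.

Lemma integral_inner (E : set T) : \int[mu]_(x in E) g x =
  ereal_sup [set \int[mu]_(x in S) g x | S in [set S | measurable S /\ S `<=` E]].
Proof.
apply/eqP; rewrite eq_le; apply/andP; split; last first.
  apply: ge_ereal_sup => _ [S [mS SE] <-].
  exact: ge0_subset_integral_nonmeasurable.
rewrite ge0_integralE//; apply: ge_ereal_sup => _ [h /= hg <-].
have [S [mS SE hS]] := nnsfun_le_restrict hg.
by apply: (le_trans hS); apply: ereal_sup_ubound; exists S.
Qed.

(* [Omega] is not known to be measurable: a measurable kernel replaces it in every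
   integral over it. *)
Lemma inner_kernel (E : set T) : \int[mu]_(x in E) g x < +oo ->
  exists B, [/\ measurable B, B `<=` E &
    forall A, measurable A ->
      \int[mu]_(x in A `&` E) g x = \int[mu]_(x in A `&` B) g x].
Proof.
move=> Eoo.
have Z0 : 0 <= \int[mu]_(x in E) g x by apply: integral_ge0.
have Zfin : \int[mu]_(x in E) g x \is a fin_num by rewrite ge0_fin_numE.
pose sups := [set \int[mu]_(x in S) g x | S in [set S | measurable S /\ S `<=` E]].
have HS n : exists S, [/\ measurable S, S `<=` E &
    \int[mu]_(x in E) g x - (n.+1%:R^-1)%:E < \int[mu]_(x in S) g x].
  have := @ub_ereal_sup_adherent R sups (n.+1%:R^-1)%R.
  rewrite -integral_inner invr_gt0 ltr0n => /(_ isT Zfin)[_ [S [mS SE] <-] h].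
  by exists S.
have {}HS := fun n => cid (HS n).
pose S n := projT1 (HS n).
have mS n : measurable (S n) by rewrite /S; case: (HS n) => ? [].
have SE n : S n `<=` E by rewrite /S; case: (HS n) => ? [].
have hS n : \int[mu]_(x in E) g x - (n.+1%:R^-1)%:E < \int[mu]_(x in S n) g x.
  by rewrite /S; case: (HS n) => ? [].
pose B := \bigcup_n S n.
have mB : measurable B by apply: bigcupT_measurable.
have BE : B `<=` E by move=> x [n _] /SE.
have mgD D : measurable_fun D g by exact: measurable_funTS.
have ZB : \int[mu]_(x in B) g x = \int[mu]_(x in E) g x.
  apply/eqP; rewrite eq_le ge0_subset_integral_nonmeasurable//=.
  apply/lee_addgt0Pr => e e0.
  have [n hn] : exists n, (n.+1%:R^-1 < e)%R.
    exists (Num.truncn e^-1); rewrite invf_plt ?posrE// ?ltr0n//.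
    by rewrite truncnS_gt.
  rewrite -leeBlDr//.
  apply: (@le_trans _ _ (\int[mu]_(x in E) g x - (n.+1%:R^-1)%:E)).
    by rewrite leeB// lee_fin ltW.
  apply: (le_trans (ltW (hS n))).
  by apply: ge0_subset_integral_nonmeasurable => //; exact: bigcup_sup.
exists B; split => // A mA; apply/eqP; rewrite eq_le; apply/andP; split; last first.
  by apply: ge0_subset_integral_nonmeasurable => //; exact: setIS.
rewrite integral_inner; apply: ge_ereal_sup => _ [U [mU UAE] <-].
have UE : U `<=` E by move=> x /UAE[].
(* [B] already carries the finite integral over [E], so a measurable part of [E] outside [B] has no
   weight. *)
have UB0 : \int[mu]_(x in U `\` B) g x = 0.
  have : \int[mu]_(x in B `|` (U `\` B)) g x <= \int[mu]_(x in E) g x.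
    apply: ge0_subset_integral_nonmeasurable => // x [/BE//|[/UE//]].
  rewrite ge0_integral_setU//; last 2 first.
  - exact: measurableD.
  - by apply/disj_setPS => x [? []].
  rewrite ZB -leeBrDl// subee// => h.
  by apply/eqP; rewrite eq_le h integral_ge0.
rewrite -(setUIDK U B) ge0_integral_setU//; last 3 first.
- exact: measurableI.
- exact: measurableD.
- by apply/disj_setPS => x [[_ Bx] [_ /(_ Bx)]].
rewrite UB0 adde0; apply: ge0_subset_integral_nonmeasurable => // x [Ux Bx].
by split => //; case: (UAE x Ux).
Qed.

(* [nu] is a bare set function because [gibbs] is one: off the measurable sets it
   need not be additive. *)
Lemma integral_le_density (nu : set T -> \bar R) (c : \bar R) (B : set T) (f : T -> R) :
  0 <= c -> measurable B -> measurable_fun [set: T] f -> (forall x, 0 <= f x)%R ->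
  (forall A, measurable A -> nu A = c * \int[mu]_(x in A `&` B) g x) ->
  0 <= \int[nu]_x (f x)%:E <= c * \int[mu]_(x in B) ((f x)%:E * g x).
Proof.
move=> c0 mB mf f0 nuE.
have nu0 : nu set0 = 0 by rewrite nuE// set0I integral_set0 mule0.
have mgD D : measurable_fun D g by exact: measurable_funTS.
(* Level sets of simple functions are measurable, so the formula for [nu] is enough to compute
   [sintegral], and the integral of [f] is a supremum of such values. *)
have sint (h : {nnsfun T >-> R}) :
    sintegral nu h = c * \int[mu]_(x in B) ((h x)%:E * g x).
  rewrite /sintegral -(fsbig_widen (range h))//=; last first.
    by move=> r [_ /= hr]; rewrite preimage10 ?nu0 ?mule0.
  rewrite fsbig_finite//=.
  set s := finmap.enum_fset _.
  have BE : B = \big[setU/set0]_(r <- s) (h @^-1` [set r] `&` B).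
    rewrite bigsetU_fset_set//; apply/seteqP; split=> [x Bx|x [? _ []//]].
    by exists (h x) => //; exists x.
  have mh r : measurable (h @^-1` [set r] `&` B) by exact: measurableI.
  have hg0 x : 0 <= (h x)%:E * g x by rewrite mule_ge0// lee_fin.
  have mhg D : measurable_fun D (fun x => (h x)%:E * g x).
    by apply: measurable_funTS; apply: emeasurable_funM => //; exact/measurable_EFinP.
  rewrite [in RHS]BE ge0_integral_bigsetU//; last 2 first.
  - exact: finmap.fset_uniq.
  - by apply/trivIsetP => i j _ _ ij; rewrite -subset0 => x /= [[-> _] [/eqP]]; rewrite (negbTE ij).
  rewrite ge0_sume_distrr; last by move=> r _; exact: integral_ge0.
  rewrite big_seq [RHS]big_seq; apply: eq_bigr => r.
  rewrite in_fset_set// inE => -[y _ hy].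
  have r0 : 0 <= r%:E by rewrite -hy lee_fin.
  rewrite nuE// muleCA -ge0_integralZl//.
  congr (_ * _); apply: eq_integral => x; rewrite inE => -[/= -> _] //.
have mfg : measurable_fun B (fun x => (f x)%:E * g x).
  by apply: measurable_funTS; apply: emeasurable_funM => //; exact/measurable_EFinP.
have f0E x : 0 <= (f x)%:E by rewrite lee_fin.
rewrite /integral patch_setT.
have -> : (fun x => (f x)%:E)^\- = cst 0.
  by apply/funext => x; rewrite /= funenegE max_r// oppe_le0.
have -> : (fun x => (f x)%:E)^\+ = (fun x => (f x)%:E).
  by apply/funext => x; rewrite /= funeposE max_l.
have h00 (h : {nnsfun T >-> R}) : (forall x, (h x)%:E <= 0) -> sintegral nu h = 0.
  move=> hle; rewrite sint (_ : (fun x => _) = cst 0) ?integral0 ?mule0//.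
  apply/funext => x; rewrite (_ : h x = 0%R) ?mul0e//.
  by apply/eqP; rewrite eq_le fun_ge0 andbT -lee_fin.
have -> : ereal_sup [set sintegral nu h | h in
    [set h : {nnsfun T >-> R} | forall x, (h x)%:E <= cst 0 x]] = 0.
  apply/eqP; rewrite eq_le; apply/andP; split.
    by apply: ge_ereal_sup => _ [h /= h0 <-]; rewrite h00.
  by apply: ereal_sup_ubound; exists nnsfun0 => //; exact: h00.
rewrite sube0; apply/andP; split.
  by apply: ereal_sup_ubound; exists nnsfun0 => //; rewrite ?h00// => x; exact: f0E.
apply: ge_ereal_sup => _ [h /= hf <-]; rewrite sint lee_wpmul2l//.
apply: ge0_le_integral => //.
- by move=> x _; rewrite mule_ge0// lee_fin.
- by apply: measurable_funTS; apply: emeasurable_funM => //; exact/measurable_EFinP.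
- by move=> x _; rewrite lee_wpmul2r.
Qed.

End inner_integral.

(** * Translation invariance of the reference measure *)

Section translation_invariance.
Local Open Scope ereal_scope.
Variable R : realType.

Lemma lebesgue_measure_shift (c : R) (A : set (measurableTypeR R)) : measurable A ->
  lebesgue_measure ((fun x : R => x + c)%R @^-1` A) = lebesgue_measure A.
Proof.
move=> mA.
have ms : measurable_fun [set: measurableTypeR R] (fun x : measurableTypeR R => (x + c)%R : measurableTypeR R).
  exact: measurable_funD.
rewrite -/(pushforward (@lebesgue_measure R) (fun x : measurableTypeR R => (x + c)%R : measurableTypeR R) A).
apply/esym/lebesgue_measure_unique => //= _ [[a b]] _ <-.
rewrite /pushforward.
have -> : (fun x : R => (x + c)%R) @^-1` `]a, b]%classic = `](a - c)%R, (b - c)%R]%classic.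
  by apply/seteqP; split => x /=; rewrite !in_itv /= ltrBlDr lerBrDr.
rewrite !lebesgue_measure_itv/= !lte_fin ltrD2r.
by case: ifP => // _; rewrite -!EFinB; congr EFin; lra.
Qed.

Definition translate (c p : plane R) : plane R := (p.1 + c.1, p.2 + c.2)%R.

Lemma measurable_translate c : measurable_fun [set: plane R] (translate c).
Proof.
by apply: measurable_fun_pair; apply: measurable_funD.
Qed.

Lemma plane_measure_translate c (A : set (plane R)) : measurable A ->
  plane_measure (translate c @^-1` A) = plane_measure A.
Proof.
move=> mA; have mt := measurable_translate c.
rewrite -[LHS]/(pushforward (@plane_measure R) (translate c) A).
apply/esym; rewrite /plane_measure.
apply: (@product_measure_unique _ _ _ _ R lebesgue_measure lebesgue_measure (pushforward (@plane_measure R) (translate c))) => // X Y mX mY.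
change ((@lebesgue_measure R \x @lebesgue_measure R)
  (((fun x : R => x + c.1)%R @^-1` X) `*` ((fun x : R => x + c.2)%R @^-1` Y)) =
  lebesgue_measure X * lebesgue_measure Y).
have ms (e : R) (Z : set (measurableTypeR R)) : measurable Z ->
    measurable ((fun x : R => x + e)%R @^-1` Z : set (measurableTypeR R)).
  move=> mZ; rewrite -[X in measurable X]setTI.
  suff : measurable_fun [set: measurableTypeR R] (fun x : measurableTypeR R => (x + e)%R : measurableTypeR R) by exact.
  exact: measurable_funD.
rewrite product_measure1E; [|exact: ms|exact: ms].
congr (_ * _); first exact: (lebesgue_measure_shift c.1 mX).
exact: (lebesgue_measure_shift c.2 mY).
Qed.

Lemma hole_measure_translate c (A : set (option (plane R))) : measurable A ->
  hole_measure (@plane_measure R) (omap (translate c) @^-1` A) =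
  hole_measure (@plane_measure R) A.
Proof.
move=> mA; rewrite !hole_measureE; congr (_ + _).
exact: (plane_measure_translate c mA).
Qed.

Lemma measurable_omap d1 d2 (T1 : measurableType d1) (T2 : measurableType d2)
  (f : T1 -> T2) : measurable_fun [set: T1] f ->
  measurable_fun [set: option T1] (omap f).
Proof.
move=> mf _ A mA; rewrite setTI.
by have := mf measurableT _ mA; rewrite setTI.
Qed.

End translation_invariance.

Section tuple_boxes.
Local Open Scope ereal_scope.
Context d (T : measurableType d).

Definition box n (A : 'I_n -> set T) : set (n.-tuple T) :=
  [set t | forall i, A i (tnth t i)].

Lemma measurable_box n (A : 'I_n -> set T) : (forall i, measurable (A i)) ->
  measurable (box A).
Proof.
move=> mA; rewrite (_ : box A =
    \bigcap_(i in [set: 'I_n]) ((@tnth n T)^~ i @^-1` A i)).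
  apply: fin_bigcap_measurable => // i _.
  by rewrite -[X in measurable X]setTI; exact: (@measurable_tnth _ T n i).
by rewrite predeqE => t; split=> [h i _|h i]; [exact: h|exact: (h i I)].
Qed.

Definition boxes n := [set B : set (n.-tuple T) | exists2 A : 'I_n -> set T, forall i, measurable (A i) & B = box A].

Lemma measurable_tuple_boxes n : @measurable _ (n.-tuple T) = <<s @boxes n >>.
Proof.
apply/seteqP; split; last first.
  apply: smallest_sub; first exact: sigma_algebra_measurable.
  by move=> _ [A mA ->]; exact: measurable_box.
apply: smallest_sub; first exact: smallest_sigma_algebra.
case: n => [|n]; first by rewrite big_ord0.
rewrite -bigcup_mkord_ord; apply: bigcup_sub => i Ii _ [A mA <-].
apply: sub_sigma_algebra.
exists (fun j => if j == inord i then A else setT).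
  by move=> j; case: ifP.
rewrite setTI; apply/seteqP; split => [t /= At j|t /(_ (inord i))/=]; last by rewrite eqxx.
by case: eqP => [->|].
Qed.

(** Boxes are a generating pi-system, and the cubes over a finite-measure exhaustion cover all
    tuples: the maximum of the indices needed for the entries serves the whole tuple. *)
Lemma power_measure_unique (R : realType)
    (mu : {sigma_finite_measure set T -> \bar R}) n
    (m' : {measure set (n.-tuple T) -> \bar R}) :
  (forall A : 'I_n -> set T, (forall i, measurable (A i)) ->
    m' (box A) = \prod_(i < n) mu (A i)) ->
  forall X, measurable X -> power_measure mu n X = m' X.
Proof.
move=> m'E X mX.
have /sigma_finiteP[F [TF ndF Foo]] := sigma_finiteT mu.
apply: (measure_unique (@boxes n) (fun k => box (fun _ : 'I_n => F k))) => //.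
- exact: measurable_tuple_boxes.
- move=> _ _ [A mA ->] [B mB ->]; exists (fun i => A i `&` B i).
    by move=> i; exact: measurableI.
  by apply/seteqP; split=> [t [h1 h2] i|t h]; [split|split=> i; case: (h i)].
- by move=> k; exists (fun=> F k) => // i; exact: (Foo k).1.
- apply/seteqP; split=> // t _.
  have H i : exists k, F k (tnth t i).
    by have : setT (tnth t i) by []; rewrite TF => -[k _ h]; exists k.
  pose k i := projT1 (cid (H i)); have hk i : F (k i) (tnth t i) := projT2 (cid (H i)).
  exists (\max_(i < n) k i)%N => // i /=.
  move: (hk i); apply/subsetPset/ndF.
  exact: leq_bigmax.
- move=> _ [A mA ->]; rewrite m'E//; exact: power_measure_box.
- move=> k; rewrite [ltLHS](power_measure_box mu (fun=> (Foo k).1)).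
  have : mu (F k) \is a fin_num by rewrite ge0_fin_numE//; exact: (Foo k).2.
  move=> /fineK <-; rewrite prodEFin ltry//.
Qed.

End tuple_boxes.

Section shifts.
Variables (R : realType) (n : nat) (l : R).
Local Notation N := n.+1.
Local Notation space := ((N * N).-tuple (option (plane R))).
Local Notation bp := (@box_point N).
Local Notation muN := (power_measure (hole_measure (@plane_measure R)) (N * N)).

Lemma idx_subproof (k : 'I_N * 'I_N) : (k.1 * N + k.2 < N * N)%N.
Proof. by case: k => -[i hi] [j hj] /=; nia. Qed.

Definition idx k : 'I_(N * N) := Ordinal (idx_subproof k).

Definition unidx (k : 'I_(N * N)) : 'I_N * 'I_N := (inord (k %/ N), inord (k %% N)).

Lemma idxK : cancel idx unidx.
Proof.
move=> [i j]; rewrite /unidx /=; congr pair; apply: val_inj => /=.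
  by rewrite divnMDl// divn_small// addn0 inordK.
by rewrite modnMDl modn_small// inordK.
Qed.

Lemma unidxK : cancel unidx idx.
Proof.
move=> k; apply: val_inj; rewrite /= !inordK ?ltn_mod ?ltn_divLR//.
by rewrite -divn_eq.
Qed.

Definition cell (w : space) x := tnth w (idx (wrap n x)).

Lemma extend_cell w x : extend l w x =
  omap (fun p : plane R => (p.1 +i* p.2)%C + (l * N%:R)%:C%C * emb R (quo n x)) (cell w x).
Proof.
have [h1 _] := modz_ord n x.1; have [h2 _] := modz_ord n x.2.
by rewrite /cell (tnth_nth None) /= !inordK.
Qed.

Definition period (q : A2) : plane R :=
  let c := (l * N%:R)%:C%C * emb R q in (complex.Re c, complex.Im c).

(** Relabelling by [y] as an action on tuples: an entry that wraps around the torus is translated by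
    the period it crosses. *)
Definition shift y (w : space) : space :=
  [tuple omap (translate (period (quo n (bp (unidx k) + y)))) (cell w (bp (unidx k) + y))
   | k < N * N].

Lemma extend_inj : injective (fun w : space => extend l w).
Proof.
move=> w w' /= h.
have [v [_ uv]] := extend_bij (isT : (0 < N)%N) (extend_periodic l w isT).
by rewrite -(uv w erefl) (uv w')// h.
Qed.

Lemma extend_shift y w : extend l (shift y w) = (fun x => extend l w (x + y)).
Proof.
apply/funext => x; rewrite !extend_cell /cell tnth_mktuple idxK.
set b := box_point (wrap n x).
have [q E] : exists q, x = b + q *+ N /\ q = quo n x by exists (quo n x); split=> //; exact: wrap_quo.
have Ey : x + y = b + y + q *+ N by rewrite E.1 addrAC.
have N0 : N%:Z != 0 by [].
have -> : quo n (x + y) = quo n (b + y) + q.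
  rewrite Ey /quo pair_mulrn /= ![_ + _ * N%:Z]addrC !divzMDl//.
  by congr pair; rewrite addrC.
rewrite /cell Ey wrap_period -E.2 /period embD.
move: (emb R (quo n (b + y))) (emb R q) ((l * N%:R)%:C%C) => e1 e2 c.
case: (tnth _ _) => [p|] //=; congr Some; rewrite mulrDr addrA.
by congr (_ + _); case: (c * e1) => c1 c2; apply/eqP; rewrite eq_complex /= !eqxx.
Qed.

Lemma measurable_tnth_cell x : measurable_fun [set: space] (fun w => cell w x).
Proof. exact: measurable_tnth. Qed.

Lemma measurable_shift y : measurable_fun [set: space] (shift y).
Proof.
apply/measurable_fun_tnthP => k.
rewrite (_ : _ \o _ = fun w => omap (translate (period (quo n (bp (unidx k) + y)))) (cell w (bp (unidx k) + y))); last first.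
  by apply/funext => w /=; rewrite tnth_mktuple.
apply: (measurableT_comp (measurable_omap (measurable_translate _))).
exact: measurable_tnth_cell.
Qed.

Definition relabel y (k : 'I_(N * N)) := idx (wrap n (bp (unidx k) + y)).

Lemma relabelK y : cancel (relabel y) (relabel (- y)).
Proof. by move=> k; rewrite /relabel idxK wrap_addK unidxK. Qed.

Lemma relabelNK y : cancel (relabel (- y)) (relabel y).
Proof. by have := @relabelK (- y); rewrite opprK. Qed.

(** [shift] permutes the entries and translates each of them. Both operations preserve the measure
    of boxes, which determine the product measure. *)
Lemma mu_shift y A : measurable A -> muN (shift y @^-1` A) = muN A.
Proof.
move=> mA; have ms := measurable_shift y.
rewrite -[LHS]/(pushforward (muN) (shift y) A).
apply/esym; apply: (@power_measure_unique _ _ R (hole_measure (@plane_measure R)) (N * N) (pushforward (muN) (shift y))) => // B mB.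
have rB : bijective (relabel y).
  by exists (relabel (- y)); [exact: relabelK|exact: relabelNK].
pose c k := omap (translate (period (quo n (bp (unidx k) + y)))).
have mc k A' : measurable A' -> measurable (c k @^-1` A').
  move=> mA'; rewrite -[X in measurable X]setTI.
  exact: (measurable_omap (measurable_translate _)).
have E : shift y @^-1` box B = box (fun j => c (relabel (- y) j) @^-1` B (relabel (- y) j)).
  apply/seteqP; split=> w /= h j.
    have := h (relabel (- y) j); rewrite tnth_mktuple /cell -/(relabel _ _).
    by rewrite relabelNK.
  by rewrite /shift tnth_mktuple; have := h (relabel y j); rewrite relabelK.
rewrite [LHS](_ : _ = muN (shift y @^-1` box B))// E.
rewrite [LHS](power_measure_box _ (fun j => mc _ _ (mB _))).
rewrite (reindex (relabel y)) /=; last exact: onW_bij.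
by apply: eq_bigr => k _; rewrite relabelK hole_measure_translate.
Qed.

End shifts.

(* [sh] is a measure-preserving action of the lattice, [M] contains exactly one
   point of each orbit in [E] of the sublattice [N * A2], and [B] is a measurable
   kernel of [E]: integrals over [B] inherit the invariance of [E] under [sh]. *)
Section action_invariance.
Local Open Scope ereal_scope.
Context d (T : measurableType d) (R : realType).
Variables (mu : {measure set T -> \bar R}) (sh : A2 -> T -> T) (N : nat).
Hypothesis msh : forall y, measurable_fun [set: T] (sh y).
Hypothesis mu_sh : forall y A, measurable A -> mu (sh y @^-1` A) = mu A.
Hypothesis sh0 : forall w, sh 0%R w = w.
Hypothesis shD : forall y z w, sh y (sh z w) = sh (y + z)%R w.

Lemma action_shK y : cancel (sh y) (sh (- y)%R).
Proof. by move=> w; rewrite shD addNr sh0. Qed.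

Lemma action_shNK y : cancel (sh (- y)%R) (sh y).
Proof. by move=> w; rewrite shD addrN sh0. Qed.

Lemma integral_action y (D : set T) (h : T -> \bar R) :
  measurable D -> measurable_fun [set: T] h -> (forall w, 0 <= h w) ->
  \int[mu]_(w in sh y @^-1` D) h (sh y w) = \int[mu]_(w in D) h w.
Proof.
move=> mD mh h0; have ms := msh y.
transitivity (\int[pushforward mu (sh y)]_(w in D) h w).
  by rewrite (ge0_integral_pushforward ms)//; exact: measurable_funTS.
by apply: eq_measure_integral => A mA _; exact: mu_sh.
Qed.

Variables (E M B : set T) (g : T -> \bar R) (f : T -> R) (C : R).
Hypothesis mM : measurable M.
Hypothesis EM : E `<=` M.
Hypothesis stable : forall w y, E w -> M (sh y w) -> E (sh y w).
Hypothesis rep_exists : forall w y, E w -> exists q : A2, M (sh (y + q *+ N)%R w).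
Hypothesis rep_unique : forall w (y q q' : A2), E w ->
  M (sh (y + q *+ N)%R w) -> M (sh (y + q' *+ N)%R w) -> q = q'.
Hypothesis g0 : forall w, 0 <= g w.
Hypothesis mg : measurable_fun [set: T] g.
Hypothesis g_sh : forall y w, g (sh y w) = g w.
Hypothesis f0 : forall w, (0 <= f w)%R.
Hypothesis mf : measurable_fun [set: T] f.
Hypothesis f_sh : forall q w, f (sh (q *+ N)%R w) = f w.
Hypothesis fC : forall w, E w -> (f w <= C)%R.
Hypothesis mB : measurable B.
Hypothesis BE : B `<=` E.
Hypothesis B_kernel : forall A, measurable A ->
  \int[mu]_(w in A `&` E) g w = \int[mu]_(w in A `&` B) g w.

Let preim y (A : set T) : measurable A -> measurable (sh y @^-1` A).
Proof.
by move=> mA; rewrite -[X in measurable X]setTI; exact: msh.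
Qed.

(** [B] is cut according to the period q that brings sh y w back into [M]. On each piece sh (y + q
    N) preserves the measure, [g], and the value f (sh y w); the images are disjoint subsets of [E]
    by uniqueness of representatives, and the kernel property compares their union with [B]. *)
Lemma action_integral_le y :
  \int[mu]_(w in B) ((f (sh y w))%:E * g w) <=
  \int[mu]_(w in B) ((f w)%:E * g w).
Proof.
pose h w := (f w)%:E * g w.
have h0 w : 0 <= h w by rewrite mule_ge0// lee_fin.
have mh : measurable_fun [set: T] h.
  by apply: emeasurable_funM => //; exact/measurable_EFinP.
(* Periods are enumerated through [pickle_inv]; indices that encode none give the empty set. *)
pose u k : set T -> set T := fun A =>
  if (pickle_inv k : option A2) is Some q then sh (y + q *+ N)%R @^-1` A else set0.
pose v k : set T -> set T := fun A =>
  if (pickle_inv k : option A2) is Some q then sh (- (y + q *+ N))%R @^-1` A else set0.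
pose D k := v k B `&` M.
have mu_ k A : measurable A -> measurable (u k A).
  by move=> mA; rewrite /u; case: pickle_inv => // q; exact: preim.
have mD k : measurable (D k).
  by apply: measurableI => //; rewrite /v; case: pickle_inv => // q; exact: preim.
have DE k : D k `<=` E.
  rewrite /D /v; case: pickle_inv => [q|]; last by rewrite set0I.
  by move=> w [/= /BE Ew Mw]; rewrite -[w](action_shNK (y + q *+ N)%R); apply: stable => //; rewrite action_shNK.
have mhD A : measurable_fun A h by exact: measurable_funTS.
have BU : B = \bigcup_k (u k M `&` B).
  apply/seteqP; split=> [w Bw|w [k _ []//]].
  have [q Mq] := rep_exists y (BE Bw).
  exists (pickle q); first exact: I.
  by split; last exact: Bw; rewrite /u pickleK_inv; exact: Mq.
have tB : trivIset setT (fun k => u k M `&` B).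
  apply/trivIsetP => i j _ _; apply: contraNeq => /set0P[w [[ui Bw] [uj _]]].
  move: ui uj; rewrite /u.
  case Ei : (pickle_inv i) => [q|//]; case Ej : (pickle_inv j) => [q'|//] /= Mq Mq'.
  move: Ei Ej; rewrite (rep_unique (BE Bw) Mq Mq') => Ei Ej.
  have := @pickle_invK A2 i; have := @pickle_invK A2 j.
  by rewrite Ei Ej /= => -> ->.
have tD : trivIset setT D.
  apply/trivIsetP => i j _ _; apply: contraNeq => /set0P[w [Di Dj]].
  have Ew := DE _ _ Di; move: Di Dj; rewrite /D /v.
  case Ei : (pickle_inv i) => [q|]; last by case.
  case Ej : (pickle_inv j) => [q'|]; last by move=> _ [].
  move=> [/= /BE/EM Mq _] [/= /BE/EM Mq' _].
  have /oppr_inj qq : (- q = - q')%R.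
    by apply: (rep_unique (y := (- y)%R) Ew); rewrite mulNrn -opprD.
  have := @pickle_invK A2 i; have := @pickle_invK A2 j.
  by rewrite Ei Ej qq /= => -> ->.
have -> : \int[mu]_(w in B) ((f (sh y w))%:E * g w) =
    \int[mu]_(w in \bigcup_k D k) h w.
  rewrite {1}BU ge0_integral_bigcup//; last 3 first.
  - by move=> k; apply: measurableI => //; exact: mu_.
  - apply: measurable_funTS; apply: emeasurable_funM => //; apply/measurable_EFinP.
    by apply: measurableT_comp => //; exact: msh.
  - by move=> w _; rewrite mule_ge0// lee_fin.
  rewrite (ge0_integral_bigcup mu mD (mhD _) (fun w _ => h0 w) tD).
  apply: eq_eseriesr => k _.
  rewrite /D /u /v; case: pickle_inv => [q|]; last by rewrite !set0I !integral_set0.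
  have mDq : measurable (sh (- (y + q *+ N))%R @^-1` B `&` M).
    by apply: measurableI => //; exact: preim.
  rewrite -(integral_action (y + q *+ N)%R mDq mh h0).
  rewrite preimage_setI setIC -comp_preimage.
  rewrite (_ : _ \o _ = id); last by apply/funext => w /=; exact: action_shK.
  apply: eq_integral => w _; rewrite /h g_sh.
  by rewrite addrC -shD f_sh.
set D' := \bigcup_k D k.
have mD' : measurable D' by exact: bigcupT_measurable.
have D'E : D' `<=` E by move=> w [k _] /DE.
rewrite -(setUIDK D' B) ge0_integral_setU//; last 3 first.
- exact: measurableI.
- exact: measurableD.
- by apply/disj_setPS => w [[_ Bw] [_ /(_ Bw)]].
(* Outside the kernel the union has no [g]-weight, and [f] is bounded on [E], so this part
   contributes nothing. *)
have gz : \int[mu]_(w in D' `\` B) g w = 0.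
  have := B_kernel (measurableD mD' mB).
  rewrite [(_ `\` _) `&` B]setIC setDIK integral_set0.
  by rewrite (_ : (D' `\` B) `&` E = D' `\` B)//; apply/setIidl => w [/D'E].
have mDB : measurable (D' `\` B) by exact: measurableD.
have -> : \int[mu]_(w in D' `\` B) h w = 0.
  apply/eqP; rewrite eq_le integral_ge0// andbT.
  apply: (@le_trans _ _ (\int[mu]_(w in D' `\` B) (`|C|%:E * g w))).
    apply: ge0_le_integral => //.
    - by apply: measurable_funTS; exact: measurable_funeM.
    - move=> w [/D'E Ew _]; apply: lee_wpmul2r => //.
      by rewrite lee_fin (le_trans (fC Ew))// ler_norm.
  rewrite ge0_integralZl//; last exact: measurable_funTS.
  by rewrite gz mule0.
rewrite adde0; apply: ge0_subset_integral => //; exact: measurableI.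
Qed.

End action_invariance.

(** * Allowed configurations under relabelling, and their normalized representatives *)

Section relabelling.
Variable R : realType.
Implicit Types (om : config R) (x y z : A2).

Definition translated om y : config R := fun x => om (x + y).

Lemma adj_add x y w : adj R (x + w) (y + w) = adj R x y.
Proof. by rewrite !adjP opprD addrACA subrr addr0. Qed.

Lemma hat_translated om y x : hat (translated om y) x = hat om (x + y).
Proof.
rewrite /hat /translated; case: (om _) => // .
by congr (_ * _); apply: eq_bigr => z _; rewrite /pos addrAC.
Qed.

Lemma Omega1_translated alpha om y : Omega1 alpha om -> Omega1 alpha (translated om y).
Proof. by move=> h x z xz; apply: h; rewrite adj_add. Qed.

Lemma Omega2_translated om y : Omega2 om -> Omega2 (translated om y).
Proof.
move=> h x z hx hz; have [/addIr|] := h _ _ hx hz; first by left.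
by rewrite !embD opprD addrACA subrr addr0; right.
Qed.

Lemma Omega3_translated om y : Omega3 om -> Omega3 (translated om y).
Proof.
move=> [F aF bF]; exists (fun p => F (p + emb R y)).
  move=> x z hz s t s0 t0 st; rewrite !hat_translated.
  rewrite [x + z + y]addrAC [x + rot z + y]addrAC -aF// embD.
  by congr F; ring.
apply: (bij_comp bF); exists (fun p => p - emb R y) => p; first by rewrite addrK.
by rewrite subrK.
Qed.

Lemma Omega4_translated om y : Omega4 om -> Omega4 (translated om y).
Proof.
move=> h x z hz; rewrite !hat_translated [x + z + y]addrAC [x + rot z + y]addrAC.
exact: h.
Qed.

End relabelling.

Section fundamental_domains.
Variable R : realType.
Implicit Types (p : R[i]) (L : R).

(* Coordinates of a point in the basis [1, tau^2]. *)
Definition coord2 p : R := complex.Im p / sin (pi / 3).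
Definition coord1 p : R := complex.Re p + coord2 p / 2.

Lemma tau2E : tau R ^+ 2 = ((- 2^-1) +i* sin (pi / 3))%C.
Proof.
rewrite tau2 /tau cos_pi3; apply/eqP; rewrite eq_complex /=.
by apply/andP; split; apply/eqP; field.
Qed.

Lemma coordK p : p = (coord1 p)%:C%C + tau R ^+ 2 * (coord2 p)%:C%C.
Proof.
have s0 := sin_pi3_gt0 R; have s1 := lt0r_neq0 s0.
rewrite tau2E /coord1; case: p => a b; apply/eqP; rewrite eq_complex /=.
by rewrite /coord2 /=; apply/andP; split; apply/eqP; field.
Qed.

Lemma coord_unique (s t : R) :
  coord1 (s%:C%C + tau R ^+ 2 * t%:C%C) = s /\ coord2 (s%:C%C + tau R ^+ 2 * t%:C%C) = t.
Proof.
have s0 := sin_pi3_gt0 R; have s1 := lt0r_neq0 s0.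
by rewrite tau2E /coord1 /coord2 /=; split; field.
Qed.

Lemma fundamental_domainP L p : fundamental_domain L p <->
  (0 <= coord1 p < L) && (0 <= coord2 p < L).
Proof.
split=> [[s [t [hs ht ->]]]|/andP[h1 h2]].
  by have [-> ->] := coord_unique s t; apply/andP.
by exists (coord1 p), (coord2 p); split => //; exact: coordK.
Qed.

Lemma coord1D p L (q : A2) : coord1 (p + L%:C%C * emb R q) = coord1 p + L * q.1%:~R.
Proof.
have s1 := lt0r_neq0 (sin_pi3_gt0 R).
by rewrite embE; case: p => a b; rewrite /coord1 /coord2 /=; field.
Qed.

Lemma coord2D p L (q : A2) : coord2 (p + L%:C%C * emb R q) = coord2 p + L * q.2%:~R.
Proof.
have s1 := lt0r_neq0 (sin_pi3_gt0 R).
by rewrite embE; case: p => a b; rewrite /coord1 /coord2 /=; field.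
Qed.

Lemma interval_representative L (t : R) : 0 < L -> exists k : int, 0 <= t + L * k%:~R < L.
Proof.
move=> L0; exists (- Num.floor (t / L)).
have h1 := floor_le (t / L). have h2 := floorD1_gt (t / L).
rewrite ler_pdivlMr// in h1; rewrite ltr_pdivrMr// in h2.
rewrite rmorphN /=; move: (Num.floor _) h1 h2 => k; rewrite intrD; lra.
Qed.

Lemma interval_representative_unique L (t : R) (k k' : int) :
  0 <= t + L * k%:~R < L -> 0 <= t + L * k'%:~R < L -> k = k'.
Proof.
move=> h h'; have L0 : 0 < L by case/andP: h; exact: le_lt_trans.
have H (a b : int) : 0 <= t + L * a%:~R < L -> 0 <= t + L * b%:~R < L -> a < b + 1.
  move=> ha hb; rewrite -(@ltr_int R) intrD -(ltr_pM2l L0) mulrDr mulr1; lra.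
have := H _ _ h h'; have := H _ _ h' h; lia.
Qed.

Lemma fundamental_representative L p : 0 < L ->
  exists q : A2, fundamental_domain L (p + L%:C%C * emb R q).
Proof.
move=> L0; have [k1 h1] := interval_representative (coord1 p) L0.
have [k2 h2] := interval_representative (coord2 p) L0.
by exists (k1, k2); apply/fundamental_domainP; rewrite coord1D coord2D h1.
Qed.

Lemma fundamental_representative_unique L p (q q' : A2) :
  fundamental_domain L (p + L%:C%C * emb R q) ->
  fundamental_domain L (p + L%:C%C * emb R q') -> q = q'.
Proof.
move=> /fundamental_domainP/andP[h1 h2] /fundamental_domainP/andP[h1' h2'].
move: h1 h2 h1' h2'; rewrite !coord1D !coord2D => h1 h2 h1' h2'.
case: q q' h1 h2 h1' h2' => [a b] [c e] /= h1 h2 h1' h2'.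
by rewrite (interval_representative_unique h1 h1') (interval_representative_unique h2 h2').
Qed.

End fundamental_domains.

Section normalization.
Variables (R : realType) (n : nat) (l : R).
Local Notation N := n.+1.
Local Notation bp := (@box_point N).
Implicit Types om : config R.

Lemma lex_lt_trichotomy (x y : A2) : [\/ x = y, lex_lt x y | lex_lt y x].
Proof.
case: x y => a b [c e]; rewrite /lex_lt /=.
have [] := ltgtP a c; [by constructor 2|by constructor 3|move=> ->].
by have [] := ltgtP b e; [constructor 2|constructor 3|move=> ->; constructor 1].
Qed.

Lemma in_boxP x : reflect (exists k, x = bp k) (in_box N x).
Proof.
apply: (iffP andP) => [[h1 h2]|[[i j] ->]]; last first.
  by have := ltn_ord i; have := ltn_ord j; split=> /=; lia.
exists (wrap n x); rewrite box_wrap; case: x h1 h2 => a b /= h1 h2.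
by rewrite !modz_small.
Qed.

Definition first_site om x :=
  [/\ in_box N x, ~~ hole om x & forall y, in_box N y -> lex_lt y x -> hole om y].

(** The row-major index [idx] is increasing for the lexicographic order, so an occupied site of
    least index will do. *)
Lemma first_site_exists om y : in_box N y -> ~~ hole om y -> exists x, first_site om x.
Proof.
move=> /in_boxP[k0 ->] hk0.
pose m (k : 'I_N * 'I_N) := nat_of_ord (idx k).
have [k hk kmin] := @arg_minnP _ k0 (fun k => ~~ hole om (bp k)) m hk0.
exists (bp k); split=> //; first by apply/in_boxP; exists k.
move=> _ /in_boxP[k' ->] lt; apply: contraT => /kmin; rewrite leqNgt => /negP[].
move: k k' lt {hk kmin} => [[i hi] [j hj]] [[i' hi'] [j' hj']].
by rewrite /lex_lt /m /= !ltz_nat eqz_nat => /orP[|/andP[/eqP ->]] ?; nia.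
Qed.

Lemma first_site_unique om x x' : first_site om x -> first_site om x' -> x = x'.
Proof.
move=> [bx hx fx] [bx' hx' fx'].
have [//|xx'|x'x] := lex_lt_trichotomy x x'.
  by have := fx' _ bx xx'; rewrite (negbTE hx).
by have := fx _ bx' x'x; rewrite (negbTE hx').
Qed.

Lemma normalizedP om x : first_site om x ->
  normalized l N om <-> fundamental_domain (l * N%:R) (pos om x).
Proof.
move=> fx; have [bx hx xmin] := fx; split => [h|h x' p bx' omx' x'min].
  apply: (h x) => //; last by move=> y by_ /(xmin _ by_)/eqP.
  by move: hx; rewrite /hole /pos; case: (om x).
have E : x = x'.
  apply: (first_site_unique fx); split=> // [|y byy yx'].
    by rewrite /hole omx'.
  by rewrite /hole x'min.
by move: h; rewrite /pos E omx'.
Qed.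

Lemma first_site_hole om om' x : (forall y, hole om' y = hole om y) ->
  first_site om x -> first_site om' x.
Proof. by move=> hh [bx hx fx]; split=> // [|y byy yx]; rewrite hh//; exact: fx. Qed.

Lemma Omega2_occupied om : (1 < N)%N -> Omega2 om ->
  exists2 y, in_box N y & ~~ hole om y.
Proof.
move=> N1 om2; have [h0|] := boolP (hole om 0); last by exists 0.
exists unit1; first by rewrite /in_box /=; lia.
by have := hole_nbr om2 h0 (isT : unit1 \in nbrs); rewrite add0r => ->.
Qed.

(** A period moves no holes, hence the first occupied site stays the same and only its value is
    translated. Existence and uniqueness of the normalizing period thus reduce to those of a
    representative in the fundamental domain. *)
Lemma normalized_period om y q x : periodic l N om -> first_site (translated om y) x ->
  normalized l N (translated om (y + q *+ N)) <->
  fundamental_domain (l * N%:R) (pos om (x + y) + (l * N%:R)%:C%C * emb R q).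
Proof.
move=> omN fx; have [bx hx _] := fx.
rewrite -(periodic_pos _ omN)// -addrA; apply: (normalizedP (om := translated om (y + q *+ N))).
apply: first_site_hole fx => z; rewrite /hole /translated addrA.
exact: periodic_hole omN.
Qed.

Hypothesis lN0 : 0 < l * N%:R.

Lemma normalized_exists om y : (1 < N)%N -> periodic l N om -> Omega2 om ->
  exists q, normalized l N (translated om (y + q *+ N)).
Proof.
move=> N1 omN om2; have [z bz hz] := Omega2_occupied N1 (Omega2_translated (y := y) om2).
have [x fx] := first_site_exists bz hz.
have [q hq] := fundamental_representative (pos om (x + y)) lN0.
by exists q; apply/(normalized_period _ omN fx).
Qed.

Lemma normalized_unique om y q q' : (1 < N)%N -> periodic l N om -> Omega2 om ->
  normalized l N (translated om (y + q *+ N)) ->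
  normalized l N (translated om (y + q' *+ N)) -> q = q'.
Proof.
move=> N1 omN om2; have [z bz hz] := Omega2_occupied N1 (Omega2_translated (y := y) om2).
have [x fx] := first_site_exists bz hz.
move=> /(normalized_period _ omN fx) hq /(normalized_period _ omN fx) hq'.
exact: fundamental_representative_unique hq hq'.
Qed.

End normalization.

(** * Measurability of the observables *)

Section measurability.
Variables (R : realType) (n : nat) (l : R).
Local Notation N := n.+1.
Local Notation space := ((N * N).-tuple (option (plane R))).
Local Notation bp := (@box_point N).

Lemma measurable_option_fun d d' (T : measurableType d) (U : measurableType d')
  (f : option T -> U) : measurable_fun [set: T] (f \o Some) ->
  measurable_fun [set: option T] f.
Proof.
move=> mf _ A mA; rewrite setTI.
by have := mf measurableT _ mA; rewrite setTI.
Qed.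

Lemma measurable_fun_cell d (U : measurableType d) (F : option (plane R) -> U) x :
  measurable_fun [set: plane R] (F \o Some) ->
  measurable_fun [set: space] (fun w => F (cell w x)).
Proof.
move=> mF; apply: (measurableT_comp (measurable_option_fun mF)).
exact: measurable_tnth_cell.
Qed.

Lemma measurable_fun_pos (f : R[i] -> R) x :
  (forall c, measurable_fun [set: plane R] (fun p : plane R => f ((p.1 +i* p.2)%C + c))) ->
  measurable_fun [set: space] (fun w => f (pos (extend l w) x)).
Proof.
move=> mf; pose c := (l * N%:R)%:C%C * emb R (quo n x).
pose F (o : option (plane R)) := f (odflt 0 (omap (fun p : plane R => (p.1 +i* p.2)%C + c) o)).
rewrite (_ : (fun _ => _) = fun w => F (cell w x)).
  by apply: (measurable_fun_cell (F := F)); exact: mf.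
by apply/funext => w; rewrite /pos extend_cell.
Qed.

Lemma measurable_Re_pos x :
  measurable_fun [set: space] (fun w => complex.Re (pos (extend l w) x) : R).
Proof.
apply: measurable_fun_pos => -[a b].
by rewrite (_ : (fun _ => _) = fun p : plane R => p.1 + a)//; exact: measurable_funD.
Qed.

Lemma measurable_Im_pos x :
  measurable_fun [set: space] (fun w => complex.Im (pos (extend l w) x) : R).
Proof.
apply: measurable_fun_pos => -[a b].
by rewrite (_ : (fun _ => _) = fun p : plane R => p.2 + b)//; exact: measurable_funD.
Qed.

Lemma measurable_hole x : measurable_fun [set: space] (fun w => hole (extend l w) x).
Proof.
rewrite (_ : (fun _ => _) = fun w => (fun o : option (plane R) => o == None) (cell w x)).
  by apply: (measurable_fun_cell (F := fun o => o == None)); exact: measurable_cst.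
by apply/funext => w; rewrite /hole extend_cell; case: cell.
Qed.

Lemma measurable_holes x y :
  measurable_fun [set: space] (fun w => hole (extend l w) x || hole (extend l w) y).
Proof. by apply: measurable_or; exact: measurable_hole. Qed.

Lemma measurable_dist x y (c : R[i]) :
  measurable_fun [set: space] (fun w => normc (pos (extend l w) x - pos (extend l w) y - c) : R).
Proof.
rewrite (_ : (fun _ => _) = fun w => Num.sqrt (
    (complex.Re (pos (extend l w) x) - complex.Re (pos (extend l w) y) - complex.Re c) ^+ 2 +
    (complex.Im (pos (extend l w) x) - complex.Im (pos (extend l w) y) - complex.Im c) ^+ 2)).
  apply: measurableT_comp.
    by apply: continuous_measurable_fun; exact: sqrt_continuous.
  by apply: measurable_funD; apply: measurable_funX; apply: measurable_funB => //;
    apply: measurable_funB; (exact: measurable_Re_pos || exact: measurable_Im_pos).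
apply/funext => w; case: (pos _ x) (pos _ y) => [a b] [a' b'].
by case: c.
Qed.

Lemma measurable_sq_deviation x z :
  measurable_fun [set: space] (fun w => sq_deviation l (extend l w) x z).
Proof.
apply: measurable_fun_ifT => //; first exact: measurable_holes.
by apply: measurable_funX; exact: measurable_dist.
Qed.

Lemma measurable_gibbs_weight (V : R -> R) (beta m : R) : measurable_fun [set: R] V ->
  measurable_fun [set: space] (gibbs_weight V l beta m (N := N)).
Proof.
move=> mV; apply/measurable_EFinP; apply: measurableT_comp => //.
apply: measurable_funN; apply: measurable_funM => //; apply: measurable_funD.
  apply: measurable_funM => //; apply: measurable_sum => k; apply: measurable_sum => z.
  apply: measurable_fun_ifT => //; first exact: measurable_holes.
  apply: measurableT_comp => //; have := measurable_dist (bp k) (bp k + z) 0.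
  by congr (measurable_fun _); apply/funext => w; rewrite subr0.
apply: measurable_funM => //; apply: measurable_sum => k.
apply: (measurableT_comp (f := fun b : bool => b%:R : R)); last exact: measurable_hole.
done.
Qed.

End measurability.

(** * Measurable normalization and invariance of the Gibbs weight *)

Section gibbs_invariance.
Variables (R : realType) (n : nat) (l : R).
Local Notation N := n.+1.
Local Notation space := ((N * N).-tuple (option (plane R))).
Local Notation bp := (@box_point N).

Definition normalized_set : set space := [set w | normalized l N (extend l w)].

Lemma measurable_fundamental_domain L :
  measurable [set p : plane R | fundamental_domain L (p.1 +i* p.2)%C].
Proof.
rewrite (_ : mkset _ =
  (fun p : plane R => coord1 (p.1 +i* p.2)%C) @^-1` `[0, L[%classic `&`
  (fun p : plane R => coord2 (p.1 +i* p.2)%C) @^-1` `[0, L[%classic); last first.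
  apply/seteqP; split => p; rewrite /= !in_itv /=.
    by move=> /fundamental_domainP/andP.
  by move=> [h1 h2]; apply/fundamental_domainP; rewrite h1.
have m2 : measurable_fun [set: plane R] (fun p : plane R => coord2 (p.1 +i* p.2)%C).
  rewrite (_ : (fun _ => _) = fun p : plane R => p.2 * (sin (pi / 3))^-1)//.
  by apply: measurable_funM => //; exact: measurable_cst.
have m1 : measurable_fun [set: plane R] (fun p : plane R => coord1 (p.1 +i* p.2)%C).
  rewrite (_ : (fun _ => _) = fun p : plane R => p.1 + coord2 (p.1 +i* p.2)%C * 2^-1)//.
  by apply: measurable_funD => //; apply: measurable_funM => //; exact: measurable_cst.
by apply: measurableI; rewrite -[X in measurable X]setTI; [exact: m1|exact: m2].
Qed.

(** A finite combination of conditions on single cells: every site of the box lies in the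
    fundamental domain, is a hole, or is preceded by an occupied site. *)
Lemma measurable_normalized_set : measurable normalized_set.
Proof.
pose L := l * N%:R.
pose A k : set space := [set w | fundamental_domain L (pos (extend l w) (bp k))].
pose H k : set space := [set w | hole (extend l w) (bp k)].
have mH k : measurable (H k).
  have := @measurable_hole R n l (bp k) measurableT [set true] I.
  by rewrite setTI; congr measurable; apply/seteqP.
have mA k : measurable (A k).
  pose c := (l * N%:R)%:C%C * emb R (quo n (bp k)).
  pose F (o : option (plane R)) := `[< fundamental_domain L
    (odflt 0 (omap (fun p : plane R => (p.1 +i* p.2)%C + c) o)) >].
  have mF : measurable_fun [set: plane R] (F \o Some).
    apply: (@measurable_fun_bool _ _ _ _ true).
    rewrite setTI (_ : _ @^-1` _ = translate (complex.Re c, complex.Im c) @^-1`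
        [set p : plane R | fundamental_domain L (p.1 +i* p.2)%C]).
      rewrite -[X in measurable X]setTI; apply: measurable_translate => //.
      exact: measurable_fundamental_domain.
    have E (p : plane R) : (p.1 +i* p.2)%C + c =
        ((p.1 + complex.Re c) +i* (p.2 + complex.Im c))%C by move: (c) => [].
    apply/seteqP; split=> p /=; rewrite /F /= E; first by move/asboolP.
    by move=> h; apply/asboolP.
  have := @measurable_fun_cell R n _ bool F (bp k) mF measurableT [set true] I.
  rewrite setTI; congr measurable; apply/seteqP; rewrite /A /F; split=> w /=;
    rewrite /pos extend_cell; first by move/asboolP.
  by move=> h; apply/asboolP.
pose B k : set space := \bigcup_(k' in [set k' | lex_lt (bp k') (bp k)]) ~` H k'.
rewrite (_ : normalized_set = \bigcap_(k in setT) (A k `|` H k `|` B k)).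
  apply: fin_bigcap_measurable => // k _; apply: measurableU; first exact: measurableU.
  by apply: fin_bigcup_measurable => // k' _; exact: measurableC.
apply/seteqP; split=> [w hw k _|w hw x p].
  have [hk|hk] := boolP (hole (extend l w) (bp k)); first by left; right.
  have [[k' lt hk']|nB] := pselect (B k w); first by right; exists k'.
  left; left; apply: (hw (bp k)).
  - by apply/in_boxP; exists k.
  - by move: hk; rewrite /hole /pos; case: (extend l w _).
  - move=> _ /in_boxP[k' ->] lt; apply/eqP; apply: contrapT => hk'.
    by apply: nB; exists k'.
move=> /in_boxP[k ->] wp xmin; have [[|]|[k' lt hk']] := hw k I.
- by rewrite /A /= /pos wp.
- by rewrite /H /= /hole wp.
- by case: hk'; rewrite /H /= /hole xmin//; apply/in_boxP; exists k'.
Qed.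

Lemma sq_deviation_shift (w : space) x y z :
  sq_deviation l (extend l (shift l y w)) x z = sq_deviation l (extend l w) (x + y) z.
Proof. by rewrite extend_shift /sq_deviation /hole /pos addrAC. Qed.

Lemma periodic_dist (om : config R) x y z : periodic l N om ->
  ~~ hole om x -> ~~ hole om y ->
  pos om (x + z *+ N) - pos om (y + z *+ N) = pos om x - pos om y.
Proof.
by move=> omN hx hy; rewrite !(periodic_pos _ omN)//; ring.
Qed.

Lemma sq_deviation_period (om : config R) x z q : periodic l N om ->
  sq_deviation l om (x + q *+ N) z = sq_deviation l om x z.
Proof.
move=> omN; rewrite /sq_deviation [x + _ + z]addrAC !(periodic_hole _ _ omN).
by case: ifPn => // /norP[hxz hx]; rewrite periodic_dist.
Qed.

Lemma pair_energy_period V (om : config R) x y q : periodic l N om ->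
  pair_energy V om (x + q *+ N) (y + q *+ N) = pair_energy V om x y.
Proof.
move=> omN; rewrite /pair_energy !(periodic_hole _ _ omN).
by case: ifPn => // /norP[hx hy]; rewrite periodic_dist.
Qed.

Lemma hamiltonian_translated V m (om : config R) y : periodic l N om ->
  hamiltonian V m N (translated om y) = hamiltonian V m N om.
Proof.
move=> omN; rewrite /hamiltonian; congr (_ * _ + _ * _).
  rewrite exchange_big [RHS]exchange_big /=; apply: eq_bigr => z _.
  rewrite -[RHS](@sum_shift _ _ (fun x => pair_energy V om x (x + z)) y).
    by apply: eq_bigr => k _; rewrite /pair_energy /hole /pos /translated [_ + z + y]addrAC.
  by move=> x q; rewrite addrAC pair_energy_period.
rewrite -[RHS](@sum_shift _ _ (fun x => (hole om x)%:R) y)//.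
by move=> x q; rewrite (periodic_hole _ _ omN).
Qed.

Lemma gibbs_weight_shift V beta m y (w : space) :
  gibbs_weight V l beta m (shift l y w) = gibbs_weight V l beta m w.
Proof.
rewrite /gibbs_weight extend_shift; do 4 congr (_ _).
exact/hamiltonian_translated/extend_periodic.
Qed.

Lemma Omega_shift alpha (w : space) y : @Omega R alpha l N w ->
  normalized_set (shift l y w) -> @Omega R alpha l N (shift l y w).
Proof.
move=> [_ h1 h2 h3 h4]; rewrite /normalized_set /Omega /allowed /= extend_shift => h.
split=> //; [exact: Omega1_translated|exact: Omega2_translated|
  exact: Omega3_translated|exact: Omega4_translated].
Qed.

End gibbs_invariance.

(** * Volume of the allowed configurations *)

Section sequential_volume.
Local Open Scope ereal_scope.
Context d (T : measurableType d) (R : realType).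
Variable mu : {sigma_finite_measure set T -> \bar R}.
Variables (ok : seq T -> set T) (kappa : nat -> R).
Hypothesis mok : forall s, measurable (ok s).
Hypothesis kappa0 : forall k, (0 <= kappa k)%R.
Hypothesis ok_kappa : forall s, mu (ok s) <= (kappa (size s))%:E.

Fixpoint all_ok (s t : seq T) : Prop :=
  if t is c :: t' then ok s c /\ all_ok (rcons s c) t' else True.

(* The product measure of a nonmeasurable set still integrates the measures of
   its sections, and this integral is monotone. *)
Lemma sequential_volume n s (A : set (n.-tuple T)) :
  (forall t, A t -> all_ok s t) ->
  power_measure mu n A <= (\prod_(i < n) kappa (size s + i))%:E.
Proof.
elim: n s A => [|n IHn] s A hA.
  rewrite big_ord0 /= diracE lee_fin; case: (_ \in _) => //=; exact: ler01.
rewrite big_ord_recl addn0 /= /power_step /pushforward /product_measure1.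
set K := (\prod_(i < n) _)%R.
have K0 : (0 <= K)%R by apply: prodr_ge0.
apply: (@le_trans _ _ (\int[mu]_x (K%:E * (\1_(ok s) x)%:E))).
  apply: ge0_le_integral_nonmeasurable => x; first exact: measure_ge0.
  rewrite indicE; have [okx|nokx] := boolP (x \in ok s).
    rewrite mule1 /=; have -> : K = (\prod_(i < n) kappa (size (rcons s x) + i))%R.
      by apply: eq_bigr => i _; rewrite size_rcons addnS.
    apply: IHn => t; rewrite /xsection /= inE => /hA /=.
    by case.
  rewrite mule0 /= (_ : xsection _ _ = set0) ?measure0//.
  apply/seteqP; split=> // t; rewrite /xsection /= inE => /hA /= [okx _].
  by move: nokx; rewrite notin_setE.
rewrite ge0_integralZl//; last by apply/measurable_EFinP; exact: measurable_indic.
rewrite integral_indic// setIT muleC EFinM; apply: lee_pmul => //.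
exact: ok_kappa.
Qed.

Lemma all_okP (x0 : T) s t :
  (forall k, (k < size t)%N -> ok (s ++ take k t) (nth x0 t k)) -> all_ok s t.
Proof.
elim: t s => [//|c t IHt] s h /=; split.
  by have := h 0%N isT; rewrite take0 cats0.
by apply: IHt => k kt; have := h k.+1 kt; rewrite /= cat_rcons.
Qed.

End sequential_volume.

Section partition_upper_bound.
Variables (R : realType) (n : nat) (l alpha : R).
Local Notation N := n.+1.
Local Notation space := ((N * N).-tuple (option (plane R))).
Local Notation H := (hole_measure (@plane_measure R)).
Hypothesis alpha1 : alpha <= 1.
Hypothesis l02 : 0 < l < 2.
Hypothesis N1 : (1 < N)%N.

Definition square (c : plane R) (r : R) : set (plane R) :=
  `[c.1 - r, c.1 + r]%classic `*` `[c.2 - r, c.2 + r]%classic.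

Lemma squareP c r (p : plane R) : square c r p <->
  `|p.1 - c.1| <= r /\ `|p.2 - c.2| <= r.
Proof.
have E (a b : R) : (a \in `[b - r, b + r]) = (`|a - b| <= r).
  by rewrite in_itv /= ler_norml; apply/idP/idP; lra.
by rewrite /square /= -!E.
Qed.

Lemma measurable_square c r : measurable (square c r).
Proof. exact: measurableX. Qed.

Lemma plane_measure_square c (r : R) : 0 < r ->
  plane_measure (square c r) = (4 * r ^+ 2)%:E.
Proof.
move=> r0; rewrite /plane_measure product_measure1E//.
have E (a : R) : lebesgue_measure (`[a - r, a + r]%classic : set (measurableTypeR R)) = (2 * r)%:E.
  rewrite lebesgue_measure_itv /= lte_fin ifT; last by lra.
  by rewrite -EFinB; congr EFin; lra.
rewrite [X in (X * _)%E]E [X in (_ * X)%E]E -EFinM; congr EFin; ring.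
Qed.

(* In the row-major order of cells, an occupied cell follows another one at
   bounded distance, among a bounded number of candidates. *)
Definition offsets : seq nat := [:: 1; 2; n; N; N.+1].

Definition chained (s : seq (option (plane R))) : set (option (plane R)) :=
  [set c | if c is Some p then
    ((size s <= 1)%N /\ square (0, 0) (4 * N%:R) p) \/
    exists o, o \in offsets /\
      if nth None s (size s - o) is Some q then square q 10 p else False
   else True].

(** Five offsets with squares of area 4 * 10^2 and mass 1 for the hole give 2001. The first occupied
    cell has index 0 or 1 and is confined only by normalization, to a square of area 4 (4 N)^2. *)
Definition chain_volume (k : nat) : R := 2001 + (if (k <= 1)%N then 64 * N%:R ^+ 2 else 0).

Lemma chainedE s : Some @^-1` chained s =
  (if (size s <= 1)%N then square (0, 0) (4 * N%:R) else set0) `|`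
  \big[setU/set0]_(o <- offsets)
    (if nth None s (size s - o) is Some q then square q 10 else set0).
Proof.
rewrite -bigcup_seq; apply/seteqP; split=> p /=.
  move=> [[-> h]|[a [ai h]]]; first by left.
  by right; exists a => //; move: h; case: nth.
move=> [|[a ai h]]; first by case: ifP => // hs h; left.
by right; exists a; split=> //; move: h; case: nth.
Qed.

Lemma measurable_chained s : measurable (chained s).
Proof.
change (measurable (Some @^-1` chained s)); rewrite chainedE; apply: measurableU.
  by case: ifP => // _; exact: measurable_square.
apply: bigsetU_measurable => o _.
by case: nth => // q; exact: measurable_square.
Qed.

Lemma hole_measure_chained s : (H (chained s) <= (chain_volume (size s))%:E)%E.
Proof.
rewrite hole_measureE chainedE diracE mem_set//=.
rewrite /chain_volume.
have -> (X : R) : 2001 + X = X + 2000 + 1 by ring.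
rewrite EFinD; apply: leeD => //; rewrite EFinD.
set S0 := (if _ then square _ _ else _); set S1 := \big[_/_]_(_ <- _) _.
have m0 : measurable S0 by rewrite /S0; case: ifP => // _; exact: measurable_square.
have ms o : measurable (if nth None s (size s - o) is Some q then square q 10 else set0).
  by case: nth => // q; exact: measurable_square.
have m1 : measurable S1 by apply: bigsetU_measurable => o _.
apply: (@le_trans _ _ (@plane_measure R S0 + @plane_measure R S1)%E).
  by apply: measureU2.
apply: leeD.
  rewrite /S0; case: ifP => _; last by rewrite measure0.
  by rewrite plane_measure_square ?mulr_gt0// lee_fin exprMn; lra.
apply: (@le_trans _ _ (\sum_(o <- offsets) 400%:E)%E); last first.
  by rewrite /offsets !big_cons big_nil /= -!EFinD lee_fin; lra.
rewrite /S1; elim: offsets => [|o os IH]; first by rewrite !big_nil measure0.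
rewrite !big_cons; set U := \big[setU/set0]_(_ <- os) _.
have mU : measurable U by apply: bigsetU_measurable => a _.
apply: (@le_trans _ _ (@plane_measure R
  (if nth None s (size s - o) is Some q then square q 10 else set0) +
  @plane_measure R U)%E); first by apply: measureU2.
apply: leeD; last exact: IH.
case: nth => [q|]; last by rewrite measure0 lee_fin ler0n.
by rewrite plane_measure_square// lee_fin; lra.
Qed.

End partition_upper_bound.

Section chained_configurations.
Variables (R : realType) (n : nat) (l alpha : R).
Local Notation N := n.+1.
Local Notation space := ((N * N).-tuple (option (plane R))).
Hypothesis alpha1 : alpha <= 1.
Hypothesis l02 : 0 < l < 2.
Hypothesis N1 : (1 < N)%N.

Lemma normc_le_square (p q : plane R) r :
  normc ((p.1 +i* p.2)%C - (q.1 +i* q.2)%C) <= r -> square q r p.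
Proof.
move=> h; apply/squareP; have r0 := le_trans (normc_ge0 _) h.
move: h; rewrite -[_ <= r](ler_pXn2r (ltn0Sn 1)) ?nnegrE ?normc_ge0// normc_sqr /sqn /= => h.
by split; rewrite -(ler_pXn2r (ltn0Sn 1)) ?nnegrE// -normrX ger0_norm ?sqr_ge0//;
  apply: le_trans h; rewrite ?lerDl ?lerDr sqr_ge0.
Qed.

Lemma fundamental_square L (p : plane R) : fundamental_domain L (p.1 +i* p.2)%C ->
  square (0, 0) (2 * L) p.
Proof.
move=> /fundamental_domainP; have s0 := sin_pi3_gt0 R; have s2 := sin_pi3_sqr R.
rewrite /coord1 /coord2 /= => /andP[/andP[h1 h2] /andP[h3 h4]].
apply/squareP; rewrite /= !subr0 !ler_norml.
have s1 : sin (pi / 3) <= 1 :> R by rewrite -(ler_pXn2r (ltn0Sn 1)) ?nnegrE ?ltW// s2 expr1n; lra.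
set t := p.2 / _ in h1 h2 h3 h4; have E : p.2 = sin (pi / 3) * t.
  by rewrite /t mulrCA mulfV ?mulr1// gt_eqF.
have : 0 <= p.2 <= t by rewrite E; nra.
by split; lra.
Qed.

Section one_configuration.
Variable w : space.
Hypothesis Ew : @Omega R alpha l N w.

Let om : config R := extend l w.
Let omN : periodic l N om. Proof. exact: extend_periodic. Qed.
Let om1 : Omega1 alpha om. Proof. by case: Ew. Qed.
Let om2 : Omega2 om. Proof. by case: Ew. Qed.

Lemma cell_value (i j : nat) : (i < N)%N -> (j < N)%N ->
  om (i%:Z, j%:Z) = omap (fun p : plane R => (p.1 +i* p.2)%C) (nth None w (i * N + j)).
Proof. exact: extend_box. Qed.

Lemma cell_square (i j i' j' : nat) p : (i < N)%N -> (j < N)%N -> (i' < N)%N -> (j' < N)%N ->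
  nth None w (i * N + j) = Some p -> ~~ hole om (i'%:Z, j'%:Z) ->
  normc (fill om (i%:Z, j%:Z) - fill om (i'%:Z, j'%:Z)) <= 10 ->
  if nth None w (i' * N + j') is Some q then square q 10 p else False.
Proof.
move=> iN jN i'N j'N wp hq.
have hp : ~~ hole om (i%:Z, j%:Z) by rewrite /hole cell_value// wp.
rewrite !fill_pos//; move: hq; rewrite /hole /pos !cell_value// wp.
by case: (nth _ _ _) => //= q _; exact: normc_le_square.
Qed.

Lemma hole_value (i j : nat) : (i < N)%N -> (j < N)%N ->
  hole om (i%:Z, j%:Z) = (nth None w (i * N + j) == None).
Proof. by move=> iN jN; rewrite /hole cell_value//; case: (nth _ _ _). Qed.

(** The predecessor of (i, j) is (i, j - 1), or (i - 1, 0) if j = 0. If that site is a hole, another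
    of its neighbours takes over: (i, j - 2), or (i - 1, 1) if j = 0, or (i - 1, 0) if j = 1.
    Without such a candidate the cell is the first occupied one, and normalization confines it. *)
Lemma cell_chained k : (k < N * N)%N -> chained n (take k w) (nth None w k).
Proof.
move=> kN; rewrite /chained /=; case wp : (nth None w k) => [p|//].
have sk : size (take k w) = k by rewrite size_take size_tuple kN.
rewrite sk.
pose i := (k %/ N)%N; pose j := (k %% N)%N.
have iN : (i < N)%N by rewrite ltn_divLR.
have jN : (j < N)%N by rewrite ltn_mod.
have kE : k = (i * N + j)%N by exact: divn_eq.
move: (i) (j) iN jN kE => {}i {}j iN jN kE.
have hx : ~~ hole om (i%:Z, j%:Z) by rewrite hole_value// -kE wp.
have far (i' j' : nat) : (i' < N)%N -> (j' < N)%N ->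
    (k - (i' * N + j'))%N \in offsets n -> (i' * N + j' < k)%N ->
    ~~ hole om (i'%:Z, j'%:Z) ->
    normc (fill om (i%:Z, j%:Z) - fill om (i'%:Z, j'%:Z)) <= 10 ->
    exists o, o \in offsets n /\
      if nth None (take k w) (k - o) is Some q then square q 10 p else False.
  move=> i'N j'N ho lt hq hd; exists (k - (i' * N + j'))%N; split=> //.
  rewrite (subKn (ltnW lt)) (nth_take _ lt).
  by apply: (cell_square iN jN i'N j'N _ hq hd); rewrite -kE.
have start : first_site n om (i%:Z, j%:Z) -> square (0, 0) (4 * N%:R) p.
  move=> fs; have [/(normalizedP l fs) h _ _ _ _] := Ew.
  move: h; rewrite /pos cell_value// -kE wp /= => /fundamental_square.
  move=> /squareP h; apply/squareP; have : 0 <= N%:R :> R by [].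
  by move: h l02 => [h1 h2] /andP[l0 l2] N0; split; [apply: (le_trans h1)|apply: (le_trans h2)]; nra.
have nbr_step (z : A2) (i' j' : nat) : z \in nbrs -> (i%:Z, j%:Z) = ((i'%:Z, j'%:Z) : A2) + z ->
    normc (fill om (i%:Z, j%:Z) - fill om (i'%:Z, j'%:Z)) <= 10.
  by move=> hz ->; exact: (grad_fill_le alpha1 om1 om2).
have ring_far (h z z' : A2) (i' j' : nat) : hole om h -> z \in nbrs -> z' \in nbrs ->
    (i%:Z, j%:Z) = h + z -> (i'%:Z, j'%:Z) = h + z' ->
    ~~ hole om (i'%:Z, j'%:Z) /\ normc (fill om (i%:Z, j%:Z) - fill om (i'%:Z, j'%:Z)) <= 10.
  move=> hh hz hz' -> ->; rewrite (hole_nbr om2 hh hz'); split=> //.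
  exact: (ring_dist alpha1 om1 om2).
case: j => [|j] in jN kE hx far start nbr_step ring_far *.
  case: i => [|i] in iN kE hx far start nbr_step ring_far *.
    left; split; first by rewrite kE.
    apply: start; split; [by rewrite /in_box /=; lia|exact: hx|].
    by move=> [a b]; rewrite /in_box /lex_lt /=; lia.
  right; have [hh|hh] := boolP (hole om (i%:Z, 0%N%:Z)); last first.
    apply: (far i 0%N) => //; try lia.
      by rewrite kE !addn0 mulSn addnK !inE eqxx !orbT.
    by apply: (nbr_step (1, 0)) => //; congr pair => /=; lia.
  have [h1 h2] := ring_far _ (1, 0) (0, 1) i 1%N hh isT isT
    ltac:(by congr pair => /=; lia) ltac:(by congr pair => /=; lia).
  apply: (far i 1%N) => //; try lia.
  by rewrite kE (_ : _ - _ = n)%N ?inE ?eqxx ?orbT//; lia.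
have [hh|hh] := boolP (hole om (i%:Z, j%:Z)); last first.
  right; apply: (far i j) => //; try lia.
    by rewrite kE (_ : _ - _ = 1)%N ?inE ?eqxx//; lia.
  by apply: (nbr_step (0, 1)) => //; congr pair => /=; lia.
case: j => [|j] in jN kE hx far start nbr_step ring_far hh *; last first.
  right; have [h1 h2] := ring_far _ (0, 1) (0, -1) i j hh isT isT
    ltac:(by congr pair => /=; lia) ltac:(by congr pair => /=; lia).
  apply: (far i j) => //; try lia.
  by rewrite kE (_ : _ - _ = 2)%N ?inE ?eqxx ?orbT//; lia.
case: i => [|i] in iN kE hx far start nbr_step ring_far hh *.
  left; split; first by rewrite kE.
  apply: start; split; [by move: N1; rewrite /in_box /=; lia|exact: hx|].
  move=> [a b]; rewrite /in_box /lex_lt /= => h1 h2.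
  by have -> : (a, b) = (0%N%:Z, 0%N%:Z) by congr pair; lia.
right; have [h1 h2] := ring_far _ (0, 1) (-1, 0) i 0%N hh isT isT
  ltac:(by congr pair => /=; lia) ltac:(by congr pair => /=; lia).
apply: (far i 0%N) => //; try lia.
by rewrite kE (_ : _ - _ = N.+1)%N ?inE ?eqxx ?orbT//; lia.
Qed.

End one_configuration.

(** Here 2065 = 2001 + 64 bounds every factor apart from an N^2 in the first two; these contribute
    N^4 <= 4^(N^2), and 8260 = 4 * 2065. *)
Lemma prod_chain_volume :
  \prod_(k < N * N) chain_volume R n (0 + k) <= 8260 ^+ (N * N).
Proof.
pose M := (N * N)%N; have M2 : (1 < M)%N by rewrite /M; nia.
apply: (@le_trans _ _ (\prod_(k < M) (2065 * (if (k <= 1)%N then M%:R else 1)))).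
  apply: ler_prod => k _; rewrite /chain_volume add0n.
  have M1 : 1 <= M%:R :> R by rewrite (ler_nat _ 1) ltnW.
  have -> : N%:R ^+ 2 = M%:R :> R by rewrite expr2 -natrM.
  by case: ifP => _; apply/andP; split; lra.
rewrite big_split /= prodr_const card_ord -/M.
have -> : \prod_(k < M) (if (k <= 1)%N then M%:R else 1) = M%:R ^+ 2 :> R.
  have [M' E] : exists M', M = M'.+2 by exists M.-2; lia.
  move: (M%:R : R) => x; rewrite E !big_ord_recl /= big1; last by case.
  by rewrite mulr1 expr2.
have M2M : M%:R <= 2 ^+ M :> R by rewrite -natrX ler_nat; exact/ltnW/ltn_expl.
have E : 8260 = 2065 * 2 ^+ 2 :> R by ring.
have C0 : 0 < 2065 :> R by rewrite ltr0n.
rewrite E; move: (2065 : R) C0 => C C0.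
rewrite exprMn (ler_pM2l (exprn_gt0 _ C0)) -exprM mulnC exprM.
by rewrite lerXn2r ?nnegrE ?exprn_ge0.
Qed.

Lemma Omega_volume (A : set space) : A `<=` @Omega R alpha l N ->
  (power_measure (hole_measure (@plane_measure R)) (N * N) A <= (8260 ^+ (N * N))%:E)%E.
Proof.
move=> AE; apply: (@le_trans _ _ (\prod_(k < N * N) chain_volume R n (0 + k))%:E%E).
  apply: (@sequential_volume _ _ _ _ (@chained R n) (@chain_volume R n) _ _ _ (N * N) [::]).
  - exact: measurable_chained.
  - move=> k; rewrite /chain_volume addr_ge0 ?ler0n//.
    by case: ifP => _; rewrite ?mulr_ge0 ?ler0n ?sqr_ge0.
  - exact: hole_measure_chained.
  move=> w /AE Ew; apply: (all_okP (x0 := None)) => k; rewrite size_tuple cat0s.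
  exact: cell_chained.
by rewrite lee_fin; exact: prod_chain_volume.
Qed.

End chained_configurations.

(** * Piecewise affine interpolation and bijectivity for a perturbed lattice *)

Section interpolation.
Variables (R : realType) (eta : A2 -> R) (r : R).
Hypothesis eta_r : forall x, `|eta x| <= r.

(* Interpolation in the unit cell at [(i, j)] of the basis [1, tau^2], cut by its
   diagonal into two triangles. *)
Definition cell_interp (i j : int) (s t : R) : R :=
  if t <= s then
    eta (i, j) + s * (eta (i + 1, j) - eta (i, j)) + t * (eta (i + 1, j + 1) - eta (i + 1, j))
  else
    eta (i, j) + t * (eta (i, j + 1) - eta (i, j)) + s * (eta (i + 1, j + 1) - eta (i, j + 1)).

Definition interp (a b : R) : R :=
  let i := Num.floor a in let j := Num.floor b in
  cell_interp i j (a - i%:~R) (b - j%:~R).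

Lemma cell_interp_right i j t : 0 <= t <= 1 ->
  cell_interp i j 1 t = cell_interp (i + 1) j 0 t.
Proof.
move=> /andP[t0 t1]; rewrite /cell_interp t1; case: ifP => [t0'|_]; last by ring.
have -> : t = 0 by lra.
by ring.
Qed.

Lemma cell_interp_top i j s : 0 <= s <= 1 ->
  cell_interp i j s 1 = cell_interp i (j + 1) s 0.
Proof.
move=> /andP[s0 s1]; rewrite /cell_interp s0; case: ifP => [s1'|_]; last by ring.
have -> : s = 1 by lra.
by ring.
Qed.

(** The floor selects half-open cells; the formula extends to closed ones because the formulas of
    adjacent cells agree on the common side. *)
Lemma interp_cell i j s t : 0 <= s <= 1 -> 0 <= t <= 1 ->
  interp (i%:~R + s) (j%:~R + t) = cell_interp i j s t.
Proof.
have H i' j' s' t' : 0 <= s' < 1 -> 0 <= t' < 1 ->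
    interp (i'%:~R + s') (j'%:~R + t') = cell_interp i' j' s' t'.
  move=> hs ht; rewrite /interp.
  have F (k : int) (u : R) : 0 <= u < 1 -> Num.floor (k%:~R + u) = k.
    by move=> hu; apply/floor_def; rewrite intrD; lra.
  by rewrite !F// ![_ + _ - _]addrAC !subrr !add0r.
have B (u : R) : 0 <= u <= 1 -> (0 <= u < 1) \/ u = 1.
  by move=> /andP[u0]; rewrite le_eqVlt => /orP[/eqP|u1]; [right|left; apply/andP].
have ivD (k : int) : k%:~R + 1 = (k + 1)%:~R + 0 :> R by rewrite intrD addr0.
move=> hs ht; have [hs'|->] := B _ hs; have [ht'|->] := B _ ht.
- exact: H.
- by rewrite ivD H ?cell_interp_top// lexx ltr01.
- by rewrite ivD H ?cell_interp_right// lexx ltr01.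
rewrite !ivD H ?lexx ?ltr01// cell_interp_right ?ler01 ?lexx//.
by rewrite cell_interp_top ?ler01 ?lexx.
Qed.

Lemma eta_diff x y : `|eta x - eta y| <= 2 * r.
Proof.
have h := eta_r x; have h' := eta_r y.
by rewrite (le_trans (ler_normB _ _))//; lra.
Qed.

Lemma cell_interp_lip1 i j s s' t :
  `|cell_interp i j s t - cell_interp i j s' t| <= 2 * r * `|s - s'|.
Proof.
wlog ss' : s s' / s' <= s.
  move=> W; have [|/ltW] := leP s' s; first exact: W.
  by move=> /W; rewrite distrC [`|s' - s|]distrC.
have d1 := eta_diff (i + 1, j) (i, j); have d2 := eta_diff (i + 1, j + 1) (i, j + 1).
have key (u v A B : R) : 0 <= u -> 0 <= v -> `|A| <= 2 * r -> `|B| <= 2 * r ->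
    s - s' = u + v -> `|u * A + v * B| <= 2 * r * (s - s').
  move=> u0 v0 hA hB ->; apply: (le_trans (ler_normD _ _)).
  rewrite !normrM (ger0_norm u0) (ger0_norm v0) mulrDr.
  by rewrite lerD// mulrC ler_wpM2r.
rewrite (@ger0_norm _ (s - s')) ?subr_ge0//.
rewrite /cell_interp; case: (leP t s) => h; case: (leP t s') => h'.
- rewrite (_ : _ - _ = (s - s') * (eta (i + 1, j) - eta (i, j)) + 0 * 0); last by ring.
  by apply: key => //; rewrite ?subr_ge0// ?normr0 ?addr0//; have := le_trans (normr_ge0 _) d1.
(* The segment crosses the diagonal and is split there, at first coordinate t. *)
- rewrite (_ : _ - _ = (s - t) * (eta (i + 1, j) - eta (i, j)) +
    (t - s') * (eta (i + 1, j + 1) - eta (i, j + 1))); last by ring.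
  by apply: key => //; lra.
- lra.
- rewrite (_ : _ - _ = (s - s') * (eta (i + 1, j + 1) - eta (i, j + 1)) + 0 * 0); last by ring.
  by apply: key => //; rewrite ?subr_ge0// ?normr0 ?addr0//; have := le_trans (normr_ge0 _) d1.
Qed.

End interpolation.

Lemma cell_interp_swap (R : realType) (eta : A2 -> R) i j s t :
  cell_interp eta i j s t = cell_interp (fun x => eta (x.2, x.1)) j i t s.
Proof.
rewrite /cell_interp /=; case: ltgtP => //= h.
by rewrite h; ring.
Qed.

Lemma interp_swap (R : realType) (eta : A2 -> R) a b :
  interp eta a b = interp (fun x => eta (x.2, x.1)) b a.
Proof. exact: cell_interp_swap. Qed.

Section lipschitz_interpolation.
Variables (R : realType).

Lemma floor_split (a : R) : exists (i : int) (s : R), a = i%:~R + s /\ 0 <= s < 1.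
Proof.
exists (Num.floor a), (a - (Num.floor a)%:~R); split; first by rewrite addrC subrK.
by have h1 := floor_le a; have := floorD1_gt a; rewrite intrD; lra.
Qed.

Lemma interp_bound (eta : A2 -> R) r a b : (forall x, `|eta x| <= r) ->
  `|interp eta a b| <= 5 * r.
Proof.
move=> hr; rewrite /interp.
have [i [s [-> hs]]] := floor_split a; have [j [t [-> ht]]] := floor_split b.
have F (k : int) (u : R) : 0 <= u < 1 -> Num.floor (k%:~R + u) = k.
  by move=> hu; apply/floor_def; rewrite intrD; lra.
rewrite !F// ![_ + _ - _]addrAC !subrr !add0r /cell_interp.
have key (A B C u v : R) : `|A| <= r -> `|B| <= 2 * r -> `|C| <= 2 * r ->
    0 <= u < 1 -> 0 <= v < 1 -> `|A + u * B + v * C| <= 5 * r.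
  move=> hA hB hC /andP[u0 u1] /andP[v0 v1].
  have mul (x y : R) : `|y| <= 2 * r -> 0 <= x -> x < 1 -> `|x * y| <= 2 * r.
    move=> hy x0 x1; rewrite normrM (ger0_norm x0).
    by apply: le_trans hy; rewrite ler_piMl// ltW.
  have := mul _ _ hB u0 u1; have := mul _ _ hC v0 v1 => h1 h2.
  by have := ler_normD (A + u * B) (v * C); have := ler_normD A (u * B); lra.
by case: (leP t s) => _; apply: key => //; exact: eta_diff.
Qed.

(** For |a - a'| >= 1 the bound 5 r on each value suffices, which is the origin of 10. Closer points
    lie in the same or in adjacent cells, where the slope is at most 2 r. *)
Lemma interp_lip1 (eta : A2 -> R) r a a' b : (forall x, `|eta x| <= r) ->
  `|interp eta a b - interp eta a' b| <= 10 * r * `|a - a'|.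
Proof.
move=> hr; have r0 : 0 <= r := le_trans (normr_ge0 _) (hr 0).
wlog aa' : a a' / a' <= a.
  move=> W; have [|/ltW] := leP a' a; first exact: W.
  by move=> /W; rewrite distrC [`|a' - a|]distrC.
rewrite [`|a - a'|]ger0_norm ?subr_ge0//.
have [far|near] := leP 1 (a - a').
  have h1 := interp_bound a b hr; have h2 := interp_bound a' b hr.
  apply: (le_trans (ler_normB _ _)); apply: (@le_trans _ _ (10 * r * 1)); first by lra.
  by rewrite ler_wpM2l// mulr_ge0.
have [i [s [aE hs]]] := floor_split a; have [i' [s' [aE' hs']]] := floor_split a'.
have [j [t [bE ht]]] := floor_split b.
have ht1 : 0 <= t <= 1 by lra.
have ii' : i = i' \/ i = i' + 1.
  have h1 : (i'%:~R : R) < (i + 1)%:~R by rewrite intrD; lra.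
  have h2 : (i%:~R : R) < (i' + 2)%:~R by rewrite intrD; lra.
  by move: h1 h2; rewrite !ltr_int; lia.
have K d : 0 <= d -> 2 * r * d <= 10 * r * d.
  by move=> d0; rewrite ler_wpM2r//; lra.
rewrite aE aE' bE; case: ii' => ii'; subst i.
  rewrite !interp_cell//; try lra.
  apply: (le_trans (cell_interp_lip1 hr _ _ _ _ _)).
  rewrite ger0_norm; last by lra.
  apply: (le_trans (K _ _)); first by lra.
  by rewrite ler_wpM2l ?mulr_ge0//; lra.
rewrite !interp_cell//; try lra.
rewrite -(subrK (cell_interp eta (i' + 1) j 0 t) (cell_interp eta (i' + 1) j s t)) -addrA.
apply: (le_trans (ler_normD _ _)).
rewrite -[X in _ + `|X - _|]cell_interp_right//.
have h1 := cell_interp_lip1 hr (i' + 1) j s 0 t.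
have h2 := cell_interp_lip1 hr i' j 1 s' t.
apply: (le_trans (lerD h1 h2)); rewrite subr0 !ger0_norm; try lra.
rewrite -mulrDr; apply: (le_trans (K _ _)); first by lra.
by rewrite ler_wpM2l ?mulr_ge0// intrD; lra.
Qed.

Lemma interp_lip (eta : A2 -> R) r a a' b b' : (forall x, `|eta x| <= r) ->
  `|interp eta a b - interp eta a' b'| <= 10 * r * (`|a - a'| + `|b - b'|).
Proof.
move=> hr; rewrite -(subrK (interp eta a' b) (interp eta a b)) -addrA.
apply: (le_trans (ler_normD _ _)); rewrite mulrDr lerD//; first exact: interp_lip1.
by rewrite !(interp_swap eta a'); apply: interp_lip1.
Qed.

End lipschitz_interpolation.

Section perturbed_lattice.
Variable R : realType.

Lemma contraction_fixpoint (f : R -> R) :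
  (forall x y, `|f x - f y| <= 2^-1 * `|x - y|) -> exists p, p = f p.
Proof.
move=> hf; pose f' : {fun [set: R] >-> [set: R]} := [fun of totalfun f].
have cf : is_contraction f'.
  exists (2^-1)%:nng; split; first by rewrite /=; lra.
  by move=> [x y] _; exact: hf.
have [|p _ pE] := @banach_fixed_point R R [set: R] f' cf closedT; first by exists 0.
by exists p.
Qed.

(** The solution is a fixed point of a |-> (u - J a) / l, a contraction because l > 1/2. *)
Lemma perturbed_solve (J : R -> R) l u : 2^-1 < l ->
  (forall x y, `|J x - J y| <= 4^-1 * `|x - y|) -> exists a, l * a + J a = u.
Proof.
move=> l2 hJ; have l0 : 0 < l by apply: lt_trans l2; rewrite invr_gt0.
have [x y|a aE] := @contraction_fixpoint (fun a => (u - J a) / l).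
  rewrite -mulrBl normrM normfV (gtr0_norm l0) ler_pdivrMr//.
  rewrite (_ : _ - _ = J y - J x); last by ring.
  rewrite distrC; apply: (le_trans (hJ _ _)); have := normr_ge0 (x - y); nra.
by exists a; rewrite {1}aE mulrCA mulfV ?gt_eqF// mulr1 subrK.
Qed.

Variables (l r : R) (xi1 xi2 : A2 -> R).
Hypothesis l2 : 2^-1 < l.
Hypothesis r_small : 100 * r <= 1.
Hypothesis xi1_r : forall x, `|xi1 x| <= r.
Hypothesis xi2_r : forall x, `|xi2 x| <= r.

Let lip (xi : A2 -> R) a a' b b' : (forall x, `|xi x| <= r) ->
  `|interp xi a b - interp xi a' b'| <= 10^-1 * (`|a - a'| + `|b - b'|).
Proof.
move=> h; apply: (le_trans (interp_lip _ _ _ _ h)).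
by rewrite ler_wpM2r ?addr_ge0//; move: r_small; lra.
Qed.

(** The two equations are solved one inside the other. The first gives a = A b, with Lipschitz
    constant (1/10) / (1/2 - 1/10) = 1/4; the perturbation in the second then has constant at most
    (1/10)(1/4 + 1) < 1/4. *)
Lemma perturbed_surjective (u v : R) : exists a b : R,
  l * a + interp xi1 a b = u /\ l * b + interp xi2 a b = v.
Proof.
have ex1 b : exists a, l * a + interp xi1 a b = u.
  apply: perturbed_solve l2 _ => x y.
  by have := lip x y b b xi1_r; rewrite subrr normr0 addr0; have := normr_ge0 (x - y); lra.
pose A b := projT1 (cid (ex1 b)).
have AE b : l * A b + interp xi1 (A b) b = u := projT2 (cid (ex1 b)).
have lipA b b' : `|A b - A b'| <= 4^-1 * `|b - b'|.
  have h := lip (A b) (A b') b b' xi1_r.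
  have E : l * (A b - A b') = - (interp xi1 (A b) b - interp xi1 (A b') b').
    by have := AE b; have := AE b'; lra.
  have l0 : 0 < l by apply: lt_trans l2; rewrite invr_gt0.
  have : l * `|A b - A b'| <= 10^-1 * (`|A b - A b'| + `|b - b'|).
    by rewrite -{1}(gtr0_norm l0) -normrM E normrN.
  by move: l2; have := normr_ge0 (A b - A b'); nra.
have [b bE] : exists b, l * b + interp xi2 (A b) b = v.
  apply: (perturbed_solve (J := fun b => interp xi2 (A b) b)) l2 _ => x y.
  by have := lip (A x) (A y) x y xi2_r; have := lipA x y; have := normr_ge0 (x - y); lra.
by exists (A b), b; split.
Qed.

Lemma perturbed_injective (a b a' b' : R) :
  l * a + interp xi1 a b = l * a' + interp xi1 a' b' ->
  l * b + interp xi2 a b = l * b' + interp xi2 a' b' -> a = a' /\ b = b'.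
Proof.
move=> h1 h2; have l0 : 0 < l by apply: lt_trans l2; rewrite invr_gt0.
have d1 := lip a a' b b' xi1_r; have d2 := lip a a' b b' xi2_r.
have E1 : l * (a - a') = - (interp xi1 a b - interp xi1 a' b') by move: h1; lra.
have E2 : l * (b - b') = - (interp xi2 a b - interp xi2 a' b') by move: h2; lra.
have e1 : l * `|a - a'| <= 10^-1 * (`|a - a'| + `|b - b'|).
  by rewrite -{1}(gtr0_norm l0) -normrM E1 normrN.
have e2 : l * `|b - b'| <= 10^-1 * (`|a - a'| + `|b - b'|).
  by rewrite -{1}(gtr0_norm l0) -normrM E2 normrN.
have n1 := normr_ge0 (a - a'); have n2 := normr_ge0 (b - b').
have z : `|a - a'| + `|b - b'| <= 0 by move: l2; nra.
by split; apply/eqP; rewrite -subr_eq0 -normr_eq0; apply/eqP; lra.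
Qed.

(* The bijection is found in the coordinates of the basis [1, tau^2]. *)
Lemma Omega3_perturbed (om : config R) (c1 c2 : R) :
  (forall x, om x = Some ((l * x.1%:~R + c1 + xi1 x)%:C%C +
                          tau R ^+ 2 * (l * x.2%:~R + c2 + xi2 x)%:C%C)) ->
  Omega3 om.
Proof.
move=> omE.
pose F (p : R[i]) : R[i] :=
  (l * coord1 p + c1 + interp xi1 (coord1 p) (coord2 p))%:C%C +
  tau R ^+ 2 * (l * coord2 p + c2 + interp xi2 (coord1 p) (coord2 p))%:C%C.
have surj y : exists p, F p = y.
  have [a [b [ha hb]]] := perturbed_surjective (coord1 y - c1) (coord2 y - c2).
  exists (a%:C%C + tau R ^+ 2 * b%:C%C); rewrite /F; have [-> ->] := coord_unique a b.
  rewrite [in RHS](coordK y); congr (_%:C%C + _ * _%:C%C); [move: ha|move: hb]; lra.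
have inj p q : F p = F q -> p = q.
  move=> h; rewrite (coordK p) (coordK q).
  have := congr1 (@coord1 R) h; have := congr1 (@coord2 R) h; rewrite /F.
  move: (coord1 p) (coord2 p) (coord1 q) (coord2 q) => a b a' b'.
  rewrite !(coord_unique _ _).1 !(coord_unique _ _).2 => h2 h1.
  have E1 : l * a + interp xi1 a b = l * a' + interp xi1 a' b' by move: h1; lra.
  have E2 : l * b + interp xi2 a b = l * b' + interp xi2 a' b' by move: h2; lra.
  by have [-> ->] := perturbed_injective E1 E2.
exists F; last first.
  exists (fun y => projT1 (cid (surj y))) => p.
    by apply: inj; exact: projT2 (cid (surj (F p))).
  exact: projT2 (cid (surj p)).
have hatE x : hat om x = (l * x.1%:~R + c1 + xi1 x)%:C%C +
    tau R ^+ 2 * (l * x.2%:~R + c2 + xi2 x)%:C%C by rewrite /hat omE.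
have embC (x : A2) : emb R x = (x.1%:~R)%:C%C + tau R ^+ 2 * (x.2%:~R)%:C%C.
  by rewrite /emb !rmorph_int.
have coord1_emb (x : A2) : coord1 (emb R x) = x.1%:~R by rewrite embC (coord_unique _ _).1.
have coord2_emb (x : A2) : coord2 (emb R x) = x.2%:~R by rewrite embC (coord_unique _ _).2.
have cellE (xi : A2 -> R) (i j : int) (s t : R) : s <= t ->
    cell_interp xi i j s t = xi (i, j) + t * (xi (i, j + 1) - xi (i, j)) +
      s * (xi (i + 1, j + 1) - xi (i, j + 1)).
  rewrite /cell_interp; case: (leP t s) => // ts st.
  have -> : s = t by lra.
  by ring.
move=> [i j] z hz s t s0 t0 st; rewrite !hatE /F !coord1D !coord2D coord1_emb coord2_emb.
set u1 : R := l * _ + c1 + xi1 (i, j); set u2 : R := l * _ + c2 + xi2 (i, j).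
set v1 : R := l * _ + c1 + xi1 (_ + z); set v2 : R := l * _ + c2 + xi2 (_ + z).
set w1 : R := l * _ + c1 + xi1 (_ + rot z); set w2 : R := l * _ + c2 + xi2 (_ + rot z).
have -> : u1%:C%C + tau R ^+ 2 * u2%:C%C +
    s%:C%C * (v1%:C%C + tau R ^+ 2 * v2%:C%C - (u1%:C%C + tau R ^+ 2 * u2%:C%C)) +
    t%:C%C * (w1%:C%C + tau R ^+ 2 * w2%:C%C - (u1%:C%C + tau R ^+ 2 * u2%:C%C)) =
    (u1 + s * (v1 - u1) + t * (w1 - u1))%:C%C +
    tau R ^+ 2 * (u2 + s * (v2 - u2) + t * (w2 - u2))%:C%C.
  move: u1 u2 v1 v2 w1 w2 (tau R ^+ 2) => u1 u2 v1 v2 w1 w2 T.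
  by rewrite !(rmorphD, rmorphM, rmorphB) /=; ring.
have E1 : ((i, j) : A2) + unit1 = (i + 1, j) by congr pair => /=; lia.
have E2 : ((i, j) : A2) + rot unit1 = (i + 1, j + 1) by congr pair => /=; lia.
have E3 : ((i, j) : A2) + rot (rot unit1) = (i, j + 1) by congr pair => /=; lia.
(* For z = 1 the triangle is the half of the cell with second coordinate at most the first; for z =
   tau it is the other half. *)
move: hz; rewrite !inE => /orP[] /eqP zE; rewrite /u1 /u2 /v1 /v2 /w1 /w2 zE ?E3 ?E2 ?E1 /=.
  rewrite (_ : i%:~R + s * 1 + t * (1 - 0)%:~R = i%:~R + (s + t)); last by rewrite subr0; ring.
  rewrite (_ : j%:~R + s * 0 + t * 1 = j%:~R + t); last by ring.
  rewrite !interp_cell; try by apply/andP; split; lra.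
  rewrite /cell_interp lerDr s0 !intrD.
  by congr (_%:C%C + _ * _%:C%C); ring.
rewrite (_ : i%:~R + s * (1 - 0)%:~R + t * (1 - 0 - 1)%:~R = i%:~R + s); last first.
  by rewrite !subr0 subrr; ring.
rewrite (_ : j%:~R + s * 1 + t * (1 - 0)%:~R = j%:~R + (s + t)); last by rewrite subr0; ring.
rewrite !interp_cell; try by apply/andP; split; lra.
rewrite !cellE ?lerDl// !intrD.
by congr (_%:C%C + _ * _%:C%C); ring.
Qed.

End perturbed_lattice.

Lemma sin_pi3_bounds (R : realType) : 4 / 5 <= sin (pi / 3) :> R /\ sin (pi / 3) <= 1 :> R.
Proof.
have s0 := sin_pi3_gt0 R; have s2 := sin_pi3_sqr R.
by split; rewrite -(ler_pXn2r (ltn0Sn 1)) ?nnegrE ?(ltW s0)// s2; lra.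
Qed.

(** * Small perturbations of the perfect lattice are allowed *)

Section perturbed_box.
Variables (R : realType) (n : nat) (l alpha rho : R).
Local Notation N := n.+1.
Local Notation space := ((N * N).-tuple (option (plane R))).
Local Notation bp := (@box_point N).
Hypothesis alpha2 : alpha <= 2^-1.
Hypothesis l_alpha : 1 - alpha / 2 < l < 1 + alpha / 2.
Hypothesis rho0 : 0 < rho.
Hypothesis rho_alpha : 8 * rho <= alpha.
Hypothesis rho_small : 200 * rho <= 1.

(** The offset (l/2)(1 + tau^2) keeps the site 0 away from the boundary of the fundamental domain,
    so that small perturbations stay normalized. *)
Definition center (x : A2) : R[i] :=
  (l / 2)%:C%C + tau R ^+ 2 * (l / 2)%:C%C + l%:C%C * emb R x.

Definition perturbed_box : set space :=
  box (fun k => Some @` square (complex.Re (center (bp (unidx k))), complex.Im (center (bp (unidx k)))) rho).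

Let l0 : 3 / 4 < l < 5 / 4. Proof. by move: l_alpha alpha2; lra. Qed.

Lemma measurable_Some_square c (r : R) : measurable (Some @` square c r : set (option (plane R))).
Proof.
change (measurable (Some @^-1` (Some @` square c r))).
rewrite (_ : _ @^-1` _ = square c r); first exact: measurable_square.
by apply/seteqP; split=> [p [q h [<-]]|p h] //; exists p.
Qed.

Lemma measurable_perturbed_box : measurable perturbed_box.
Proof. by apply: measurable_box => k; exact: measurable_Some_square. Qed.

Lemma hole_measure_square c (r : R) : 0 < r ->
  hole_measure (@plane_measure R) (Some @` square c r) = (4 * r ^+ 2)%:E.
Proof.
move=> r0; rewrite hole_measureE diracE memNset ?adde0; last by case.
rewrite (_ : _ @^-1` _ = square c r); first exact: plane_measure_square.
by apply/seteqP; split=> [p [q h [<-]]|p h] //; exists p.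
Qed.

Lemma perturbed_box_volume :
  power_measure (hole_measure (@plane_measure R)) (N * N) perturbed_box =
  ((4 * rho ^+ 2) ^+ (N * N))%:E%E.
Proof.
rewrite /perturbed_box (power_measure_box _ (fun k => measurable_Some_square _ _)).
rewrite (eq_bigr (fun=> (4 * rho ^+ 2)%:E)); last first.
  by move=> k _; exact: hole_measure_square.
by rewrite prodEFin prodr_const card_ord.
Qed.

Section one_configuration.
Variable w : space.
Hypothesis Bw : perturbed_box w.

Let om : config R := extend l w.

Lemma perturbed_value x : exists2 d : R[i], om x = Some (center x + d) &
  `|complex.Re d| <= rho /\ `|complex.Im d| <= rho.
Proof.
rewrite /om extend_cell /cell; have [p /squareP [h1 h2] <-] := Bw (idx (wrap n x)).
rewrite idxK in h1 h2 *; move: h1 h2; set b := bp _ => h1 h2.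
exists ((p.1 +i* p.2)%C - center b).
  rewrite /= {2}(wrap_quo n x) -/b; congr Some.
  rewrite /center embD emb_mulrn rmorphM /= rmorph_nat; ring.
by move: h1 h2; case: (center b).
Qed.

Let dev x : R[i] := pos om x - center x.

Let devE x : om x = Some (center x + dev x).
Proof.
have [d omx _] := perturbed_value x; rewrite /dev /pos omx; congr Some => /=; ring.
Qed.

Let dev_small x : `|complex.Re (dev x)| <= rho /\ `|complex.Im (dev x)| <= rho.
Proof. by have [d omx] := perturbed_value x; rewrite /dev /pos omx /= addrC addKr. Qed.

Let posE x : pos om x = center x + dev x. Proof. by rewrite /pos devE. Qed.

Let occupied x : hole om x = false. Proof. by rewrite /hole devE. Qed.

Let hatE x : hat om x = pos om x. Proof. by rewrite /hat /pos devE. Qed.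

Lemma perturbed_grad x z : exists2 d : R[i],
  pos om (x + z) - pos om x = l%:C%C * emb R z + d &
  `|complex.Re d| <= 2 * rho /\ `|complex.Im d| <= 2 * rho.
Proof.
exists (dev (x + z) - dev x).
  by rewrite !posE /center embD; ring.
have [a1 a2] := dev_small (x + z); have [b1 b2] := dev_small x.
move: (dev (x + z)) (dev x) a1 a2 b1 b2 => [a b] [c e] /= a1 a2 b1 b2.
by split; rewrite (le_trans (ler_normB _ _))//; lra.
Qed.

Lemma normc_le_ReIm (d : R[i]) r : `|complex.Re d| <= r -> `|complex.Im d| <= r ->
  normc d <= 2 * r.
Proof.
move=> h1 h2; have r0 := le_trans (normr_ge0 _) h1.
rewrite -(ler_pXn2r (ltn0Sn 1)) ?nnegrE ?normc_ge0 ?mulr_ge0// normc_sqr /sqn.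
rewrite -[complex.Re d ^+ 2]ger0_norm ?sqr_ge0// normrX -[complex.Im d ^+ 2]ger0_norm ?sqr_ge0// normrX.
have : `|complex.Re d| ^+ 2 <= r ^+ 2 by rewrite ler_pXn2r ?nnegrE.
have : `|complex.Im d| ^+ 2 <= r ^+ 2 by rewrite ler_pXn2r ?nnegrE.
by have := sqr_ge0 r; lra.
Qed.

(** The coordinates of the increment change by at most 2 rho, its modulus by at most twice that; 8
    rho <= alpha later keeps the bonds within [Omega1]. *)
Lemma perturbed_length x z : z \in nbrs ->
  l - 4 * rho <= normc (pos om (x + z) - pos om x) <= l + 4 * rho.
Proof.
move=> hz; have [d -> [d1 d2]] := perturbed_grad x z.
have nd := normc_le_ReIm d1 d2.
have e1 : normc (emb R z) = 1.
  by apply/eqP; rewrite -(@eqrXn2 _ 2) ?normc_ge0 ?ler01// normc_sqr sqn_emb// expr1n.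
have l00 : 0 <= l by move: l0; lra.
have nl : normc (l%:C%C * emb R z) = l.
  by rewrite normcM e1 mulr1 /normc /= expr0n addr0 sqrtr_sqr ger0_norm.
have h1 := le_normcD (l%:C%C * emb R z) d.
have h2 := le_normcD (l%:C%C * emb R z + d) (- d).
by rewrite addrK normcN nl in h2; rewrite nl in h1; apply/andP; split; lra.
Qed.

Lemma Im_div_gt0 (d e : R[i]) : 0 < area2 d e -> 0 < complex.Im (e / d).
Proof.
case: d e => a b [c f]; rewrite /area2 /= => h.
have n0 : 0 < a ^+ 2 + b ^+ 2.
  rewrite lt_neqAle eq_sym addr_ge0 ?sqr_ge0// andbT paddr_eq0 ?sqr_ge0//.
  apply/negP => /andP[]; rewrite !expf_eq0 /= => /eqP a0 /eqP b0.
  by move: h; rewrite a0 b0 !mul0r subrr ltxx.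
have -> : c * - (b / (a ^+ 2 + b ^+ 2)) + f * (a / (a ^+ 2 + b ^+ 2)) =
    (a * f - b * c) / (a ^+ 2 + b ^+ 2).
  by move: (_^-1) => v; ring.
by rewrite divr_gt0.
Qed.

(** The unperturbed determinant l^2 sin(pi/3) is at least 9/16 * 4/5, while the perturbation changes
    it by at most 5/4 * 12 rho + 8 rho^2. *)
Lemma perturbed_orientation x z : z \in nbrs ->
  0 < area2 (pos om (x + z) - pos om x) (pos om (x + rot z) - pos om x).
Proof.
move=> hz; have [d -> [d1 d2]] := perturbed_grad x z.
have [d' -> [d1' d2']] := perturbed_grad x (rot z).
have := sqn_emb R hz; rewrite emb_rot.
have s0 := sin_pi3_gt0 R; have s2 := sin_pi3_sqr R; have c2 := cos_pi3 R.
have [s45 s1] := sin_pi3_bounds R.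
rewrite /tau c2; move: (emb R z) d d' d1 d2 d1' d2' => [p q] [a b] [c e] /=.
rewrite /area2 /sqn /=; set s := sin _ in s0 s2 s45 s1 * => a1 b1 c1 e1 pq.
have [p1 q1] : `|p| <= 1 /\ `|q| <= 1.
  by split; rewrite -(ler_pXn2r (ltn0Sn 1)) ?nnegrE// -normrX ger0_norm ?sqr_ge0//
    expr1n -pq ?lerDl ?lerDr sqr_ge0.
have mul (u v X Y : R) : `|u| <= X -> `|v| <= Y -> `|u * v| <= X * Y.
  by move=> hx hy; rewrite normrM ler_pM.
have M (u v X Y : R) : `|u| <= X -> `|v| <= Y -> - (X * Y) <= u * v <= X * Y.
  by move=> hx hy; rewrite -ler_norml mul.
have l00 : `|l| <= 5 / 4 by rewrite ger0_norm; move: l0; lra.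
set p' := 1 / 2 * p - s * q; set q' := 1 / 2 * q + s * p.
have p'1 : `|p'| <= 1 * 1 + 1 * 1.
  rewrite (le_trans (ler_normB _ _))// lerD//; apply: mul => //.
    by rewrite ger0_norm; lra.
  by rewrite ger0_norm; lra.
have q'1 : `|q'| <= 1 * 1 + 1 * 1.
  rewrite (le_trans (ler_normD _ _))// lerD//; apply: mul => //.
    by rewrite ger0_norm; lra.
  by rewrite ger0_norm; lra.
rewrite !mul0r !subr0 !addr0.
have -> : (l * p + a) * (l * q' + e) - (l * q + b) * (l * p' + c) =
    l ^+ 2 * s * (p ^+ 2 + q ^+ 2) +
    (l * (p * e + a * q' - q * c - b * p') + (a * e - b * c)) by rewrite /p' /q'; field.
rewrite pq mulr1.
have h1 := M _ _ _ _ p1 e1; have h2 := M _ _ _ _ a1 q'1.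
have h3 := M _ _ _ _ q1 c1; have h4 := M _ _ _ _ b1 p'1.
have h5 := M _ _ _ _ a1 e1; have h6 := M _ _ _ _ b1 c1.
have h7 : `|p * e + a * q' - q * c - b * p'| <= 12 * rho.
  by rewrite ler_norml; apply/andP; split; lra.
have h8 := M _ _ _ _ l00 h7.
have l916 : 9 / 16 <= l ^+ 2 by move: l0; nra.
have : 9 / 16 * (4 / 5) <= l ^+ 2 * s by apply: ler_pM => //; lra.
have r2 : rho * rho <= rho / 200 by rewrite ler_pM2l//; move: rho_small; lra.
by move: rho_small rho0; lra.
Qed.

Lemma coord_small (d : R[i]) r : `|complex.Re d| <= r -> `|complex.Im d| <= r ->
  `|coord1 d| <= 2 * r /\ `|coord2 d| <= 2 * r.
Proof.
move=> h1 h2; have r0 := le_trans (normr_ge0 _) h1.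
have s0 := sin_pi3_gt0 R; have s2 := sin_pi3_sqr R.
have [s45 _] := sin_pi3_bounds R.
have c2 : `|coord2 d| <= 5 / 4 * r.
  rewrite /coord2 normrM normfV (gtr0_norm s0) ler_pdivrMr//.
  apply: (le_trans h2); have : r * (4 / 5) <= r * sin (pi / 3) by rewrite ler_wpM2l.
  by lra.
split; last by lra.
rewrite /coord1 (le_trans (ler_normD _ _))// normrM [`|2^-1|]ger0_norm; lra.
Qed.

Lemma perturbed_coords x : om x = Some ((l * x.1%:~R + l / 2 + coord1 (dev x))%:C%C +
  tau R ^+ 2 * (l * x.2%:~R + l / 2 + coord2 (dev x))%:C%C).
Proof.
rewrite devE {1}(coordK (dev x)) /center /emb; congr Some.
rewrite -[in LHS](rmorph_int (real_complex R) x.1) -[in LHS](rmorph_int (real_complex R) x.2).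
by move: (tau R ^+ 2) => T; rewrite /= !(rmorphD, rmorphM) /=; ring.
Qed.

Lemma perturbed_allowed : allowed alpha l N om.
Proof.
have small x : `|coord1 (dev x)| <= 2 * rho /\ `|coord2 (dev x)| <= 2 * rho.
  by have [h1 h2] := dev_small x; exact: coord_small.
split.
- move=> x p bx omx xmin.
  have x0 : x = (0, 0).
    have [//|lt|lt] := lex_lt_trichotomy x (0, 0).
      by move: bx lt; rewrite /in_box /lex_lt /=; case: (x) => a b /=; lia.
    have b0 : in_box N (0, 0) by rewrite /in_box /=; lia.
    by have := xmin _ b0 lt; rewrite devE.
  have := perturbed_coords x; rewrite omx => -[->].
  have := small x; rewrite !ler_norml => -[/andP[h1 h2] /andP[h3 h4]].
  have N1 : l <= l * N%:R.
    by rewrite ler_peMr; [|by move: l0; lra|rewrite (ler_nat _ 1)].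
  apply/fundamental_domainP; rewrite (coord_unique _ _).1 (coord_unique _ _).2.
  rewrite x0 /= !mulr0 !add0r -x0; move: l0 rho_small => l0' rs.
  by apply/andP; split; apply/andP; split; lra.
- move=> x y; rewrite adjP => xy _ _.
  have /andP[h1 h2] := perturbed_length x xy.
  rewrite [x + (y - x)]addrC subrK -normcN opprB in h1 h2.
  by move: l_alpha rho_alpha; lra.
- by move=> x y; rewrite occupied.
- have h1 : 2^-1 < l by move: l0; lra.
  have h2 : 100 * (2 * rho) <= 1 by move: rho_small; lra.
  exact: (Omega3_perturbed h1 h2 (fun x => (small x).1) (fun x => (small x).2)
    perturbed_coords).
by move=> x z hz; rewrite !hatE; apply: Im_div_gt0; exact: perturbed_orientation.
Qed.

(** There are no holes, so the bound does not involve [m]; this makes the final estimate uniform in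
    [m]. *)
Lemma perturbed_energy V Vl kappa m :
  (forall r, l - 4 * rho <= r <= l + 4 * rho -> V r <= Vl + kappa) ->
  hamiltonian V m N om <= 3 * (N * N)%:R * (Vl + kappa).
Proof.
move=> hV; rewrite /hamiltonian [X in _ + _ * X]big1 ?mulr0 ?addr0; last first.
  by move=> k _; rewrite occupied.
rewrite exchange_big /=.
apply: (@le_trans _ _ (2^-1 * sum_edges n (fun _ _ => Vl + kappa))); last first.
  by rewrite sum_edges_cst; lra.
rewrite ler_wpM2l//.
apply: (@le_sum_edges R n (fun x z => pair_energy V om x (x + z))) => x z hz.
rewrite /pair_energy !occupied /= -normcN opprB; apply: hV.
exact: perturbed_length.
Qed.

End one_configuration.
End perturbed_box.

(** * The potential near 1 *)

Section convex_potential.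
Variables (R : realType) (D : set R) (V : R -> R).
Hypothesis pV : potential D V.

Let D1 : D 1. Proof. by case: pV. Qed.

Lemma potential_derive r : D r -> is_derive r 1 V (derive1 V r).
Proof.
case: pV => _ _ _ h _ /h[d _ _ _].
by rewrite derive1E; exact: derivableP.
Qed.

Lemma potential_derive2 r : D r -> is_derive r 1 (derive1 V) (derive1 (derive1 V) r).
Proof.
case: pV => _ _ _ h _ /h[_ d _ _].
by rewrite [X in is_derive _ _ _ X]derive1E; exact: derivableP.
Qed.

Lemma potential_continuous r : D r -> {for r, continuous V}.
Proof.
by case: pV => _ _ _ h _ /h[d _ _ _]; apply: differentiable_continuous; exact/derivable1_diffP.
Qed.

Lemma potential_continuous1 r : D r -> {for r, continuous (derive1 V)}.
Proof.
by case: pV => _ _ _ h _ /h[_ d _ _]; apply: differentiable_continuous; exact/derivable1_diffP.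
Qed.

(** With c0 = V''(1) / 4, continuity gives V'' >= 2 c0 near 1, and V'(1) = 0 makes V' as small there
    as [energy_lower_bound] requires. *)
Lemma potential_near : exists alpha0 c0 : R, [/\ 0 < alpha0, alpha0 <= 2^-1, 0 < c0 &
  forall r, `|r - 1| < alpha0 -> [/\ D r, 2 * c0 <= derive1 (derive1 V) r,
    `|derive1 V r| <= c0 / 144 & `|V r| <= `|V 1| + 1]].
Proof.
have [oD _ _ h V10] := pV; have [d1 d2 cV2 V2] := h 1 D1.
have [c0 c00 c0E] : exists2 c0, 0 < c0 & derive1 (derive1 V) 1 = 4 * c0.
  by exists (derive1 (derive1 V) 1 / 4); [rewrite divr_gt0|rewrite mulrC divfK].
have nD : \forall r \near (1 : R), D r by exact: open_nbhs_nbhs.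
have n2 : \forall r \near (1 : R), 2 * c0 <= derive1 (derive1 V) r.
  have := cV2; move/cvgrPdist_lt => /(_ (2 * c0)) H.
  have e0 : 0 < 2 * c0 by rewrite mulr_gt0.
  near=> r; have : `|derive1 (derive1 V) 1 - derive1 (derive1 V) r| < 2 * c0 by near: r; exact: H.
  rewrite c0E ltr_norml; move: (derive1 _ r) => v /andP[_ hv].
  lra.
have n1 : \forall r \near (1 : R), `|derive1 V r| <= c0 / 144.
  have := potential_continuous1 D1; move/cvgrPdist_lt => /(_ (c0 / 144)) H.
  have e0 : 0 < c0 / 144 by rewrite divr_gt0.
  near=> r; have : `|derive1 V 1 - derive1 V r| < c0 / 144 by near: r; exact: H.
  by rewrite V10 sub0r normrN => /ltW.
have n0 : \forall r \near (1 : R), `|V r| <= `|V 1| + 1.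
  have := potential_continuous D1; move/cvgrPdist_lt => /(_ 1 ltr01) H.
  near=> r; have : `|V 1 - V r| < 1 by near: r; exact: H.
  have := ler_normB (V 1) (V 1 - V r); rewrite subKr; lra.
have : \forall r \near (1 : R), [/\ D r, 2 * c0 <= derive1 (derive1 V) r,
    `|derive1 V r| <= c0 / 144 & `|V r| <= `|V 1| + 1].
  by near=> r; split; near: r.
move=> /nbhs_ballP[e /= e0 H].
exists (Num.min e 2^-1), c0; split.
- by rewrite lt_min e0 invr_gt0 ltr0n.
- by rewrite ge_min lexx orbT.
- exact: c00.
move=> r; rewrite lt_min => /andP[re _]; apply: H.
by rewrite /ball /= distrC.
Unshelve. all: by end_near. Qed.

(** Subtracting the linear term and c0 (t - l)^2 from V leaves a function whose derivative has the
    sign of t - l, hence with minimum at l. *)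
Lemma second_order_lower_bound (c0 a b l r : R) :
  (forall t, a < t < b -> D t /\ 2 * c0 <= derive1 (derive1 V) t) ->
  a < l < b -> a < r < b ->
  V l + derive1 V l * (r - l) + c0 * (r - l) ^+ 2 <= V r.
Proof.
move=> hab hl hr.
pose G t := V t - (derive1 V l * t + c0 * (t - l) ^+ 2).
pose dG t := derive1 V t - (derive1 V l + c0 * (2 * (t - l))).
have dGE t : a < t < b -> is_derive t 1 G (dG t).
  move=> /hab[Dt _]; have dV := potential_derive Dt.
  rewrite /G /dG; apply: is_deriveB; apply: is_derive_eq.
  by rewrite -![_ *: _]/(_ * _); ring.
have cG x y : a < x -> y < b -> {within `[x, y], continuous G}.
  move=> ax yb; apply: derivable_within_continuous => t; rewrite in_itv /= => /andP[xt ty].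
  by have /dGE dt : a < t < b by rewrite (lt_le_trans ax)//= (le_lt_trans ty).
have sign t : a < t < b -> 0 <= dG t * (t - l).
  move=> ht.
  have step x y : a < x -> y < b -> x < y ->
      2 * c0 * (y - x) <= derive1 V y - derive1 V x.
    move=> ax yb xy.
    have inab u : x <= u <= y -> a < u < b.
      by move=> /andP[xu uy]; rewrite (lt_le_trans ax)//= (le_lt_trans uy).
    have hd u : u \in `]x, y[ -> is_derive u 1 (derive1 V) (derive1 (derive1 V) u).
      rewrite in_itv /= => /andP[xu uy]; apply: potential_derive2.
      by apply: (hab u _).1; apply: inab; rewrite !ltW.
    have hc : {within `[x, y], continuous (derive1 V)}.
      apply: continuous_in_subspaceT => u; rewrite inE /= in_itv /= => /inab/hab[Du _].
      exact: potential_continuous1.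
    have [u] := MVT xy hd hc.
    rewrite in_itv /= => /andP[xu uy] ->; rewrite ler_wpM2r ?subr_ge0 ?(ltW xy)//.
    by apply: (hab u _).2; apply: inab; rewrite !ltW.
  have [al lb] := andP hl; have [at_ tb] := andP ht.
  rewrite /dG; have [tl|lt|->] := ltgtP t l.
  - by have := step _ _ at_ lb tl; nra.
  - by have := step _ _ al tb lt; nra.
  - by rewrite subrr mulr0.
have Gl : G l = V l - derive1 V l * l by rewrite /G subrr expr0n mulr0 addr0.
have Gr : V l + derive1 V l * (r - l) + c0 * (r - l) ^+ 2 <= V r <-> G l <= G r.
  by rewrite Gl /G; split; lra.
apply/Gr; have [al lb] := andP hl; have [ar rb] := andP hr.
have [rl|lr|->//] := ltgtP r l.
  have hd u : u \in `]r, l[ -> is_derive u 1 G (dG u).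
    by rewrite in_itv /= => /andP[ru ul]; apply: dGE; rewrite (lt_trans ar)//= (lt_trans ul).
  have [u] := MVT rl hd (cG _ _ ar lb).
  rewrite in_itv /= => /andP[ru ul]; have := sign u.
  rewrite (lt_trans ar ru) (lt_trans ul lb) => /(_ isT) s E.
  by rewrite -subr_ge0 -opprB E; nra.
have hd u : u \in `]l, r[ -> is_derive u 1 G (dG u).
  by rewrite in_itv /= => /andP[ru ul]; apply: dGE; rewrite (lt_trans al)//= (lt_trans ul).
have [u] := MVT lr hd (cG _ _ al rb).
rewrite in_itv /= => /andP[ru ul]; have := sign u.
rewrite (lt_trans al ru) (lt_trans ul rb) => /(_ isT) s E.
by rewrite -subr_ge0 E; nra.
Qed.

(* Only the values of [V] on the interval matter, and there it is continuous. *)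
Lemma measurable_potential a b : (forall t, a < t < b -> D t) ->
  measurable_fun [set: R] (V \_ `]a, b[%classic).
Proof.
move=> hab; apply/(measurable_restrictT _ _).1 => //.
apply: open_continuous_measurable_fun; first exact: interval_open.
by move=> t; rewrite inE /= in_itv /= => /hab; exact: potential_continuous.
Qed.

End convex_potential.

(** * The lattice action on tuples, and truncation of the potential *)

Section lattice_action.
Variables (R : realType) (n : nat) (l : R).
Local Notation N := n.+1.
Local Notation space := ((N * N).-tuple (option (plane R))).

Lemma shift0 (w : space) : shift l 0 w = w.
Proof.
by apply: (@extend_inj R n l); rewrite extend_shift; apply/funext => x; rewrite addr0.
Qed.

Lemma shiftD y z (w : space) : shift l y (shift l z w) = shift l (y + z) w.
Proof.
by apply: (@extend_inj R n l); rewrite !extend_shift; apply/funext => x; rewrite addrA.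
Qed.

End lattice_action.

Lemma eq_hamiltonian (R : realType) (V V' : R -> R) alpha m N (om : config R) :
  Omega1 alpha om -> (forall r, 1 - alpha < r < 1 + alpha -> V r = V' r) ->
  hamiltonian V m N om = hamiltonian V' m N om.
Proof.
move=> om1 VV'; rewrite /hamiltonian; congr (2^-1 * _ + _).
apply: eq_bigr => k _; rewrite !big_seq; apply: eq_bigr => z hz.
rewrite /pair_energy; case: ifPn => // /norP[hx hy]; apply: VV'; apply: om1 => //.
by rewrite adjP addrC addKr.
Qed.

(** Bond lengths in [Omega] lie between 1 - alpha and 1 + alpha. A total [V], arbitrary elsewhere,
    can thus be exchanged for a measurable truncation. *)
Lemma eq_gibbs (R : realType) (V V' : R -> R) alpha l beta m N :
  (forall r, 1 - alpha < r < 1 + alpha -> V r = V' r) ->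
  gibbs V alpha l beta m (N := N) = gibbs V' alpha l beta m (N := N).
Proof.
move=> VV'.
have gE w : @Omega R alpha l N w -> gibbs_weight V l beta m w = gibbs_weight V' l beta m w.
  by move=> [_ om1 _ _ _]; rewrite /gibbs_weight (eq_hamiltonian m N om1 VV').
have ZE : partition_function V alpha l beta m N = partition_function V' alpha l beta m N.
  by apply: eq_integral => w; rewrite inE; exact: gE.
apply/funext => A; rewrite /gibbs ZE.
suff -> : (\int[mu (N := N)]_(w in A `&` @Omega R alpha l N) gibbs_weight V l beta m w =
    \int[mu (N := N)]_(w in A `&` @Omega R alpha l N) gibbs_weight V' l beta m w)%E by [].
by apply: eq_integral => w; rewrite inE => -[_]; exact: gE.
Qed.

(** * Energy against entropy at fixed beta *)

Section deviation_bound.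
Variables (R : realType) (n : nat) (V : R -> R) (alpha l beta m c0 C0 V1 : R).
Local Notation N := n.+1.
Local Notation space := ((N * N).-tuple (option (plane R))).
Local Notation bp := (@box_point N).
Local Notation muN := (power_measure (hole_measure (@plane_measure R)) (N * N)).
Local Notation Om := (@Omega R alpha l N).
Local Notation g := (gibbs_weight V l beta m (N := N)).
Local Notation f x z := (fun w : space => sq_deviation l (extend l w) x z).
Hypothesis N1 : (1 < N)%N.
Hypothesis alpha2 : alpha < 2^-1.
Hypothesis l_alpha : 1 - alpha / 2 < l < 1 + alpha / 2.
Hypothesis beta0 : 0 < beta.
Hypothesis mV : measurable_fun [set: R] V.
Hypothesis V_convex : forall r, 1 - alpha < r < 1 + alpha ->
  V l + V1 * (r - l) + c0 * (r - l) ^+ 2 <= V r.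
Hypothesis c00 : 0 < c0.
Hypothesis V1_small : `|V1| <= c0 / 144.
Hypothesis Vl_le : `|V l| <= C0.
Hypothesis m_large : 6 * C0 + 100 * c0 <= m.

Let l0 : 3 / 4 < l < 5 / 4. Proof. by move: l_alpha alpha2; lra. Qed.

Let c288 : 0 < c0 / 288. Proof. by rewrite divr_gt0 ?ltr0n. Qed.

Let g0 (w : space) : (0 <= g w)%E.
Proof. by rewrite lee_fin expR_ge0. Qed.

Let mg : measurable_fun [set: space] g.
Proof. exact: measurable_gibbs_weight. Qed.

Lemma sq_deviation_ge0 (om : config R) x z : 0 <= sq_deviation l om x z.
Proof. by rewrite /sq_deviation; case: ifP => // _; rewrite sqr_ge0. Qed.

Lemma sq_deviation_le (w : space) x z : z \in nbrs -> Om w -> f x z w <= 16.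
Proof.
move=> hz [_ om1 _ _ _]; rewrite /sq_deviation; case: ifPn => // /norP[hxz hx].
have /andP[_] : 1 - alpha < normc (pos (extend l w) x - pos (extend l w) (x + z)) < 1 + alpha.
  by apply: om1 => //; rewrite adjP addrC addKr.
move=> h; rewrite normc_sqr.
have : sqn (pos (extend l w) x - pos (extend l w) (x + z)) <= (3 / 2) ^+ 2.
  rewrite -normc_sqr ler_pXn2r ?nnegrE ?normc_ge0//; first by move: h alpha2; lra.
have := sqn_emb R hz; move: (pos _ x) (pos _ (x + z)) (emb R z) => -[a1 a2] [b1 b2] [e1 e2].
rewrite /sqn /=; have := l0.
move: l => t /andP[t1 t2] he hd.
have ht : t ^+ 2 <= 2 by nra.
have : (t * e1) ^+ 2 + (t * e2) ^+ 2 <= 2.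
  by rewrite !exprMn -mulrDr he mulr1.
rewrite !mul0r !subr0 !addr0; move: (t * e1) (t * e2) => u1 u2 hu.
have := sqr_ge0 (b1 - a1 + u1); have := sqr_ge0 (b2 - a2 + u2).
by move: hd hu; rewrite !expr2; lra.
Qed.

Definition total_deviation z (w : space) := \sum_k f (bp k) z w.

Lemma total_deviation_ge0 z w : 0 <= total_deviation z w.
Proof. by apply: sumr_ge0 => k _; exact: sq_deviation_ge0. Qed.

Lemma measurable_total_deviation z : measurable_fun [set: space] (total_deviation z).
Proof. by apply: measurable_sum => k; exact: measurable_sq_deviation. Qed.

Lemma total_deviation_energy z w : z \in nbrs -> Om w ->
  3 * (N * N)%:R * V l + c0 / 288 * total_deviation z w <= hamiltonian V m N (extend l w).
Proof.
move=> hz [_ om1 om2 _ om4].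
have l2 : 2^-1 < l < 3 / 2 by move: l0; lra.
have := energy_lower_bound alpha2 l2 (extend_periodic l w isT) om1 om2 om4
  V_convex c00 V1_small Vl_le m_large.
apply: le_trans; rewrite lerD2l (ler_pM2l c288) /sum_edges (big_rem z)//.
apply: ler_wpDr.
  by apply: sumr_ge0 => y _; apply: sumr_ge0 => k _; exact: sqn_ge0.
apply: ler_sum => k _; rewrite /sq_deviation; case: ifPn => [_|/norP[h1 h2]]; first exact: sqn_ge0.
by rewrite normc_sqr grad_displacement /grad !fill_pos.
Qed.

Local Notation Z := (partition_function V alpha l beta m N).
Local Notation rate t := (3 * (N * N)%:R * V l + c0 / 288 * t).

Lemma weight_event_le t z A : z \in nbrs -> measurable A -> A `<=` Om ->
  (forall w, A w -> t <= total_deviation z w) ->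
  (\int[muN]_(w in A) g w <= (expR (- (beta * rate t)) * 8260 ^+ (N * N))%:E)%E.
Proof.
move=> hz mA AOm At; set K := expR _.
have le_K w : A w -> (g w <= K%:E)%E.
  move=> Aw; rewrite lee_fin ler_expR lerN2 ler_pM2l//.
  apply: le_trans (total_deviation_energy hz (AOm _ Aw)).
  by rewrite lerD2l (ler_pM2l c288); exact: At.
apply: (@le_trans _ _ (\int[muN]_(w in A) K%:E)%E).
  by apply: ge0_le_integral => //; exact: measurable_funTS.
rewrite integral_cst// EFinM lee_wpmul2l ?lee_fin ?expR_ge0//.
have [a1 l02] : alpha <= 1 /\ 0 < l < 2 by move: alpha2 l0; lra.
exact: (Omega_volume a1 l02 N1 AOm).
Qed.

(** This is [weight_event_le] at t = 0, applied to measurable subsets of [Omega] and passed to their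
    supremum. *)
Lemma partition_function_lty : (Z < +oo)%E.
Proof.
have h : (Z <= (expR (- (beta * rate 0)) * 8260 ^+ (N * N))%:E)%E.
  rewrite /partition_function [leLHS](integral_inner muN g0).
  apply: ge_ereal_sup => _ [S [mS SOm] <-].
  by apply: (weight_event_le (z := unit1)) => // w _; exact: total_deviation_ge0.
exact: le_lt_trans h (ltry _).
Qed.

Lemma partition_function_ge rho kappa : 0 < rho -> 8 * rho <= alpha -> 200 * rho <= 1 ->
  (forall r, l - 4 * rho <= r <= l + 4 * rho -> V r <= V l + kappa) ->
  ((expR (- (beta * (3 * (N * N)%:R * (V l + kappa)))) * (4 * rho ^+ 2) ^+ (N * N))%:E <= Z)%E.
Proof.
move=> rho0 rho_a rho_s hV; set K := expR _.
have alpha2' := ltW alpha2.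
have BOm : @perturbed_box R n l rho `<=` Om.
  by move=> w; exact: (perturbed_allowed alpha2' l_alpha rho0 rho_a rho_s).
apply: le_trans (ge0_subset_integral_nonmeasurable muN g0 BOm).
have mB := @measurable_perturbed_box R n l rho.
apply: (@le_trans _ _ (\int[muN]_(w in @perturbed_box R n l rho) K%:E)%E).
  by rewrite integral_cst// EFinM -(perturbed_box_volume n l rho0).
apply: ge0_le_integral => //.
- by move=> w _; rewrite lee_fin expR_ge0.
- exact: measurable_funTS.
move=> w Bw; rewrite lee_fin ler_expR lerN2 ler_pM2l//.
exact: (perturbed_energy alpha2' l_alpha Bw).
Qed.

(** Relabelling by x - y carries the bond at y to the bond at x, so the mean at [x] is at most the
    mean at any other site; this is summed over the box. *)
Lemma mean_le_average (B : set space) x z : measurable B -> B `<=` Om -> z \in nbrs ->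
  (forall A, measurable A ->
    \int[muN]_(w in A `&` Om) g w = \int[muN]_(w in A `&` B) g w)%E ->
  ((N * N)%:R%:E * \int[muN]_(w in B) ((f x z w)%:E * g w) <=
   \int[muN]_(w in B) ((total_deviation z w)%:E * g w))%E.
Proof.
move=> mB BOm hz BK.
have lN0 : 0 < l * N%:R by rewrite mulr_gt0 ?ltr0n//; move: l0; lra.
have inv y : (\int[muN]_(w in B) ((f x z w)%:E * g w) <=
    \int[muN]_(w in B) ((f y z w)%:E * g w))%E.
  rewrite (eq_integral (fun w => (f y z (shift l (x - y) w))%:E * g w)%E); last first.
    by move=> w _; rewrite sq_deviation_shift addrC subrK.
  apply: (@action_integral_le _ _ _ muN (@shift R n l) N _ _ _ _ Om (@normalized_set R n l) _ _ _ 16) => //.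
  - exact: measurable_shift.
  - exact: mu_shift.
  - exact: shift0.
  - exact: shiftD.
  - exact: measurable_normalized_set.
  - by move=> w [].
  - by move=> w u; exact: Omega_shift.
  - move=> w u [_ _ om2 _ _].
    have [q hq] := normalized_exists lN0 u N1 (extend_periodic l w isT) om2.
    by exists q; rewrite /normalized_set /= extend_shift.
  - move=> w u q q' [_ _ om2 _ _]; rewrite /normalized_set /= !extend_shift.
    exact: (normalized_unique N1 (extend_periodic l w isT) om2).
  - by move=> u w; exact: gibbs_weight_shift.
  - by move=> w; exact: sq_deviation_ge0.
  - exact: measurable_sq_deviation.
  - by move=> q w; rewrite sq_deviation_shift sq_deviation_period//; exact: extend_periodic.
  - by move=> w; exact: sq_deviation_le.
have mfg y : measurable_fun B (fun w => (f y z w)%:E * g w)%E.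
  apply: measurable_funTS; apply: emeasurable_funM => //.
  by apply/measurable_EFinP; exact: measurable_sq_deviation.
have fg0 y w : (0 <= (f y z w)%:E * g w)%E.
  by rewrite mule_ge0// lee_fin sq_deviation_ge0.
have -> : (\int[muN]_(w in B) ((total_deviation z w)%:E * g w) =
    \sum_(k : 'I_N * 'I_N) \int[muN]_(w in B) ((f (bp k) z w)%:E * g w))%E.
  rewrite -ge0_integral_sum//; apply: eq_integral => w _.
  rewrite /total_deviation -sumEFin ge0_sume_distrl// => k _.
  by rewrite lee_fin sq_deviation_ge0.
apply: (@le_trans _ _ (\sum_(k : 'I_N * 'I_N) \int[muN]_(w in B) ((f x z w)%:E * g w))%E).
  by rewrite sumr_const card_prod !card_ord mule_natl.
by apply: lee_sum => k _; exact: inv.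
Qed.

(** Where the total deviation is below [t], it is replaced by [t]; elsewhere it is at most 16 N^2,
    and [weight_event_le] bounds the weight of that event. *)
Lemma truncated_mean_le (B : set space) t z : measurable B -> B `<=` Om -> 0 <= t -> z \in nbrs ->
  (\int[muN]_(w in B) ((total_deviation z w)%:E * g w) <=
   t%:E * \int[muN]_(w in B) g w +
   (16 * (N * N)%:R)%:E * (expR (- (beta * rate t)) * 8260 ^+ (N * N))%:E)%E.
Proof.
move=> mB BOm t0 hz; set W := (X in (_ + _ * X)%E).
have mF := measurable_total_deviation z.
pose A := [set w | t <= total_deviation z w].
have mA : measurable A.
  rewrite (_ : A = total_deviation z @^-1` `[t, +oo[%classic).
    by rewrite -[X in measurable X]setTI; apply: mF.
  by apply/seteqP; split=> w; rewrite /A /= in_itv /= andbT.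
have mFg (S : set space) : measurable_fun S (fun w => (total_deviation z w)%:E * g w)%E.
  by apply: measurable_funTS; apply: emeasurable_funM => //; exact/measurable_EFinP.
have Fg0 w : (0 <= (total_deviation z w)%:E * g w)%E.
  by rewrite mule_ge0// lee_fin total_deviation_ge0.
have mcg c (S : set space) : measurable_fun S (fun w => c%:E * g w)%E.
  by apply: measurable_funTS; exact: measurable_funeM.
have mBA : measurable (B `&` A) by exact: measurableI.
have mBDA : measurable (B `\` A) by exact: measurableD.
have C0' : 0 <= 16 * (N * N)%:R :> R by rewrite mulr_ge0 ?ler0n.
have FC w : Om w -> total_deviation z w <= 16 * (N * N)%:R.
  move=> Omw; apply: (@le_trans _ _ (\sum_(k : 'I_N * 'I_N) 16)).
    by apply: ler_sum => k _; exact: sq_deviation_le.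
  by rewrite sumr_const card_prod !card_ord mulr_natr.
rewrite -{1}(setUIDK B A) [B `&` A `|` _]setUC ge0_integral_setU//; last first.
  by apply/disj_setPS => w [[_ nA] [_ /nA]].
apply: leeD.
  apply: (@le_trans _ _ (\int[muN]_(w in B `\` A) (t%:E * g w))%E).
    apply: ge0_le_integral => //.
    move=> w [Bw /negP nA]; apply: lee_wpmul2r => //; rewrite lee_fin.
    by apply: ltW; rewrite ltNge.
  rewrite ge0_integralZl//; last exact: measurable_funTS.
  apply: lee_wpmul2l; first by rewrite lee_fin.
  by apply: ge0_subset_integral_nonmeasurable => // w [].
apply: (@le_trans _ _ (\int[muN]_(w in B `&` A) ((16 * (N * N)%:R)%:E * g w))%E).
  apply: ge0_le_integral => //.
  by move=> w [Bw _]; apply: lee_wpmul2r => //; rewrite lee_fin; apply/FC/BOm.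
rewrite ge0_integralZl//; last exact: measurable_funTS.
apply: lee_wpmul2l; first by rewrite lee_fin.
by apply: (weight_event_le hz mBA) => [w [/BOm]|w [_]].
Qed.

(* Per site: entropy [8260] against the volume of the perturbed squares, times the
   Boltzmann factor of the energy excess. *)
Definition decay eps rho kappa :=
  8260 / (4 * rho ^+ 2) * expR (- (beta * (c0 / 288 * eps - 3 * kappa))).

Lemma decay_ge0 eps rho kappa : 0 < rho -> 0 <= decay eps rho kappa.
Proof.
move=> rho0; have r2 : 0 <= rho ^+ 2 := sqr_ge0 _.
have c4 : (0 : R) <= 4 by rewrite ler0n.
have c8 : (0 : R) <= 8260 by rewrite ler0n.
by apply: mulr_ge0; [exact: divr_ge0 c8 (mulr_ge0 c4 r2)|exact: expR_ge0].
Qed.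

(** With t = eps N^2 all exponents are multiples of N^2, and the ground energy 3 N^2 V(l) is common
    to both sides. *)
Lemma weight_ratio eps rho kappa : 0 < rho ->
  expR (- (beta * rate (eps * (N * N)%:R))) * 8260 ^+ (N * N) =
  decay eps rho kappa ^+ (N * N) *
  (expR (- (beta * (3 * (N * N)%:R * (V l + kappa)))) * (4 * rho ^+ 2) ^+ (N * N)).
Proof.
move=> rho0; rewrite /decay; move: (N * N)%N => M.
have v0 : 4 * rho ^+ 2 != 0 by rewrite mulf_neq0 ?pnatr_eq0 ?expf_neq0 ?gt_eqF.
move: (4 * rho ^+ 2) v0 (8260 : R) => v v0 a.
rewrite !exprMn exprVn -expRM_natr.
set e := expR _; set e1 := expR _; set e2 := expR _.
have -> : e = e1 * e2 by rewrite /e /e1 /e2 -expRD; congr expR; ring.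
have : v ^+ M != 0 by rewrite expf_neq0.
by move: (v ^+ M) (a ^+ M) => v' a' hv; field.
Qed.

Lemma mean_deviation_le eps rho kappa x z : z \in nbrs -> 0 < eps ->
  0 < rho -> 8 * rho <= alpha -> 200 * rho <= 1 ->
  (forall r, l - 4 * rho <= r <= l + 4 * rho -> V r <= V l + kappa) ->
  decay eps rho kappa <= 1 ->
  (0 <= \int[gibbs V alpha l beta m (N := N)]_w (f x z w)%:E <=
   (eps + 16 * decay eps rho kappa)%:E)%E.
Proof.
move=> hz eps0 rho0 rho_a rho_s hV decay1.
have [B [mB BOm BK]] := inner_kernel (mu := muN) g0 mg partition_function_lty.
have Zge := partition_function_ge rho0 rho_a rho_s hV.
have ratio := weight_ratio eps kappa rho0.
move: Zge ratio; set L := (X in (X%:E <= _)%E); set W := (X in X = _) => Zge ratio.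
have L0 : 0 < L.
  by rewrite mulr_gt0 ?expR_gt0// exprn_gt0// mulr_gt0 ?ltr0n// exprn_gt0.
have ZB : (Z = \int[muN]_(w in B) g w)%E.
  by have := BK _ measurableT; rewrite !setTI.
have [r ZE] : exists r, (Z = r%:E)%E.
  move: partition_function_lty Zge; case: (Z) => [r _ _|//|//]; by exists r.
have Lr : L <= r by move: Zge; rewrite ZE lee_fin.
have r0 : 0 < r by exact: lt_le_trans Lr.
have Zinv : (Z^-1 = r^-1%:E)%E by rewrite ZE inver gt_eqF.
have mf : measurable_fun [set: space] (f x z) by exact: measurable_sq_deviation.
have f0 w : 0 <= f x z w by exact: sq_deviation_ge0.
have gibbsE A : measurable A -> (gibbs V alpha l beta m (N := N) A =
    r^-1%:E * \int[muN]_(w in A `&` B) g w)%E.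
  by move=> mA; rewrite /gibbs Zinv; congr (_ * _)%E; exact: BK.
have rV0 : (0 <= r^-1%:E :> \bar R)%E by rewrite lee_fin invr_ge0 ltW.
have /andP[-> /= h] := integral_le_density g0 mg rV0 mB mf f0 gibbsE.
apply: (le_trans h); rewrite lee_pdivrMl//.
have M0 : 0 < (N * N)%:R :> R by rewrite ltr0n.
rewrite -(@lee_pmul2l _ (N * N)%:R%:E) ?lte_fin//.
have t0 : 0 <= eps * (N * N)%:R by rewrite mulr_ge0 ?ltW.
apply: (le_trans (mean_le_average x mB BOm hz BK)).
apply: (le_trans (truncated_mean_le mB BOm t0 hz)).
rewrite -ZB ZE -/W -!EFinM -EFinD lee_fin ratio.
have d0 := decay_ge0 eps kappa rho0.
(* Uniformity in [N] arises here: a number in [0, 1] bounds its N^2-th power. *)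
have dM : decay eps rho kappa ^+ (N * N) <= decay eps rho kappa.
  have -> : (N * N)%N = (N * N).-1.+1 by [].
  by rewrite exprS ler_piMr ?exprn_ile1.
have dL : decay eps rho kappa ^+ (N * N) * L <= decay eps rho kappa * r.
  by apply: ler_pM => //; [rewrite exprn_ge0|exact: ltW].
have -> : (N * N)%:R * (r * (eps + 16 * decay eps rho kappa)) =
    eps * (N * N)%:R * r + 16 * (N * N)%:R * (decay eps rho kappa * r) by ring.
by rewrite lerD2l ler_wpM2l// mulr_ge0 ?ler0n.
Qed.

End deviation_bound.

(** * The limit of large beta *)

Lemma gibbs_deviation_uniform (R : realType) (D : set R) (V : R -> R) :
  potential D V -> exists alpha0 m0 : R, 0 < alpha0 /\
    forall alpha, 0 < alpha < alpha0 -> admissible D alpha /\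
    forall l, 1 - alpha / 2 < l < 1 + alpha / 2 -> forall e, 0 < e ->
      \forall beta \near +oo, forall N m x z, (5 <= N)%N -> m0 <= m -> z \in nbrs ->
      (0 <= \int[gibbs V alpha l beta m (N := N)]_w
              (sq_deviation l (extend l w) x z)%:E <= e%:E)%E.
Proof.
move=> pV; have [a0 [c0 [a00 a02 c00 near1]]] := potential_near pV.
(* The threshold for [m] in [energy_lower_bound], with the bound |V 1| + 1 for V near 1 as [C0]. *)
exists a0, (6 * (`|V 1| + 1) + 100 * c0); split=> // alpha /andP[al0 ala0].
have near r : 1 - alpha <= r <= 1 + alpha -> [/\ D r, 2 * c0 <= derive1 (derive1 V) r,
    `|derive1 V r| <= c0 / 144 & `|V r| <= `|V 1| + 1].
  move=> hr; apply: near1; apply: le_lt_trans ala0; rewrite ler_norml; move: hr; lra.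
have near' r : 1 - alpha < r < 1 + alpha -> 1 - alpha <= r <= 1 + alpha.
  by move=> /andP[/ltW -> /ltW ->].
split.
  split=> //; first by move: a02 ala0; lra.
  by move=> r; rewrite /= in_itv /= => /near[].
move=> l l_alpha e e0.
have l_near : 1 - alpha < l < 1 + alpha by move: l_alpha al0; lra.
have [Dl _ V1l Vl] := near _ (near' _ l_near).
pose Vt := V \_ `]1 - alpha, 1 + alpha[%classic.
have VtE r : 1 - alpha < r < 1 + alpha -> Vt r = V r.
  by move=> hr; rewrite /Vt patchT// inE /= in_itv.
have mVt : measurable_fun [set: R] Vt.
  by apply: (measurable_potential pV) => t /near'/near[].
(* This [kappa] makes 3 kappa half of the gain c0 eps / 288, so a positive rate remains. *)
pose eps := e / 2; pose kappa := c0 * eps / 1728.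
have eps0 : 0 < eps by rewrite divr_gt0 ?ltr0n.
have kappa0 : 0 < kappa by rewrite divr_gt0 ?ltr0n// mulr_gt0.
have [d d0 hd] : exists2 d, 0 < d & forall r, `|l - r| < d -> V r <= V l + kappa.
  have /cvgrPdist_lt/(_ _ kappa0)/nbhs_ballP[d /= d0 hd] := potential_continuous pV Dl.
  exists d => // r /hd; rewrite ltr_norml => /andP[h _].
  by move: h; move: (V r) (V l) (kappa) => u v k; clear; lra.
have [rho [rho0 rho_a rho_s rho_d]] : exists rho,
    [/\ 0 < rho, 8 * rho <= alpha, 200 * rho <= 1 & 8 * rho <= d].
  exists (Num.min (alpha / 8) (Num.min (1 / 200) (d / 8))).
  have := ge_min; split.
  - by rewrite !lt_min !divr_gt0 ?ltr0n.
  - by rewrite mulrC -ler_pdivlMr ?ltr0n// ge_min lexx.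
  - by rewrite mulrC -ler_pdivlMr ?ltr0n// !ge_min lexx !orbT.
  - by rewrite mulrC -ler_pdivlMr ?ltr0n// !ge_min lexx !orbT.
(* The remainder 16 * eta is then at most e / 2, the half of e left by [eps]. *)
pose eta := Num.min 1 (e / 32).
have eta0 : 0 < eta by rewrite lt_min ltr01 divr_gt0 ?ltr0n.
pose a := 8260 / (4 * rho ^+ 2); pose delta := c0 / 288 * eps - 3 * kappa.
have deltaE : delta = c0 * eps / 576 by rewrite /delta /kappa; field.
have delta0 : 0 < delta by rewrite deltaE divr_gt0 ?ltr0n// mulr_gt0.
have a0' : 0 < a by rewrite divr_gt0 ?ltr0n// mulr_gt0 ?ltr0n// exprn_gt0.
(* From exp(x) >= 1 + x. The threshold for beta involves neither [N] nor [m] nor the bond. *)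
have decay_le beta : a / (delta * eta) < beta -> decay beta c0 eps rho kappa <= eta.
  move=> hb; rewrite /decay -/a -/delta expRN ler_pdivrMr ?expR_gt0//.
  move: hb; rewrite ltr_pdivrMr ?mulr_gt0// => /ltW hb; apply: (le_trans hb).
  have -> : beta * (delta * eta) = eta * (beta * delta) by ring.
  rewrite ler_pM2l//; apply: le_trans (expR_ge1Dx _).
  by rewrite lerDr.
near=> beta.
have hb : a / (delta * eta) < beta by near: beta; apply: nbhs_pinfty_gt; rewrite num_real.
have beta0 : 0 < beta by apply: lt_trans hb; rewrite divr_gt0// mulr_gt0.
move=> [//|n] m x z N5 hm hz.
have N1 : (1 < n.+1)%N by apply: leq_trans N5.
have al2 : alpha < 2^-1 by exact: lt_le_trans ala0 a02.
have VtVE r : 1 - alpha < r < 1 + alpha -> V r = Vt r by move=> /VtE.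
have convex r : 1 - alpha < r < 1 + alpha ->
    Vt l + derive1 V l * (r - l) + c0 * (r - l) ^+ 2 <= Vt r.
  move=> hr; rewrite !VtE//; apply: (second_order_lower_bound pV (a := 1 - alpha) (b := 1 + alpha)) => //.
  by move=> t /near'/near[].
have Vtl : `|Vt l| <= `|V 1| + 1 by rewrite VtE.
have hV r : l - 4 * rho <= r <= l + 4 * rho -> Vt r <= Vt l + kappa.
  move=> hr; rewrite !VtE//; last by move: hr l_alpha rho_a; clear; lra.
  by apply: hd; rewrite ltr_norml; move: hr rho_d rho0; clear; lra.
have deta := decay_le _ hb.
have d1 : decay beta c0 eps rho kappa <= 1.
  by apply: (le_trans deta); rewrite /eta ge_min lexx.
have de : decay beta c0 eps rho kappa <= e / 32.
  by apply: (le_trans deta); rewrite /eta ge_min lexx orbT.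
rewrite (eq_gibbs _ _ _ _ VtVE).
have /andP[-> h] := mean_deviation_le N1 al2 l_alpha beta0 mVt convex c00 V1l Vtl hm
  x hz eps0 rho0 rho_a rho_s hV d1.
apply: (le_trans h); rewrite lee_fin /eps.
by move: de; move: (decay _ _ _ _ _) => u; clear; lra.
Unshelve. all: by end_near. Qed.

Theorem corollary1p2 (R : realType) (D : set R) (V : R -> R) :
  potential D V ->
  exists alpha0 m0 : R, 0 < alpha0 /\
    forall alpha : R, 0 < alpha < alpha0 -> admissible D alpha /\
      forall l : R, 1 - alpha / 2 < l < 1 + alpha / 2 ->
        ereal_sup [set ereal_sup [set ereal_sup [set ereal_sup
            [set (\int[gibbs V alpha l beta m (N := N)]_w
                    (sq_deviation l (extend l w) x z)%:E)%E
            | z in [set` nbrs]]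
            | x in [set: A2]]
            | m in [set m : R | m0 <= m]]
            | N in [set N : nat | (5 <= N)%N]]
          @[beta --> +oo] --> (0 : \bar R).
Proof.
move=> /gibbs_deviation_uniform[alpha0 [m0 [alpha00 H]]].
exists alpha0, m0; split=> // alpha /H[adm {}H]; split=> // l /H {}H.
set S := (S in S @ _ --> _).
have bound e : 0 < e -> \forall beta \near +oo, (0 <= S beta <= e%:E)%E.
  move=> /H; apply: filterS => beta h; apply/andP; split.
    (* A supremum over the empty set would be -oo; one admissible choice of indices makes the nested
       suprema nonnegative. *)
    have /andP[h0 _] := h 5%N m0 0 unit1 isT (lexx _) isT; apply: (le_trans h0).
    apply: le_ereal_sup_tmp; eexists; first by exists 5%N.
    apply: le_ereal_sup_tmp; eexists; first by exists m0 => /=.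
    apply: le_ereal_sup_tmp; eexists; first by exists 0.
    by apply: ereal_sup_ubound; exists unit1.
  apply: ge_ereal_sup => _ [N N5 <-]; apply: ge_ereal_sup => _ [m hm <-].
  apply: ge_ereal_sup => _ [x _ <-]; apply: ge_ereal_sup => _ [z hz <-].
  by have /andP[] := h N m x z N5 hm hz.
have fin beta e : (0 <= S beta <= e%:E)%E -> S beta \is a fin_num.
  by move=> /andP[h0 h1]; rewrite ge0_fin_numE// (le_lt_trans h1)// ltry.
apply/fine_cvgP; split.
  by have := bound _ ltr01; apply: filterS => beta /fin.
apply/cvgrPdist_le => e /bound; apply: filterS => beta /= h.
have /andP[h0 h1] := h.
by rewrite sub0r normrN ger0_norm ?fine_ge0// -lee_fin fineK// (fin _ _ h).
Qed.
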